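(* There exists an algorithm which, given as input an endomorphism $\psi$ of the free group $F_2$ of rank two, outputs a basis (free generating set) of the stable image $\psi^{\infty}(F_2)=\bigcap_{i=1}^{\infty}\psi^i(F_2)$.
   Context: $F_2=F(a,b)$ is the free group on a fixed basis $a,b$. An endomorphism $\psi$ is given as input by the two words $\psi(a),\psi(b)$. The basis of the trivial subgroup is the empty set. *)

(* Defs.v *)
From HB Require Import structures.
From mathcomp Require Export all_boot.
From mathcomp Require Export classical_sets.

Set Implicit Arguments.
Unset Strict Implicit.
Unset Printing Implicit Defensive.

Local Open Scope group_scope.

Section FreeGroup.
Variable X : choiceType.

(* The letter (x, false) is the generator x, and (x, true) is its inverse. *)
Definition letter : Type := (X * bool)%type.

Definition letter_inv (l : letter) : letter := (l.1, ~~ l.2).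

Definition reduced (w : seq letter) : bool :=
  sorted (fun l m => m != letter_inv l) w.

(* The free group on X: its elements are the reduced words. *)
Record freegroup : Type :=
  FreeGroup { word : seq letter; word_reduced : reduced word }.

HB.instance Definition _ := [isSub for word].
HB.instance Definition _ := [Choice of freegroup by <:].

Definition push (l : letter) (w : seq letter) : seq letter :=
  if w is m :: w' then if m == letter_inv l then w' else l :: w else [:: l].

Definition reduce (w : seq letter) : seq letter := foldr push [::] w.

Lemma letter_invK : involutive letter_inv.
Proof. by case=> x b; rewrite /letter_inv negbK. Qed.

Lemma push_reduced l w : reduced w -> reduced (push l w).
Proof.
case: w => //= m w rw; case: eqP => [_|/eqP neq].
  exact: path_sorted rw.
by rewrite /= neq rw.
Qed.

Lemma foldr_push_reduced v w : reduced v -> reduced (foldr push v w).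
Proof. by move=> rv; elim: w => //= l w; apply: push_reduced. Qed.

Lemma reduce_reduced w : reduced (reduce w).
Proof. exact: foldr_push_reduced. Qed.

Lemma reduce_id w : reduced w -> reduce w = w.
Proof.
elim: w => //= l w IHw rw; rewrite IHw; last exact: path_sorted rw.
by case: w rw {IHw} => //= m w /andP[/negbTE-> _].
Qed.

Lemma pushK l w : reduced w -> push l (push (letter_inv l) w) = w.
Proof.
case: w => [|m w] /=; first by rewrite eqxx.
rewrite letter_invK; case: (eqVneq m l) => [-> | _ _] /=; last by rewrite eqxx.
by case: w => //= k w /andP[/negbTE-> _].
Qed.

Lemma foldr_push_push l v w : reduced w ->
  foldr push w (push l v) = push l (foldr push w v).
Proof.
move=> rw; case: v => //= m v; case: eqP => //= ->.
by rewrite pushK ?foldr_push_reduced.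
Qed.

Lemma foldr_push_reduce v w : reduced w ->
  foldr push w (reduce v) = foldr push w v.
Proof. by move=> rw; elim: v => //= l v IHv; rewrite foldr_push_push// IHv. Qed.

Lemma reduce_cat v w : reduce (v ++ w) = foldr push (reduce w) v.
Proof. exact: foldr_cat. Qed.

Lemma reduce_catl v w : reduce (reduce v ++ w) = reduce (v ++ w).
Proof. by rewrite !reduce_cat foldr_push_reduce// reduce_reduced. Qed.

Lemma reduce_catr v w : reduce (v ++ reduce w) = reduce (v ++ w).
Proof. by rewrite !reduce_cat (reduce_id (reduce_reduced w)). Qed.

Definition word_inv (w : seq letter) : seq letter := rev (map letter_inv w).

Lemma word_invK : involutive word_inv.
Proof. by move=> w; rewrite /word_inv map_rev revK (mapK letter_invK). Qed.

Lemma word_inv_reduced w : reduced w -> reduced (word_inv w).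
Proof.
rewrite /reduced /word_inv rev_sorted sorted_map; apply: sub_sorted => l m /=.
by rewrite letter_invK; apply: contraNneq => ->.
Qed.

Lemma reduce_wordV w : reduce (w ++ word_inv w) = [::].
Proof.
elim: w => // l w IHw; rewrite /word_inv map_cons rev_cons -cats1 cat_cons catA.
rewrite /= -[reduce _]reduce_catl IHw.
exact: pushK.
Qed.

Definition free_of_word (w : seq letter) : freegroup :=
  FreeGroup (reduce_reduced w).

Definition free_one : freegroup := @FreeGroup [::] isT.

Definition free_inv (u : freegroup) : freegroup :=
  FreeGroup (word_inv_reduced (word_reduced u)).

Definition free_mul (u v : freegroup) : freegroup :=
  free_of_word (word u ++ word v).

Lemma free_mulA : associative free_mul.
Proof.
by move=> u v w; apply: val_inj; rewrite /= reduce_catl reduce_catr catA.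
Qed.

Lemma free_1mul : left_id free_one free_mul.
Proof. by move=> u; apply: val_inj; apply: reduce_id (word_reduced u). Qed.

Lemma free_mul1 : right_id free_one free_mul.
Proof.
by move=> u; apply: val_inj; rewrite /= cats0 (reduce_id (word_reduced u)).
Qed.

Lemma free_mulV : right_inverse free_one free_inv free_mul.
Proof. by move=> u; apply: val_inj; apply: reduce_wordV. Qed.

Lemma free_Vmul : left_inverse free_one free_inv free_mul.
Proof.
move=> u; apply: val_inj => /=; rewrite -[word u in X in _ ++ X]word_invK.
exact: reduce_wordV.
Qed.

HB.instance Definition _ := isGroup.Build freegroup
  free_mulA free_1mul free_mul1 free_Vmul free_mulV.

Definition free_gen (x : X) : freegroup := @FreeGroup [:: (x, false)] isT.

Section Lift.
Variables (G : groupType) (s : X -> G).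

Definition letter_eval (l : letter) : G := if l.2 then (s l.1)^-1 else s l.1.

(* The homomorphism freegroup -> G that sends free_gen x to s x. *)
Definition free_lift (u : freegroup) : G := \prod_(l <- word u) letter_eval l.

Lemma letter_evalV l : letter_eval (letter_inv l) = (letter_eval l)^-1.
Proof. by case: l => x [] //=; rewrite /letter_eval /= invgK. Qed.

Lemma eval_push l w :
  \prod_(m <- push l w) letter_eval m =
    letter_eval l * \prod_(m <- w) letter_eval m.
Proof.
case: w => [|m w] /=; first by rewrite big_cons.
by case: eqP => [->|_]; rewrite !big_cons // letter_evalV mulVKg.
Qed.

Lemma eval_reduce w :
  \prod_(m <- reduce w) letter_eval m = \prod_(m <- w) letter_eval m.
Proof. by elim: w => //= l w IHw; rewrite eval_push big_cons IHw. Qed.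

Lemma free_lift_morphism : monoid_morphism free_lift.
Proof.
split=> [|u v]; first by rewrite /free_lift big_nil.
by rewrite /free_lift eval_reduce big_cat.
Qed.

HB.instance Definition _ :=
  isUMagmaMorphism.Build freegroup G free_lift free_lift_morphism.

Lemma free_lift_gen x : free_lift (free_gen x) = s x.
Proof. by rewrite /free_lift big_seq1. Qed.

End Lift.
End FreeGroup.

Local Open Scope classical_set_scope.

(* B freely generates the subgroup H: the homomorphism from the free group on  *)
(* the indices of B that sends i to the i-th entry of B is an isomorphism onto *)
(* H. In particular B has no repetition, and [::] is a basis of exactly {1}.   *)
Definition is_free_basis (G : groupType) (B : seq G) (H : set G) : Prop :=
  let f := free_lift (fun i : 'I_(size B) => B`_i) in
  injective f /\ range f = H.

Definition stable_image (G : groupType) (psi : {multiplicative G -> G})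
  : set G :=
  \bigcap_(i >= 1) range (iter i psi).

Definition F2 : Type := freegroup 'I_2.
HB.instance Definition _ := Group.on F2.

Definition gen_a : F2 := free_gen (ord0 : 'I_2).
Definition gen_b : F2 := free_gen (ord_max : 'I_2).

(* Kleene's partial (mu-)recursive functions on natural numbers. *)
Inductive recfun : Type :=
  | Zero
  | Succ
  | Proj of nat
  | Comp of recfun & seq recfun
  | Prec of recfun & recfun
  | Mu of recfun.

(* rec_eval p xs y: the function denoted by p is defined on the argument list  *)
(* xs and its value is y. Prec recurses on the first argument, and Mu f xs is  *)
(* the least n with f (n, xs) = 0, where f must be defined and nonzero at all  *)
(* smaller arguments.                                                          *)
Inductive rec_eval : recfun -> seq nat -> nat -> Prop :=
  | EvalZero xs : rec_eval Zero xs 0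
  | EvalSucc x : rec_eval Succ [:: x] x.+1
  | EvalProj i xs : i < size xs -> rec_eval (Proj i) xs (nth 0 xs i)
  | EvalComp f gs xs ys z :
      rec_evals gs xs ys -> rec_eval f ys z -> rec_eval (Comp f gs) xs z
  | EvalPrec0 f g xs z : rec_eval f xs z -> rec_eval (Prec f g) (0 :: xs) z
  | EvalPrecS f g n xs y z :
      rec_eval (Prec f g) (n :: xs) y -> rec_eval g [:: n, y & xs] z ->
      rec_eval (Prec f g) (n.+1 :: xs) z
  | EvalMu f xs n (k : nat -> nat) :
      (forall m, m < n -> rec_eval f (m :: xs) (k m).+1) ->
      rec_eval f (n :: xs) 0 ->
      rec_eval (Mu f) xs n
with rec_evals : seq recfun -> seq nat -> seq nat -> Prop :=
  | EvalNil xs : rec_evals [::] xs [::]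
  | EvalCons g gs xs y ys :
      rec_eval g xs y -> rec_evals gs xs ys ->
      rec_evals (g :: gs) xs (y :: ys).

Scheme rec_eval_mut := Minimality for rec_eval Sort Prop
  with rec_evals_mut := Minimality for rec_evals Sort Prop.

Lemma rec_eval_fun p xs y z : rec_eval p xs y -> rec_eval p xs z -> y = z.
Proof.
move=> ev; move: p xs y ev z.
apply: (rec_eval_mut (P0 := fun gs xs ys =>
  forall zs, rec_evals gs xs zs -> ys = zs)).
- by move=> xs z ev; inversion ev.
- by move=> x z ev; inversion ev.
- by move=> i xs _ z ev; inversion ev.
- move=> f gs xs ys z _ IHgs _ IHf z' ev.
  inversion ev as [| | |? ? ? zs ? evs evf| | |]; subst.
  by apply: IHf; rewrite (IHgs _ evs).
- by move=> f g xs z _ IH z' ev; inversion ev; apply: IH.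
- move=> f g n xs y z _ IHy _ IHz z' ev.
  inversion ev as [| | | | |? ? ? ? y' ? evy evz|]; subst.
  by apply: IHz; rewrite (IHy _ evy).
- move=> f xs n k _ IHk _ IH0 m ev.
  inversion ev as [| | | | | |? ? ? k' evk ev0]; subst.
  case: (ltngtP n m) => // [lt_nm | lt_mn].
  + by have := IH0 _ (evk _ lt_nm).
  + by have := IHk _ lt_mn _ ev0.
- by move=> xs zs ev; inversion ev.
- move=> g gs xs y ys _ IHg _ IHgs zs ev.
  by inversion ev; congr (_ :: _); [apply: IHg | apply: IHgs].
Qed.

(* Goedel numbers: the letters a, a^-1, b, b^-1 are 0, 1, 2, 3, and finite     *)
(* sequences of numbers are numbered by the bijection CodeSeq.code.            *)
Definition letter_code (l : letter 'I_2) : nat := (l.1).*2 + l.2.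

Definition word_code (u : F2) : nat := CodeSeq.code (map letter_code (word u)).

Definition words_code (B : seq F2) : nat := CodeSeq.code (map word_code B).

Definition computable_words (f : F2 -> F2 -> seq F2) : Prop :=
  exists p : recfun, forall u v : F2,
    rec_eval p [:: word_code u; word_code v] (words_code (f u v)).

(* Main.v *)
(* Let f be an endomorphism of F = F(a, b), L = |f(a)| + |f(b)|, and K its     *)
(* stable image. Nielsen reduction turns (f(a), f(b)) into the image (u, v)    *)
(* of a basis (p, q) of controlled length. If u or v is trivial, the image of  *)
(* f is cyclic. Otherwise take (u, v) Nielsen reduced, so that f is injective. *)
(* If f is onto, then u, v are letters and a, b have short preimages. If not,  *)
(* iterating f makes reduced pairs arbitrarily long, so K is cyclic, generated *)
(* by a primitive element p with f(p) = p^(+-1).                               *)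
(* The point is that such a p is short. Up to conjugation and signs p is a     *)
(* positive (Christoffel) word X. Conjugating f into lam with lam(X) = X^(+-1),*)
(* the commutator [X, lam(Y)] is conjugate to [f(a), f(b)]^(+-1), hence short, *)
(* Y completing X to a basis. If the axis of X and its translate by lam(Y) are *)
(* disjoint, X is shorter than that commutator; if they meet, the word         *)
(* combinatorics of X and abelianisation show that lam is onto. This bounds    *)
(* |X|, and after a change of basis f^2 fixes a conjugate a^h. Then            *)
(* f^2(x) = k theta(x) k^-1 with theta(a) = a, theta(b) = v a^j and            *)
(* h k = a^m theta(h), where theta stretches h so much that |h| is bounded.    *)
(* Hence K is F, which a bounded search for preimages of a and b detects, or   *)
(* it is generated by any shortest nontrivial element x of computably bounded  *)
(* length with f(f(x)) = x, or it is trivial if there is no such x.            *)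

Require Import Defs.
From mathcomp Require Import zify ssralg ssrint ring boolp.

Set Implicit Arguments.
Unset Strict Implicit.
Unset Printing Implicit Defensive.

Local Open Scope group_scope.

(** The algorithm is a bounded search, so everything rests on one computable bound,
    [stable_dichotomy]. With L = |f(a)| + |f(b)|, either a and b have preimages of length at most
    [preim_bound L], and then the stable image K is all of F, or K is generated by one x with
    f(f(x)) = x and |x| at most [fix_bound L + L]. In the second case K contains every y with
    f(f(y)) = y, so a shortest nontrivial such y is x or its inverse ([basis_spec]).

    [nielsen_reduction] finds a basis (p, q) whose image is degenerate or Nielsen reduced. A
    degenerate pair gives a cyclic image, settled by [stab_cyclic_image]. A reduced pair makes f
    injective ([nred_inj]) and bounds the preimages of letters if f is onto. If f is injective but
    not onto, reduced pairs generating f^n(F) become arbitrarily long ([long_pairs]), so the short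
    elements of f^n(F) are powers of one of the two generators. Hence K is abelian, and
    [stable_cyclic] shows that K is trivial or generated by a primitive p with f(p) = p^(+-1).

    What remains is to bound |p| ([fixed_primitive_len]). By [tame_normal_form], p is up to
    conjugation and signs a positive word X obtained from a letter by the substitution a -> a, b ->
    ab and the exchange of a and b. If X is long, the abelianised map is +-1. Then either the axis
    of X in the Cayley tree meets its translate by the image of Y, where X, Y is a basis, and
    Christoffel combinatorics ([chr_basis], [axis_meet]) makes the map onto; or the two axes are
    disjoint and a commutator conjugate to [f(a), f(b)]^(+-1) has cyclically reduced length at least
    2|X| ([axis_disjoint]). So |X| is bounded ([primitive_word_size]). The conjugator is bounded by
    [axis_len]: in a suitable basis it gives a word W with W k = a^m theta(W), theta expanding, and
    comparing the prefixes of both sides bounds the number and the lengths of the runs of W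
    ([core_nofold], [core_fold]).

    The search itself is programmed on Goedel numbers ([computable_basis]). *)

Section Morphisms.
Variables (G H : groupType) (f : G -> H).
Hypothesis fM : {morph f : x y / x * y}.

Lemma mor1 : f 1 = 1.
Proof. by apply: (@mulgI _ (f 1)); rewrite -fM !mulg1. Qed.

Lemma morV x : f x^-1 = (f x)^-1.
Proof. by apply: (@mulgI _ (f x)); rewrite -fM !mulgV mor1. Qed.

Lemma morX x n : f (x ^+ n) = f x ^+ n.
Proof. by elim: n => [|n IH]; rewrite ?mor1 // !expgS fM IH. Qed.

Lemma mor_prod (I : Type) (r : seq I) (F : I -> G) :
  f (\prod_(i <- r) F i) = \prod_(i <- r) f (F i).
Proof. exact: (big_morph f fM mor1). Qed.

Lemma mor_inj : (forall x, f x = 1 -> x = 1) -> injective f.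
Proof.
move=> f1 x y e; apply/divg1_eq/f1; by rewrite fM morV e mulgV.
Qed.

End Morphisms.

(** * Length and cancellation in free groups *)

Section FreeWords.
Variable X : choiceType.
Implicit Types (x y z : freegroup X) (l m : letter X) (s t w : seq (letter X)).

Definition len x := size (word x).
Definition fw s : freegroup X := free_of_word s.
Definition lett l : freegroup X := @FreeGroup X [:: l] isT.

Lemma word_inj : injective (@word X). Proof. exact: val_inj. Qed.

Lemma wordM x y : word (x * y) = reduce (word x ++ word y). Proof. by []. Qed.
Lemma wordV x : word x^-1 = word_inv (word x). Proof. by []. Qed.

Lemma fwK x : fw (word x) = x.
Proof. by apply: word_inj; apply: reduce_id (word_reduced x). Qed.

Lemma word_fw s : reduced s -> word (fw s) = s.
Proof. exact: reduce_id. Qed.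

Lemma fw_cat s t : fw (s ++ t) = fw s * fw t.
Proof. by apply: word_inj; rewrite wordM /= reduce_catl reduce_catr. Qed.

Lemma fw_nil : fw [::] = 1. Proof. exact: word_inj. Qed.
Lemma fw1 l : fw [:: l] = lett l. Proof. exact: word_inj. Qed.
Lemma fw_cons l s : fw (l :: s) = lett l * fw s.
Proof. by rewrite -cat1s fw_cat fw1. Qed.

Lemma fw_inv s : fw (word_inv s) = (fw s)^-1.
Proof.
apply: (@mulgI _ (fw s)); rewrite mulgV -fw_cat.
by apply: word_inj; apply: reduce_wordV.
Qed.

Lemma lettV l : lett (letter_inv l) = (lett l)^-1.
Proof. by rewrite -!fw1 -fw_inv. Qed.

Lemma size_word_inv s : size (word_inv s) = size s.
Proof. by rewrite size_rev size_map. Qed.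

Lemma word_inv_cat s t : word_inv (s ++ t) = word_inv t ++ word_inv s.
Proof. by rewrite /word_inv map_cat rev_cat. Qed.

Lemma lenV x : len x^-1 = len x.
Proof. by rewrite /len wordV size_word_inv. Qed.

Lemma lenVM x y : len (y^-1 * x^-1) = len (x * y).
Proof. by rewrite -lenV invgM !invgK. Qed.

Lemma len1 : len (1 : freegroup X) = 0. Proof. by []. Qed.

Lemma len_eq0 x : (len x == 0) = (x == 1).
Proof.
apply/eqP/eqP => [/size0nil e|->//]; exact: word_inj.
Qed.

Lemma len_gt0 x : (0 < len x) = (x != 1).
Proof. by rewrite -len_eq0 lt0n. Qed.

Lemma len_lett l : len (lett l) = 1%N. Proof. by []. Qed.

Lemma size_push l s : size (push l s) <= (size s).+1.
Proof. by case: s => //= m s; case: ifP => //= _; lia. Qed.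

Lemma size_reduce s : size (reduce s) <= size s.
Proof. by elim: s => //= l s IH; apply: leq_trans (size_push _ _) _. Qed.

Lemma len_fw s : len (fw s) <= size s. Proof. exact: size_reduce. Qed.

Lemma lenM x y : len (x * y) <= len x + len y.
Proof. by rewrite -size_cat; apply: size_reduce. Qed.

Lemma reduced_cat s t : reduced (s ++ t) -> reduced s /\ reduced t.
Proof.
case: s => [|l s] //= ; rewrite /reduced /= cat_path => /andP[-> /path_sorted].
by [].
Qed.

Lemma reduced_rcons2 s l m t :
  reduced (rcons s l ++ m :: t) =
  [&& reduced (rcons s l), m != letter_inv l & reduced (m :: t)].
Proof.
case: s => [|k s] /=; first by [].
by rewrite cat_path last_rcons /=.
Qed.

Lemma reduced_cons2 l m t :
  reduced [:: l, m & t] = (m != letter_inv l) && reduced (m :: t).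
Proof. by []. Qed.

Lemma reduced_word x : reduced (word x). Proof. exact: word_reduced. Qed.

Lemma cancelP x y : exists s p t,
  [/\ word x = s ++ p, word y = word_inv p ++ t & word (x * y) = s ++ t].
Proof.
suff H : forall s t, reduced s -> reduced t -> exists s1 p t1,
  [/\ s = s1 ++ p, t = word_inv p ++ t1 & reduced (s1 ++ t1)].
  have [s1 [p [t1 [e1 e2 r]]]] := H _ _ (reduced_word x) (reduced_word y).
  exists s1, p, t1; split=> //.
  rewrite -[x]fwK -[y]fwK e1 e2 !fw_cat fw_inv -!mulgA mulVKg -fw_cat word_fw //.
move=> s t rs; elim: t s rs => [|m t IH] s rs rt.
  by exists s, [::], [::]; rewrite !cats0.
case/lastP: s rs => [|s l] rs; first by exists [::], [::], (m :: t).
have [e|ne] := eqVneq m (letter_inv l); last first.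
  exists (rcons s l), [::], (m :: t); rewrite cats0; split=> //.
  by rewrite reduced_rcons2 rs ne rt.
have rs' : reduced s by move: rs; rewrite -cats1 => /reduced_cat[].
have [s1 [p [t1 [e1 e2 r]]]] := IH s rs' (path_sorted rt).
exists s1, (rcons p l), t1; split=> //; first by rewrite e1 -rcons_cat.
by rewrite -cats1 word_inv_cat e e2.
Qed.

(* The number of letters cancelled on each side in the product x y. *)
Definition cn x y := (len x + len y - len (x * y))./2.

Lemma cnP x y : exists s p t,
  [/\ word x = s ++ p, word y = word_inv p ++ t, word (x * y) = s ++ t
    & size p = cn x y].
Proof.
have [s [p [t [e1 e2 e3]]]] := cancelP x y; exists s, p, t; split=> //.
rewrite /cn /len e1 e2 e3 !size_cat size_word_inv; lia.
Qed.

Lemma len_cn x y : len (x * y) + (cn x y).*2 = len x + len y.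
Proof.
have [s [p [t [e1 e2 e3 <-]]]] := cnP x y.
rewrite /len e1 e2 e3 !size_cat size_word_inv; lia.
Qed.

(** What cancels in x y is the common prefix of x^-1 and y, so [cn] is a Gromov product in the
    Cayley tree. *)
Lemma cn_geP k x y : k <= cn x y <->
  [/\ k <= len x, k <= len y & take k (word x^-1) = take k (word y)].
Proof.
split=> [|[k1 k2 e]].
  have [s [p [t [e1 e2 e3 <-]]]] := cnP x y => lek.
  rewrite /len wordV e1 e2 word_inv_cat !size_cat size_word_inv.
  by split; [lia | lia | rewrite !takel_cat ?size_word_inv].
have ex : x = fw (word_inv (drop k (word x^-1))) * fw (word_inv (take k (word x^-1))).
  by rewrite -fw_cat -word_inv_cat cat_take_drop wordV word_invK fwK.
have ey : y = fw (take k (word y)) * fw (drop k (word y)).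
  by rewrite -fw_cat cat_take_drop fwK.
have exy : x * y = fw (word_inv (drop k (word x^-1)) ++ drop k (word y)).
  by rewrite {1}ex {1}ey e -mulgA (fw_inv (take _ _)) mulKg -fw_cat.
have := len_fw (word_inv (drop k (word x^-1)) ++ drop k (word y)).
rewrite -exy size_cat size_word_inv !size_drop -/(len _) -/(len y) lenV.
have := len_cn x y; lia.
Qed.

Lemma cn_le x y : cn x y <= len x /\ cn x y <= len y.
Proof. by have [] := (cn_geP (cn x y) x y).1 (leqnn _). Qed.

Lemma cnV x y : cn y^-1 x^-1 = cn x y.
Proof. by rewrite /cn -invgM !lenV addnC. Qed.

(* cn x^-1 y is the length of the common prefix of x and y. *)
Lemma cn_ultra x y z : minn (cn x^-1 y) (cn y^-1 z) <= cn x^-1 z.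
Proof.
have [p1 p2 p3] := (cn_geP (minn (cn x^-1 y) (cn y^-1 z)) x^-1 y).1 (geq_minl _ _).
have [q1 q2 q3] := (cn_geP (minn (cn x^-1 y) (cn y^-1 z)) y^-1 z).1 (geq_minr _ _).
apply/cn_geP; split=> //; rewrite p3 -q3; by rewrite invgK.
Qed.

Lemma word_mul_nc x y : cn x y = 0 -> word (x * y) = word x ++ word y.
Proof.
have [s [p [t [-> -> -> <-]]]] := cnP x y => /size0nil ->.
by rewrite cats0.
Qed.

Lemma wordM_red x y : reduced (word x ++ word y) -> word (x * y) = word x ++ word y.
Proof. by move=> r; rewrite wordM reduce_id. Qed.

Lemma fw_word_prod x : x = \prod_(l <- word x) lett l.
Proof.
rewrite -[LHS]fwK; elim: (word x) => [|l s IH]; first by rewrite big_nil fw_nil.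
by rewrite big_cons -IH fw_cons.
Qed.

Lemma lett_gen i b : lett (i, b) = if b then (free_gen i)^-1 else free_gen i.
Proof. by case: b => //; rewrite -(lettV (i, false)). Qed.

Lemma free_ext (G : groupType) (f g : freegroup X -> G) :
  {morph f : x y / x * y} -> {morph g : x y / x * y} ->
  (forall i, f (free_gen i) = g (free_gen i)) -> f =1 g.
Proof.
move=> fM gM e x; rewrite (fw_word_prod x) (mor_prod fM) (mor_prod gM).
apply: eq_bigr => -[i b] _; rewrite lett_gen.
by case: b; rewrite ?(morV fM) ?(morV gM) e.
Qed.

Lemma len_prod (I : Type) (r : seq I) (F : I -> freegroup X) B :
  (forall i, len (F i) <= B) -> len (\prod_(i <- r) F i) <= B * size r.
Proof.
move=> h; elim: r => [|i r IH]; first by rewrite big_nil.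
by rewrite big_cons mulnS; apply: leq_trans (lenM _ _) (leq_add _ _).
Qed.

Lemma lenX x n : len (x ^+ n) <= n * len x.
Proof.
elim: n => // n IH; rewrite expgS mulSn; apply: leq_trans (lenM _ _) _.
by rewrite leq_add2l.
Qed.

(** If half of x cancelled against x, the letters facing each other across the middle of x would be
    inverse: a letter would be its own inverse, or x would not be reduced. *)
Lemma cn_self x : x != 1 -> (cn x x).*2 < len x.
Proof.
move=> x1; rewrite ltnNge; apply/negP => h.
set h2 := (len x).+1./2.
have lh : h2 <= cn x x by rewrite /h2; move: h; lia.
have /(cn_geP _ _ _)[k1 k2 e] := lh.
have lx : 0 < len x by rewrite len_gt0.
(* the middle letter would be its own inverse, or the two middle letters would cancel *)
have sx : size (word x) = len x by [].
pose i := (len x)./2.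
have li : i < size (word x) by rewrite sx /i; lia.
have l : letter X by move: lx; rewrite /len; case: (word x) => // l _ _; exact: l.
have nthV j : j < len x -> nth l (word x^-1) j = letter_inv (nth l (word x) (len x - j.+1)).
  move=> lj; rewrite wordV nth_rev size_map // (nth_map l) //; lia.
have eqj j : j < h2 -> nth l (word x) j = letter_inv (nth l (word x) (len x - j.+1)).
  move=> lj; rewrite -nthV; last by rewrite /h2 in lj *; lia.
  by rewrite -(nth_take l lj (word x)) -e nth_take.
have [od|ev] := boolP (odd (len x)).
  have lt : i < h2 by rewrite /h2 /i; lia.
  have := eqj _ lt; rewrite (_ : len x - i.+1 = i)%N; last by rewrite /i; lia.
  by case: (nth l (word x) i) => a [].
have lt : i.-1 < h2 by rewrite /h2 /i; lia.
have ee := eqj _ lt.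
rewrite (_ : len x - i.-1.+1 = i)%N in ee; last by rewrite /i; lia.
have := reduced_word x; rewrite -(cat_take_drop i (word x)).
rewrite (drop_nth l li) (_ : i = i.-1.+1) ?(take_nth l); try by rewrite ?sx /i; lia.
rewrite reduced_rcons2 (_ : i.-1.+1 = i); last by rewrite /i; lia.
by rewrite ee letter_invK eqxx andbF.
Qed.

End FreeWords.

(** * Nielsen reduction in rank two *)

Notation I2 := (fintype_ordinal__canonical__choice_Choice 2).
Notation L2 := (letter I2).
Notation F := (freegroup I2).

Definition ga : F := free_gen ord0.
Definition gb : F := free_gen ord_max.

Lemma letter_invN (X : choiceType) (l : letter X) : l != letter_inv l.
Proof. by case: l => i []; rewrite /letter_inv xpair_eqE eqxx. Qed.

Lemma reduced_glue (X : choiceType) (s t w : seq (letter X)) :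
  0 < size t -> reduced (s ++ t) -> reduced (t ++ w) -> reduced (s ++ t ++ w).
Proof.
case: t => // l t _; case: s => [|k s] //; rewrite /reduced /= !cat_path /=.
by case/andP=> -> /andP[-> _]; rewrite cat_path.
Qed.

(* cn y z is computed inside the suffix of y of length len y - c. *)
Lemma small_cancel (X : choiceType) (x y z : freegroup X) s c :
  word x = s ++ drop c (word y) -> c + cn y z < len y ->
  word (x * z) = take (len x - cn y z) (word x) ++ drop (cn y z) (word z).
Proof.
have [s1 [p [t [e1 e2 e3 <-]]]] := cnP y z.
rewrite /len => ex; rewrite e1 size_cat => lt.
have lc : c < size s1 by lia.
rewrite e1 drop_cat lc in ex.
have lx : size (word x) - size p = size (s ++ drop c s1).
  by rewrite ex catA size_cat addnK.
rewrite lx {1}ex catA take_size_cat // e2 drop_size_cat ?size_word_inv //.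
rewrite -[x]fwK -[z]fwK ex e2 !fw_cat (fw_inv p) -!mulgA mulVKg.
rewrite -(fw_cat (drop c s1)) -(fw_cat s).
have r1 := reduced_word (y * z); rewrite e3 in r1.
have r2 := reduced_word x; rewrite ex catA in r2.
have r : reduced (s ++ drop c s1 ++ t).
  apply: reduced_glue; first by rewrite size_drop subn_gt0.
    by case: (reduced_cat r2).
  by move: r1; rewrite -{1}(cat_take_drop c s1) -catA => /reduced_cat[].
by rewrite -!catA word_fw.
Qed.

Section Endo.

Definition im2 (p q : F) (i : 'I_2) : F := if i == ord0 then p else q.
Definition e2 (p q : F) : F -> F := free_lift (im2 p q).
Definition ev (p q : F) : L2 -> F := letter_eval (im2 p q).

Lemma e2M p q : {morph e2 p q : x y / x * y}.
Proof. exact: (free_lift_morphism (im2 p q)).2. Qed.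

Lemma e2V p q x : e2 p q x^-1 = (e2 p q x)^-1. Proof. exact: morV (@e2M p q) x. Qed.
Lemma e21 p q : e2 p q 1 = 1. Proof. exact: mor1 (@e2M p q). Qed.

Lemma e2a p q : e2 p q ga = p. Proof. exact: free_lift_gen. Qed.
Lemma e2b p q : e2 p q gb = q. Proof. exact: free_lift_gen. Qed.

Lemma ord2P (i : 'I_2) : i = ord0 \/ i = ord_max.
Proof. by case: i => [[|[|//]] lt]; [left | right]; apply: val_inj. Qed.

Lemma e2_ext (f : F -> F) p q : {morph f : x y / x * y} ->
  f ga = p -> f gb = q -> f =1 e2 p q.
Proof.
move=> fM <- <-; apply: free_ext => //; first exact: e2M.
by move=> i; case: (ord2P i) => ->; rewrite -/ga -/gb ?e2a ?e2b.
Qed.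

Lemma e2_comp (f : F -> F) p q x : {morph f : x y / x * y} ->
  f (e2 p q x) = e2 (f p) (f q) x.
Proof.
move=> fM; apply: (@e2_ext (f \o e2 p q)) => [y z||] /=; rewrite ?e2a ?e2b //.
by rewrite e2M fM.
Qed.

Lemma e2_id x : e2 ga gb x = x.
Proof. by symmetry; apply: (@e2_ext id). Qed.

Lemma evV p q l : ev p q (letter_inv l) = (ev p q l)^-1.
Proof. exact: letter_evalV. Qed.

Lemma e2_fw p q s : e2 p q (fw s) = \prod_(l <- s) ev p q l.
Proof. exact: eval_reduce. Qed.

Lemma e2_word p q x : e2 p q x = \prod_(l <- word x) ev p q l.
Proof. by []. Qed.

Lemma e2_rcons p q s l : e2 p q (fw (rcons s l)) = e2 p q (fw s) * ev p q l.
Proof. by rewrite -cats1 !e2_fw big_cat big_seq1. Qed.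

Lemma e2_lett p q l : e2 p q (lett l) = ev p q l.
Proof. by rewrite -fw1 e2_fw big_seq1. Qed.

Lemma len_e2 p q x : len (e2 p q x) <= (len p + len q) * len x.
Proof.
rewrite e2_word; apply: len_prod => -[i b].
rewrite /ev /letter_eval /im2 /=; case: b; rewrite ?lenV; case: ifP => _; lia.
Qed.

End Endo.

Definition nred (p q : F) : bool :=
  [&& p != 1, q != 1,
      [forall l : L2, forall m : L2, (m != letter_inv l) ==>
         ((cn (ev p q l) (ev p q m)).*2 <= len (ev p q l)) &&
         ((cn (ev p q l) (ev p q m)).*2 <= len (ev p q m))] &
      [forall l : L2, forall m : L2, forall k : L2,
         (m != letter_inv l) ==> (k != letter_inv m) ==>
         (cn (ev p q l) (ev p q m) + cn (ev p q m) (ev p q k) < len (ev p q m))]].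

Section NReduced.
Variables p q : F.
Hypothesis nr : nred p q.
Notation y := (ev p q).

Lemma nred_ev1 l : y l != 1.
Proof.
case/and4P: nr => p1 q1 _ _; case: l => i b; rewrite /ev /letter_eval /im2 /=.
by case: b; rewrite ?invg_eq1; case: ifP.
Qed.

Lemma nred_N1 l m : m != letter_inv l ->
  (cn (y l) (y m)).*2 <= len (y l) /\ (cn (y l) (y m)).*2 <= len (y m).
Proof.
by case/and4P: nr => _ _ /forallP/(_ l)/forallP/(_ m)/implyP h _ /h/andP.
Qed.

Lemma nred_N2 l m k : m != letter_inv l -> k != letter_inv m ->
  cn (y l) (y m) + cn (y m) (y k) < len (y m).
Proof.
case/and4P: nr => _ _ _ /forallP/(_ l)/forallP/(_ m)/forallP/(_ k)/implyP h.
by move=> /h/implyP.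
Qed.

(** The invariant behind all length estimates: the image of a reduced word still ends in a piece of
    the image of its last letter, and this piece is too long for the next factor to use it up. *)
Lemma nred_last s l : reduced (rcons s l) ->
  exists t c, [/\ word (e2 p q (fw (rcons s l))) = t ++ drop c (word (y l)),
    forall m, m != letter_inv l -> c + cn (y l) (y m) < len (y l)
  & len (y l) <= len (e2 p q (fw (rcons s l)))].
Proof.
elim/last_ind: s l => [|s k IH] l.
  move=> _; exists [::], 0; rewrite /= fw1 e2_lett drop0; split=> // m lm.
  have := nred_ev1 l; have [] := nred_N1 lm; rewrite -len_gt0; lia.
rewrite -[X in reduced X]cats1 reduced_rcons2 => /and3P[r kl _].
have [t [c [e1 c1 l1]]] := IH k r.
rewrite e2_rcons (small_cancel e1 (c1 _ kl)).
eexists; exists (cn (y k) (y l)); split; first by [].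
  by move=> m lm; apply: nred_N2.
rewrite /len (small_cancel e1 (c1 _ kl)) size_cat size_takel ?leq_subr //.
rewrite size_drop -/(len _); have := nred_N1 kl; move: l1; rewrite /len.
have := (cn_le (y k) (y l)); rewrite /len; lia.
Qed.

Lemma nred_step s l m : reduced (rcons (rcons s l) m) ->
  let x := e2 p q (fw (rcons s l)) in
  word (e2 p q (fw (rcons (rcons s l) m))) =
    take (len x - cn (y l) (y m)) (word x) ++ drop (cn (y l) (y m)) (word (y m))
  /\ cn (y l) (y m) <= len x.
Proof.
rewrite -[X in reduced X]cats1 reduced_rcons2 => /and3P[r kl _] x.
have [t [c [e1 c1 l1]]] := nred_last r.
rewrite e2_rcons (small_cancel e1 (c1 _ kl)); split=> //.
by rewrite (leq_trans _ l1) // (cn_le _ _).1.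
Qed.

Lemma nred_len_step s l m : reduced (rcons (rcons s l) m) ->
  len (e2 p q (fw (rcons (rcons s l) m))) + (cn (y l) (y m)).*2 =
  len (e2 p q (fw (rcons s l))) + len (y m).
Proof.
move=> r; have [e le] := nred_step r.
rewrite {1}/len e size_cat size_takel ?leq_subr // size_drop -/(len _).
have := (cn_le (y l) (y m)); lia.
Qed.

(** Every letter contributes at least one letter to the image that survives cancellation from both
    sides; the term [cn] reserves what the next factor may still remove. *)
Lemma nred_len_aux s l m : reduced (rcons s l) -> m != letter_inv l ->
  size s + cn (y l) (y m) < len (e2 p q (fw (rcons s l))).
Proof.
elim/last_ind: s l m => [|s k IH] l m.
  move=> _ ne; rewrite /= fw1 e2_lett.
  by have := nred_ev1 l; have := nred_N1 ne; rewrite -len_gt0; lia.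
move=> r ne; have := r; rewrite -[X in reduced X]cats1 reduced_rcons2.
case/and3P=> r1 kl _; have := IH _ _ r1 kl; have := nred_len_step r.
by have := nred_N2 kl ne; rewrite size_rcons; lia.
Qed.

Lemma nred_len s : reduced s -> size s <= len (e2 p q (fw s)).
Proof.
case/lastP: s => // s l r; rewrite size_rcons.
by have := nred_len_aux r (letter_invN l); lia.
Qed.

(** Appending a factor never shortens the image, since at most half of the new factor cancels, and
    the image is at least as long as its last factor. *)
Lemma nred_len_mem s l : reduced s -> l \in s -> len (y l) <= len (e2 p q (fw s)).
Proof.
elim/last_ind: s l => // s k IH l r; rewrite mem_rcons inE => /predU1P[->|ls].
  by have [t [c [_ _]]] := nred_last r.
have r1 : reduced s by move: r; rewrite -cats1 => /reduced_cat[].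
apply: leq_trans (IH _ r1 ls) _; case/lastP: s r r1 ls {IH} => // s m r r1 _.
have := r; rewrite -[X in reduced X]cats1 reduced_rcons2 => /and3P[_ mk _].
by have := nred_len_step r; have := nred_N1 mk; lia.
Qed.

Lemma nred_inj : injective (e2 p q).
Proof.
apply: mor_inj; first exact: e2M.
move=> x x1; apply/eqP; rewrite -len_eq0 -leqn0.
by have := nred_len (reduced_word x); rewrite fwK x1 len1.
Qed.

End NReduced.

(** * Elementary Nielsen moves and their termination *)

(** The bases of F reached from (a, b) by elementary Nielsen moves. *)
Inductive tame : F -> F -> Prop :=
  | TameId : tame ga gb
  | TameSwap p q : tame p q -> tame q p
  | TameInv p q : tame p q -> tame p^-1 q
  | TameMul p q : tame p q -> tame (p * q) q.

Lemma TameInv2 p q : tame p q -> tame p q^-1.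
Proof. by move=> /TameSwap/TameInv/TameSwap. Qed.

Definition tlen (p q : F) := len p + len q.
Definition qlen (p q : F) := len (p * p) + len (q * q).
(** One number for the lexicographic order on ([tlen], [qlen]): [qlen] is at most 2 [tlen], so 3
    [tlen]^2 outweighs it. The length of the squares takes the place of the usual order on words as
    tie-breaker. *)
Definition nmu (p q : F) := 3 * (tlen p q) ^ 2 + qlen p q.

Lemma nmu_lt p q p' q' : tlen p' q' < tlen p q -> nmu p' q' < nmu p q.
Proof.
move=> lt; have : qlen p' q' <= 2 * tlen p' q'.
  by rewrite /qlen /tlen; have := lenM p' p'; have := lenM q' q'; lia.
rewrite /nmu -!mulnn; nia.
Qed.

Lemma nmu_lt2 p q p' q' : tlen p' q' = tlen p q -> qlen p' q' < qlen p q ->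
  nmu p' q' < nmu p q.
Proof. by rewrite /nmu => -> lt; rewrite ltn_add2l. Qed.

(* The tie-breaking step of Nielsen reduction: qlen drops while tlen does not change. *)
Lemma half_cancel (X : choiceType) (u v : freegroup X) : v != 1 ->
  (cn u v).*2 = len v -> (cn v u).*2 = len v -> len v <= len u ->
  len (u * v) = len u /\ len (u * v * (u * v)) < len (u * u).
Proof.
move=> v1 h1 h2 le; have hv := cn_self v1.
set h := cn u v in h1; have e : cn v u = h by lia.
(* Otherwise the tree inequality, used twice, would make v cancel half of itself in v v. *)
have cuu : cn u u < h.
  rewrite ltnNge; apply/negP => g.
  have g1 := cn_ultra v^-1 u u^-1; have g2 := cn_ultra v^-1 u^-1 v.
  move: g1 g2; rewrite !invgK cnV e -/h; lia.
have [s1 [p1 [t1 [e1 e2 e3 e4]]]] := cnP u v.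
have [s2 [p2 [t2 [f1 f2 f3 f4]]]] := cnP v u.
have lv : len v = size p1 + size t1 by rewrite /len e2 size_cat size_word_inv.
have lv2 : len v = size s2 + size p2 by rewrite /len f1 size_cat.
have [ep et] : word_inv p1 = s2 /\ t1 = p2.
  have ss : size s2 = size (word_inv p1) by rewrite size_word_inv; lia.
  move: e2; rewrite f1 => /eqP; rewrite eqseq_cat //.
  by case/andP=> /eqP-> /eqP->.
have lu : len u = size s1 + size p1 by rewrite /len e1 size_cat.
(* Here v = p1^-1 p2 and u = p2^-1 m p1, so that u v = p2^-1 m p2 is a visible conjugate with a
   short square. *)
have eu : word u = word_inv p2 ++ drop (size p2) s1 ++ p1.
  rewrite -[LHS](cat_take_drop (size p2)) {1}f2 take_size_cat ?size_word_inv //.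
  have lsp : size p2 <= size s1 by lia.
  rewrite e1 drop_cat; move: lsp; rewrite leq_eqVlt; case: ltnP => // l1.
  by rewrite orbF => /eqP->; rewrite subnn drop0 drop_size.
have ev : word v = word_inv p1 ++ p2 by rewrite e2 et.
have euv : u * v = fw (word_inv p2 ++ drop (size p2) s1 ++ p2).
  by rewrite -[u]fwK -[v]fwK eu ev !fw_cat !fw_inv -!mulgA mulVKg.
have luv : len (u * v) = len u by have := len_cn u v; lia.
have -> : u * v * (u * v) =
    fw (word_inv p2 ++ drop (size p2) s1 ++ drop (size p2) s1 ++ p2).
  by rewrite euv !fw_cat !fw_inv -!mulgA mulVKg.
split=> //; apply: leq_ltn_trans (len_fw _) _.
rewrite !size_cat size_word_inv size_drop; have := len_cn u u; lia.
Qed.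

Lemma letter2P (P : L2 -> L2 -> Prop) :
  (forall i b c, P (i, b) (i, c)) ->
  (forall b c, P (ord0, b) (ord_max, c)) -> (forall b c, P (ord_max, b) (ord0, c)) ->
  forall l m, P l m.
Proof.
move=> h1 h2 h3 [i b] [j c]; case: (ord2P i) => ->; case: (ord2P j) => ->; auto.
Qed.

(** The move replaces the factor at l by its product with the factor at m. It is chosen before f is
    applied, so one choice controls both the growth of the basis and the measures of its image. *)
Lemma tame_mul_ev p q (l m : L2) : tame p q -> l.1 != m.1 -> exists p' q' : F,
  [/\ tame p' q', len p' + len q' <= 2 * (len p + len q) &
    forall f : F -> F, {morph f : x y / x * y} ->
    let u := ev (f p) (f q) l in let v := ev (f p) (f q) m in
    tlen (f p') (f q') = len (u * v) + len v /\
    qlen (f p') (f q') = len (u * v * (u * v)) + len (v * v)].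
Proof.
have lenVV (u : F) : len (u^-1 * u^-1) = len (u * u) by exact: lenVM.
move: l m; apply: letter2P => [i b c|b c|b c]; rewrite ?eqxx // => tp _.
  exists (ev p q (ord0, b) * ev p q (ord_max, c)), (ev p q (ord_max, c)); split.
  - have : tame (ev p q (ord0, b)) (ev p q (ord_max, c)).
      by rewrite /ev /letter_eval /im2 /=; case: b; case: c; do ?[exact: TameInv | apply: TameInv2 | apply: TameInv].
    exact: TameMul.
  - have := lenM (ev p q (ord0, b)) (ev p q (ord_max, c)).
    rewrite /ev /letter_eval /im2 /=; case: b; case: c; rewrite ?lenV; lia.
  - move=> f fM u v; rewrite /tlen /qlen !fM.
    have -> : f (ev p q (ord0, b)) = u by rewrite /u /ev /letter_eval /im2 /=; case: (b); rewrite ?(morV fM).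
    by have -> : f (ev p q (ord_max, c)) = v by rewrite /v /ev /letter_eval /im2 /=; case: (c); rewrite ?(morV fM).
exists (ev p q (ord0, c)), (ev p q (ord_max, b) * ev p q (ord0, c)); split.
- have : tame (ev p q (ord_max, b)) (ev p q (ord0, c)).
    apply: TameSwap; rewrite /ev /letter_eval /im2 /=; case: b; case: c; do ?[exact: TameInv | apply: TameInv2 | apply: TameInv]; done.
  by move/TameMul/TameSwap.
- have := lenM (ev p q (ord_max, b)) (ev p q (ord0, c)).
  rewrite /ev /letter_eval /im2 /=; case: b; case: c; rewrite ?lenV; lia.
- move=> f fM u v; rewrite /tlen /qlen !fM.
  have -> : f (ev p q (ord_max, b)) = u by rewrite /u /ev /letter_eval /im2 /=; case: (b); rewrite ?(morV fM).
  have -> : f (ev p q (ord0, c)) = v by rewrite /v /ev /letter_eval /im2 /=; case: (c); rewrite ?(morV fM).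
  by rewrite addnC [X in _ /\ X = _]addnC.
Qed.

Lemma tlen_ev p q (l m : L2) : l.1 != m.1 ->
  tlen p q = len (ev p q l) + len (ev p q m) /\
  qlen p q = len (ev p q l * ev p q l) + len (ev p q m * ev p q m).
Proof.
have lenVV (u : F) : len (u^-1 * u^-1) = len (u * u) by exact: lenVM.
move: l m; apply: letter2P => [i b c|b c|b c]; rewrite ?eqxx // => _;
  rewrite /tlen /qlen /ev /letter_eval /im2 /=; case: b; case: c;
  rewrite ?lenVV ?lenV //; lia.
Qed.

(** If the first condition fails, a product is shorter than one of its factors. If only the second
    fails, the middle factor loses exactly half of its letters on each side, which is the situation
    of [half_cancel]. *)
Lemma nred_improve (p q : F) : p != 1 -> q != 1 -> ~~ nred p q ->
  exists l m : L2, l.1 != m.1 /\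
    let u := ev p q l in let v := ev p q m in
    (len (u * v) < len u) \/
    (len (u * v) = len u /\ len (u * v * (u * v)) < len (u * u)).
Proof.
move=> p1 q1; have evn1 l : ev p q l != 1.
  by case: l => i b; rewrite /ev /letter_eval /im2 /=; case: b; rewrite ?invg_eq1; case: ifP.
have same (l m : L2) : m != letter_inv l -> l.1 = m.1 -> m = l.
  case: l m => i b [j c] /= + ij; rewrite /letter_inv ij xpair_eqE eqxx /=.
  by case: b; case: c.
have c_lt (l m : L2) : m != letter_inv l -> (len (ev p q l) < (cn (ev p q l) (ev p q m)).*2) ->
    exists l m : L2, l.1 != m.1 /\
    let u := ev p q l in let v := ev p q m in
    (len (u * v) < len u) \/
    (len (u * v) = len u /\ len (u * v * (u * v)) < len (u * u)).
  move=> ml lt; have ne : l.1 != m.1.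
    apply/eqP => e; move: lt; rewrite (same _ _ ml e).
    by have := cn_self (evn1 l); lia.
  exists (letter_inv m), (letter_inv l); rewrite eq_sym; split=> //; left.
  by rewrite /= !evV lenVM !lenV; have := len_cn (ev p q l) (ev p q m); lia.
rewrite /nred p1 q1 /= negb_and => nn.
have [N1|/forallPn[l /forallPn[m]]] := boolP [forall l : L2, forall m : L2, (m != letter_inv l) ==>
         ((cn (ev p q l) (ev p q m)).*2 <= len (ev p q l)) &&
         ((cn (ev p q l) (ev p q m)).*2 <= len (ev p q m))]; last first.
  rewrite negb_imply negb_and -!ltnNge => /andP[ml /orP[]]; first exact: c_lt.
  rewrite -cnV -[len (ev p q m)]lenV -!evV; apply: c_lt.
  by rewrite (inj_eq (can_inj (@letter_invK _))) eq_sym; move: ml; rewrite -{1}[m]letter_invK (can_eq (@letter_invK _)).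
have N1' (l m : L2) : m != letter_inv l -> (cn (ev p q l) (ev p q m)).*2 <= len (ev p q l) /\
         (cn (ev p q l) (ev p q m)).*2 <= len (ev p q m).
  by move/forallP: N1 => /(_ l)/forallP/(_ m)/implyP h /h/andP.
move: nn; rewrite N1 /= => /forallPn[l /forallPn[m /forallPn[k]]].
rewrite !negb_imply -leqNgt => /and3P[ml km le].
have [a1 a2] := N1' _ _ ml; have [a3 a4] := N1' _ _ km.
have nlm : l.1 != m.1.
  apply/eqP => e; have e' := same _ _ ml e; subst m.
  by have := cn_self (evn1 l); lia.
have nmk : m.1 != k.1.
  apply/eqP => e; have e' := same _ _ km e; subst k.
  by have := cn_self (evn1 m); lia.
(* Neighbouring letters carry different generators, so the outer two carry the same one. If they are
   inverse, the tree inequality would make the middle factor cancel half of itself in its square. *)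
have lk : k = l \/ k = letter_inv l.
  case: l m k nlm nmk {ml km le a1 a2 a3 a4} => i b [j c] [k d] /=.
  case: (ord2P i) => ->; case: (ord2P j) => ->; case: (ord2P k) => -> // _ _;
  by case: b; case: d; auto.
case: lk => e; subst k; last first.
  have := cn_ultra (ev p q m)^-1 (ev p q l)^-1 (ev p q m).
  rewrite !invgK -evV; move: (cn_self (evn1 m)) le a2 a3.
  set A := cn (ev p q l) _; set B := cn _ (ev p q (letter_inv l)).
  set C := cn _ _; set D := len _; lia.
exists l, m; split=> //; right; apply: half_cancel => //; lia.
Qed.

Definition nielsen_end (u v : F) := [\/ u = 1, v = 1 | nred u v].

(** Each move lowers [nmu] and at most doubles |p| + |q|, whence the power of 2. *)
Lemma nielsen_reduction (f : F -> F) : {morph f : x y / x * y} ->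
  forall p q, tame p q -> exists p' q', [/\ tame p' q',
    len p' + len q' <= 2 ^ (nmu (f p) (f q)) * (len p + len q),
    tlen (f p') (f q') <= tlen (f p) (f q) & nielsen_end (f p') (f q')].
Proof.
move=> fM p q; have [n] := ubnP (nmu (f p) (f q)); elim: n p q => // n IH p q lt tp.
have [u1|u1] := eqVneq (f p) 1.
  by exists p, q; split=> //; [rewrite leq_pmull ?expn_gt0 | apply: Or31].
have [v1|v1] := eqVneq (f q) 1.
  by exists p, q; split=> //; [rewrite leq_pmull ?expn_gt0 | apply: Or32].
have [nr|nr] := boolP (nred (f p) (f q)).
  by exists p, q; split=> //; [rewrite leq_pmull ?expn_gt0 | apply: Or33].
have [l [m [lm h]]] := nred_improve u1 v1 nr.
have [p' [q' [tp' le' /(_ f fM) /= [et eq]]]] := tame_mul_ev tp lm.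
have [et0 eq0] := tlen_ev (f p) (f q) lm.
have mlt : nmu (f p') (f q') < nmu (f p) (f q).
  case: h => [h|[h1 h2]]; first by apply: nmu_lt; rewrite et et0; lia.
  by apply: nmu_lt2; rewrite ?et ?et0 ?eq ?eq0; lia.
have tle : tlen (f p') (f q') <= tlen (f p) (f q).
  by rewrite et et0; case: h => [h|[h1 h2]]; lia.
have [|p2 [q2 [tp2 l2 t2 e2]]] := IH _ _ _ tp'; first lia.
exists p2, q2; split=> //; last by apply: leq_trans tle.
apply: leq_trans l2 _; apply: (@leq_trans (2 ^ nmu (f p') (f q') * (2 * (len p + len q)))).
  by rewrite leq_mul2l le' orbT.
by rewrite mulnA -expnSr leq_mul2r leq_exp2l // mlt orbT.
Qed.

Lemma tame_surj p q : tame p q -> forall z, exists t, e2 p q t = z.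
Proof.
suff H : tame p q -> (exists t, e2 p q t = ga) /\ (exists t, e2 p q t = gb).
  move=> /H[[s es] [t et]] z; exists (e2 s t z).
  by rewrite (e2_comp _ _ _ (@e2M p q)) es et e2_id.
elim=> {p q} [|p q _|p q _|p q _].
- by split; [exists ga | exists gb]; rewrite e2_id.
- move=> [[s es] [t et]]; have H x : e2 q p (e2 gb ga x) = e2 p q x.
    by rewrite (e2_comp _ _ _ (@e2M q p)) e2a e2b.
  by split; [exists (e2 gb ga s) | exists (e2 gb ga t)]; rewrite H.
- move=> [[s es] [t et]]; have H x : e2 p^-1 q (e2 ga^-1 gb x) = e2 p q x.
    by rewrite (e2_comp _ _ _ (@e2M p^-1 q)) e2V e2a e2b invgK.
  by split; [exists (e2 ga^-1 gb s) | exists (e2 ga^-1 gb t)]; rewrite H.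
- move=> [[s es] [t et]]; have H x : e2 (p * q) q (e2 (ga * gb^-1) gb x) = e2 p q x.
    by rewrite (e2_comp _ _ _ (@e2M (p * q) q)) e2M e2V e2a e2b mulgK.
  by split; [exists (e2 (ga * gb^-1) gb s) | exists (e2 (ga * gb^-1) gb t)]; rewrite H.
Qed.

(** * Integer powers and centralizers *)

Section IntPowers.
Variable G : groupType.
Implicit Types (x y : G) (j k : int).

Definition xz x k : G := match k with Posz n => x ^+ n | Negz n => x ^- n.+1 end.

Lemma xzS x k : xz x (k + 1)%R = xz x k * x.
Proof.
case: k => n; first by rewrite (_ : (Posz n + 1)%R = n.+1); [exact: expgSr | lia].
case: n => [|n]; first exact: esym (mulVg x).
rewrite (_ : (Negz n.+1 + 1)%R = Negz n); last lia.
by rewrite [xz x (Negz n.+1)]/= (expgS x n.+1) invgM mulgVK.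
Qed.

Lemma xzP x k : xz x (k - 1)%R = xz x k * x^-1.
Proof. by rewrite -{2}[k](GRing.subrK 1%R) xzS mulgK. Qed.

Lemma xz0 x : xz x 0 = 1. Proof. by []. Qed.
Lemma xz1 x : xz x 1 = x. Proof. by []. Qed.

Lemma xzD x j k : xz x (j + k)%R = xz x j * xz x k.
Proof.
elim/int_rect: k => [|n IH|n IH]; first by rewrite GRing.addr0 mulg1.
  rewrite (_ : (j + n.+1)%R = (j + n%:Z + 1)%R); last lia.
  rewrite xzS IH -mulgA -xzS; congr (_ * xz x _); lia.
rewrite (_ : (j - n.+1%:Z)%R = (j - n%:Z - 1)%R); last lia.
rewrite xzP IH -mulgA -xzP; congr (_ * xz x _); lia.
Qed.

Lemma xzN x k : xz x (- k)%R = (xz x k)^-1.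
Proof.
by apply: (@mulgI _ (xz x k)); rewrite mulgV -xzD GRing.subrr.
Qed.

Lemma xzM x j k : xz x (j * k)%R = xz (xz x j) k.
Proof.
elim/int_rect: k => [|n IH|n IH]; first by rewrite GRing.mulr0.
  by rewrite (_ : n.+1%:Z = n%:Z + 1)%R ?GRing.mulrDr ?xzS ?xzD ?IH ?GRing.mulr1 //; lia.
rewrite (_ : - n.+1%:Z = - n%:Z - 1)%R; last lia.
by rewrite GRing.mulrBr GRing.mulr1 xzD xzN IH xzP.
Qed.

Lemma xzC x j k : xz x j * xz x k = xz x k * xz x j.
Proof. by rewrite -!xzD GRing.addrC. Qed.

Lemma xz_commute x y k : commute x y -> commute x (xz y k).
Proof. by case: k => n c /=; [|apply: commuteV]; apply: commuteX. Qed.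

Lemma xzVx x k : xz x^-1 k = xz x (- k)%R.
Proof.
have -> : x^-1 = xz x (-1)%R by rewrite xzN.
by rewrite -xzM; congr (xz x _); lia.
Qed.

Lemma xzJ x y k : xz (x ^ y) k = xz x k ^ y.
Proof. by case: k => n /=; rewrite -conjXg -?conjVg. Qed.

End IntPowers.

Lemma mor_xz (G H : groupType) (f : G -> H) x k :
  {morph f : x y / x * y} -> f (xz x k) = xz (f x) k.
Proof. by move=> fM; case: k => n /=; rewrite ?(morV fM) (morX fM). Qed.

Lemma morJ (G H : groupType) (f : G -> H) x y :
  {morph f : x y / x * y} -> f (x ^ y) = f x ^ f y.
Proof. by move=> fM; rewrite !fM (morV fM). Qed.

Lemma word_lettX (X : choiceType) (l : letter X) n : word (lett l ^+ n) = nseq n l.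
Proof.
elim: n => // n IH; rewrite expgS wordM_red IH // /reduced /=.
by case: n {IH} => //= n; rewrite letter_invN /=; elim: n => //= n ->; rewrite letter_invN.
Qed.

Definition sgnb (k : int) : bool := if k is Negz _ then true else false.

Lemma word_ga_xz k : word (xz ga k) = nseq `|k|%N (ord0, sgnb k) :> seq L2.
Proof.
have ea : ga = lett (ord0 : I2, false) by [].
have e n : word (ga ^+ n) = nseq n (ord0, false) by rewrite ea word_lettX.
case: k => n; first exact: e.
by rewrite -[xz ga _]/(ga ^- n.+1) wordV e /word_inv map_nseq rev_nseq.
Qed.

Lemma len_ga_xz k : len (xz ga k) = `|k|%N.
Proof. by rewrite /len word_ga_xz size_nseq. Qed.

Lemma tame_bij p q : tame p q ->
  exists p' q', cancel (e2 p q) (e2 p' q') /\ cancel (e2 p' q') (e2 p q).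
Proof.
have step (p1 q1 p2 q2 s t : F) : cancel (e2 s t) (e2 p2 q2) -> cancel (e2 p2 q2) (e2 s t) ->
    (exists p' q', cancel (e2 p1 q1) (e2 p' q') /\ cancel (e2 p' q') (e2 p1 q1)) ->
    exists p' q', cancel (e2 (e2 p1 q1 s) (e2 p1 q1 t)) (e2 p' q') /\
                  cancel (e2 p' q') (e2 (e2 p1 q1 s) (e2 p1 q1 t)).
  move=> h1 h2 [p' [q' [h3 h4]]].
  exists (e2 p2 q2 p'), (e2 p2 q2 q'); split=> x.
    by rewrite -(e2_comp s t _ (@e2M p1 q1)) -(e2_comp p' q' _ (@e2M p2 q2)) h3 h1.
  by rewrite -(e2_comp s t _ (@e2M p1 q1)) -(e2_comp p' q' _ (@e2M p2 q2)) h2 h4.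
have chk (s t s' t' : F) : e2 s t s' = ga -> e2 s t t' = gb -> cancel (e2 s' t') (e2 s t).
  by move=> h1 h2 x; rewrite (e2_comp _ _ _ (@e2M s t)) h1 h2 e2_id.
elim=> {p q} [|p q _ IH|p q _ IH|p q _ IH].
- by exists ga, gb; split=> x; rewrite !e2_id.
- have /(_ gb ga gb ga) := @step p q _ _ _ _ _ _ IH; rewrite !e2a !e2b.
  by apply; apply: chk; rewrite ?e2a ?e2b.
- have /(_ ga^-1 gb ga^-1 gb) := @step p q _ _ _ _ _ _ IH; rewrite e2V !e2a !e2b.
  by apply; apply: chk; rewrite ?e2V ?e2a ?e2b ?invgK.
- have /(_ (ga * gb^-1) gb (ga * gb) gb) := @step p q _ _ _ _ _ _ IH.
  rewrite e2M !e2a !e2b; apply; apply: chk; rewrite ?e2M ?e2V ?e2a ?e2b ?mulgK ?mulgVK //.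
Qed.

Lemma ga_neq1 : ga != 1. Proof. by rewrite -len_gt0. Qed.
Lemma gb_neq1 : gb != 1. Proof. by rewrite -len_gt0. Qed.

Lemma tame_neq1 p q : tame p q -> p != 1 /\ q != 1.
Proof.
move=> /tame_bij[p' [q' [/can_inj h _]]].
split; [apply: contra ga_neq1 | apply: contra gb_neq1] => /eqP e; apply/eqP/h.
  by rewrite e2a e e21.
by rewrite e2b e e21.
Qed.

Lemma strip_a (y : F) : exists k y1, y = xz ga k * y1 /\
  (forall i s, word y1 = i :: s -> i.1 != ord0).
Proof.
have [n] := ubnP (len y); elim: n y => // n IH y lt.
case e : (word y) => [|[i b] s].
  by exists 0%R, y; rewrite mul1g; split=> // i s; rewrite e.
have [i0|i0] := eqVneq i ord0; last first.
  by exists 0%R, y; rewrite mul1g; split=> // j s'; rewrite e => -[<- _].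
have ey : y = lett (i, b) * fw s by rewrite -fw_cons -e fwK.
have [|k [y1 [e1 h]]] := IH (fw s).
  by apply: leq_ltn_trans (len_fw _) _; move: lt; rewrite /len e.
exists ((if b then -1 else 1) + k)%R, y1; split=> //.
rewrite xzD -mulgA -e1 ey i0 lett_gen; congr (_ * _).
by case: (b); rewrite ?(xzN ga 1) xz1.
Qed.

(** Strip the leading power of a from y. If the rest y1 is nontrivial, a^k y1 is reduced as written,
    and by length so is y1 a^k; their first letters then disagree. *)
Lemma centralizer_ga (y : F) k : (k != 0)%R -> commute y (xz ga k) -> exists j, y = xz ga j.
Proof.
move=> k0 c; have [j [y1 [ey h]]] := strip_a y.
exists j; rewrite ey; case e : (word y1) => [|l s].
  by rewrite -[y1]fwK e fw_nil mulg1.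
have c1 : y1 * xz ga k = xz ga k * y1.
  have : xz ga j * (y1 * xz ga k) = xz ga j * (xz ga k * y1).
    by rewrite mulgA -ey c ey !mulgA xzC.
  by move/mulgI.
exfalso; have l0 := h _ _ e.
have [n n0] : exists n, `|k|%N = n.+1.
  by exists `|k|%N.-1; move: k0; case: k {c c1} => [[]|].
have w1 : word (xz ga k * y1) = word (xz ga k) ++ word y1.
  apply: wordM_red; rewrite word_ga_xz e n0 -(addn1 n) nseqD -catA.
  rewrite -cat1s in e; apply: (@reduced_glue _ _ [:: _]) => //.
    have := reduced_word (xz ga k); by rewrite word_ga_xz n0 -(addn1 n) nseqD.
  rewrite -[_ ++ _]/[:: (ord0, sgnb k), l & s] reduced_cons2; apply/andP; split; last by have := reduced_word y1; rewrite e.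
  by apply: contraNneq l0 => ->.
have cn0 : cn y1 (xz ga k) = 0.
  have e1 : len (y1 * xz ga k) = len (xz ga k) + len y1.
    by rewrite c1 /len w1 size_cat.
  by have := len_cn y1 (xz ga k); rewrite e1; set u := len _; set v := len _; set w := cn _ _; lia.
have := word_mul_nc cn0; rewrite c1 w1 e word_ga_xz n0 /= => -[el _].
by move: l0; rewrite -el eqxx.
Qed.

Lemma tame_centralizer p q (y : F) k : tame p q -> (k != 0)%R ->
  commute y (xz p k) -> exists j, y = xz p j.
Proof.
move=> /tame_bij[p' [q' [h1 h2]]] k0 c.
have ep : e2 p' q' p = ga by rewrite -{1}(e2a p q) h1.
have /centralizer_ga : commute (e2 p' q' y) (xz ga k).
  rewrite /commute -ep -(mor_xz _ _ (@e2M p' q')) -!e2M; congr (e2 _ _ _); exact: c.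
case=> // j ej; exists j; rewrite -[y]h2 ej (mor_xz _ _ (@e2M p q)) e2a //.
Qed.

Lemma tame_xz_neq1 p q k : tame p q -> (k != 0)%R -> xz p k != 1.
Proof.
move=> /tame_bij[p' [q' [/can_inj h _]]] k0.
rewrite -(e2a p q) -(mor_xz _ _ (@e2M p q)) -(e21 p q) (inj_eq h) -len_eq0 len_ga_xz.
by rewrite absz_eq0.
Qed.

(** * Stable images of injective endomorphisms *)

Lemma pigeonhole (T : finType) (P : nat -> T -> Prop) :
  (forall n, exists t, P n t) -> exists i j t, [/\ i < j, P i t & P j t].
Proof.
move=> h.
have [g hg] : exists g : 'I_(#|T|.+1) -> T, forall i : 'I_(#|T|.+1), P i (g i).
  by apply: (@fin_all_exists _ (fun=> T) (fun i t => P (nat_of_ord i) t)).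
have /injectivePn [i [j ij e]] : ~~ injectiveb g.
  by apply/injectiveP => /leq_card; rewrite card_ord ltnn.
have [lt|lt|e'] := ltngtP i j; last by case/eqP: ij; apply: val_inj.
  by exists i, j, (g i); split=> //; rewrite e.
by exists j, i, (g i); split=> //; rewrite e.
Qed.

Definition stab (f : F -> F) (z : F) := forall n, exists t, iter n f t = z.

Lemma iterM (f : F -> F) n : {morph f : x y / x * y} -> {morph iter n f : x y / x * y}.
Proof. by move=> fM; elim: n => // n IH x y; rewrite /= IH fM. Qed.

Lemma powers_of_gen (X : choiceType) (i0 : X) (w : freegroup X) :
  (forall l, l \in word w -> l.1 = i0) -> exists k, w = xz (free_gen i0) k.
Proof.
rewrite -{2}[w]fwK; elim: (word w) => [|[i b] s IH] h; first by exists 0%R; rewrite fw_nil.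
have [|k ek] := IH; first by move=> l ls; apply: h; rewrite inE ls orbT.
have /= -> := h _ (mem_head _ _).
rewrite fw_cons ek lett_gen; exists ((if b then -1 else 1) + k)%R.
by rewrite xzD; congr (_ * _); case: b h => _; rewrite ?(xzN _ 1) xz1.
Qed.

Lemma len_ev p q (l : L2) : len (ev p q l) = len (if l.1 == ord0 then p else q).
Proof. by case: l => i b; rewrite /ev /letter_eval /=; case: b; rewrite ?lenV. Qed.

Section StableCyclic.
Variable f : F -> F.
Hypotheses (fM : {morph f : x y / x * y}) (fI : injective f).
Hypothesis fns : ~ (forall z, exists t, f t = z).

Lemma iterI n : injective (iter n f).
Proof. by elim: n => // n IH x y /fI/IH. Qed.

(** Otherwise the reduced pairs generating f^n(F) all lie in a finite set, and two of them coincide.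
    Then f^i(F) = f^j(F) with i < j, and cancelling f^i by injectivity makes f onto. *)
Lemma long_pairs R : exists n p q,
  [/\ tame p q, nred (iter n f p) (iter n f q) & R < tlen (iter n f p) (iter n f q)].
Proof.
apply: contrapT => nex; apply: fns => z.
pose P n (t : R.-bseq L2 * R.-bseq L2) := exists p q,
  [/\ tame p q, word (iter n f p) = t.1 & word (iter n f q) = t.2].
have [n|i [j [t [ij [p1 [q1 [t1 a1 b1]]] [p2 [q2 [t2 a2 b2]]]]]]] := @pigeonhole _ P.
  have [p [q [tpq _ _ e]]] := nielsen_reduction (iterM n fM) TameId.
  have [p1 q1] := tame_neq1 tpq.
  have nr : nred (iter n f p) (iter n f q).
    by case: e => // /esym; rewrite -(mor1 (iterM n fM)) => /iterI/esym/eqP e;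
      rewrite e in p1 q1.
  have le : tlen (iter n f p) (iter n f q) <= R.
    by rewrite leqNgt; apply/negP => lt; apply: nex; exists n, p, q.
  have l1 : size (word (iter n f p)) <= R by move: le; rewrite /tlen /len; lia.
  have l2 : size (word (iter n f q)) <= R by move: le; rewrite /tlen /len; lia.
  by exists (Bseq l1, Bseq l2), p, q.
have [w ew] := tame_surj t1 z.
exists (iter (j - i).-1 f (e2 p2 q2 w)); rewrite -iterS prednK ?subn_gt0 //.
apply: (@iterI i); rewrite -iterD subnKC; last exact: ltnW.
rewrite -ew !(e2_comp _ _ _ (iterM _ fM)).
by congr (e2 _ _ _); apply: word_inj; rewrite ?a1 ?b1 ?a2 ?b2.
Qed.

(** In a reduced pair of total length above 2R one generator is longer than R. By [nred_len_mem] it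
    cannot occur in an element of length at most R. *)
Lemma short_powers R : exists n p q, tame p q /\
  forall z, len z <= R -> (exists t, iter n f t = z) -> exists k, z = xz (iter n f p) k.
Proof.
have [n [p [q [tpq nr lt]]]] := long_pairs R.*2.
have main z : (exists t, iter n f t = z) -> exists2 w, z = e2 (iter n f p) (iter n f q) w
    & forall l, l \in word w -> len (ev (iter n f p) (iter n f q) l) <= len z.
  move=> [t et]; have [w ew] := tame_surj tpq t; exists w.
    by rewrite -et -ew (e2_comp _ _ _ (iterM n fM)).
  move=> l lw; have := nred_len_mem nr (reduced_word w) lw; rewrite fwK.
  by rewrite -(e2_comp _ _ _ (iterM n fM)) ew et.
have [l|l] := ltnP R (len (iter n f q)).
  exists n, p, q; split=> // z lz /main[w ez hw]; rewrite ez in lz hw *.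
  have [|k ->] := @powers_of_gen I2 ord0 w.
    move=> m /hw; rewrite len_ev; case: (ord2P m.1) => // -> /= le.
    by have := leq_trans l (leq_trans le lz); rewrite ltnn.
  by exists k; rewrite (mor_xz _ _ (@e2M _ _)) e2a.
exists n, q, p; split; first exact: TameSwap.
move=> z lz /main[w ez hw]; rewrite ez in lz hw *.
have [|k ->] := @powers_of_gen I2 ord_max w.
  move=> m /hw; rewrite len_ev; case: (ord2P m.1) => // -> /= le.
  by have := leq_trans le lz; move: lt l; rewrite /tlen; lia.
by exists k; rewrite (mor_xz _ _ (@e2M _ _)) e2b.
Qed.

Lemma stab_f z : stab f z -> stab f (f z).
Proof. by move=> h n; have [t <-] := h n; exists (f t); rewrite -iterSr. Qed.

(** By injectivity the unique preimage of z is also the one found at every later stage, so it is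
    stable itself. *)
Lemma stab_preim z : stab f z -> exists2 y, stab f y & f y = z.
Proof.
move=> h; have [y ey] := h 1%N; exists y => // n; have [t et] := h n.+1.
by exists t; apply: fI; rewrite -iterS et.
Qed.

Lemma stab_preim_iter n z : stab f z -> exists2 y, stab f y & iter n f y = z.
Proof.
elim: n z => [|n IH] z h; first by exists z.
have [y /IH[t st et] ey] := stab_preim h; exists t => //.
by rewrite iterS et.
Qed.

Lemma stab_commute y z : stab f y -> stab f z -> commute y z.
Proof.
move=> hy hz; have [n [p [q [_ h]]]] := short_powers (maxn (len y) (len z)).
have [j ->] := h _ (leq_maxl _ _) (hy n).
have [k ->] := h _ (leq_maxr _ _) (hz n).
exact: xzC.
Qed.

Lemma stab_xz y k : stab f y -> stab f (xz y k).
Proof. by move=> h n; have [t <-] := h n; exists (xz t k); rewrite (mor_xz _ _ (iterM n fM)). Qed.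

Lemma fix_stab p s : f p = xz p s -> (s = 1 \/ s = -1)%R -> stab f p.
Proof.
move=> e s1; suff h n : iter n f p = xz p (s ^+ n)%R.
  move=> n; case: (s1) => es; rewrite es in h.
    by exists p; rewrite h GRing.expr1n.
  exists (xz p ((-1) ^+ n)%R); rewrite (mor_xz _ _ (iterM n fM)) h -xzM.
  by rewrite -GRing.exprMn GRing.mulrNN GRing.mulr1 GRing.expr1n.
elim: n => [|n IH]; first by rewrite GRing.expr0 xz1.
by rewrite iterS IH (mor_xz _ _ fM) e -xzM GRing.exprS.
Qed.

Theorem stable_cyclic : (exists2 x, stab f x & x != 1) ->
  exists p q, [/\ tame p q, f p = p \/ f p = p^-1 &
    forall z, stab f z <-> exists k, z = xz p k].
Proof.
move=> [x sx x1]; have [n [p [q [tpq h]]]] := short_powers (len x).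
have [i ex] := h _ (leqnn _) (sx n).
have i0 : (i != 0)%R by apply: contraNneq x1 => i0; rewrite ex i0.
(* p^i is the n-fold preimage of x, which is stable by injectivity. *)
have spi : stab f (xz p i).
  have [y sy ey] := stab_preim_iter n sx; suff -> : xz p i = y by [].
  by apply: (@iterI n); rewrite ey (mor_xz _ _ (iterM n fM)).
have cz y : stab f y -> exists j, y = xz p j.
  by move=> sy; apply: (tame_centralizer tpq i0); apply: stab_commute.
(* f(p) commutes with f(p^i), a nontrivial power of p, so it lies in the centralizer of that
   power. *)
have [s es] : exists s, f p = xz p s.
  have [m em] := cz _ (stab_f spi); rewrite (mor_xz _ _ fM) in em.
  have m0 : (m != 0)%R.
    apply: contra (tame_xz_neq1 tpq i0) => /eqP e0; rewrite e0 -(mor_xz _ _ fM) in em.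
    by apply/eqP/fI; rewrite em (mor1 fM).
  apply: (tame_centralizer tpq m0); rewrite -em; exact: xz_commute.
have es' m : iter m f p = xz p (s ^+ m)%R.
  elim: m => [|m IH]; first by rewrite GRing.expr0 xz1.
  by rewrite iterS IH (mor_xz _ _ fM) es -xzM GRing.exprS.
(* All iterated preimages of p^i are powers of p, so i is divisible by every power of s; as i is not
   0, s must be 1 or -1. *)
have sdiv m : exists t : int, (i = s ^+ m * t)%R.
  have [y sy ey] := stab_preim_iter m spi; have [t et] := cz _ sy.
  exists t; apply/eqP; rewrite -GRing.subr_eq0; apply: contraT => /(tame_xz_neq1 tpq)/eqP[].
  by rewrite xzD xzN xzM -es' -(mor_xz _ _ (iterM m fM)) -et ey mulgV.
have s1 : (s = 1 \/ s = -1)%R.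
  have s0 : (s != 0)%R.
    by apply/eqP => e; have [t et] := sdiv 1%N; move: i0; rewrite et e GRing.expr1 GRing.mul0r eqxx.
  have [t et] := sdiv `|i|%N.
  have : (`|s| ^ `|i| * `|t| = `|i|)%N by rewrite [in RHS]et abszM abszX.
  have : (0 < `|i|)%N by rewrite absz_gt0.
  have [le|lt] := leqP `|s|%N 1; first by move=> _ _; lia.
  case: `|t|%N => [|t' _ e]; first by rewrite muln0; lia.
  have := ltn_expl `|i|%N lt; rewrite -[X in _ < X]muln1; nia.
exists p, q; split=> //.
  by rewrite es; case: s1 => ->; [left; rewrite xz1 | right; rewrite (xzN p 1)].
move=> z; split; first exact: cz.
by case=> k ->; apply: stab_xz; apply: (fix_stab es s1).
Qed.

End StableCyclic.

(** * Normal form of bases *)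

(* Positive words: false stands for a and true for b. *)
Definition pos (w : seq bool) : F :=
  fw [seq ((if c then ord_max else ord0) : I2, false) | c <- w].

Definition subst (w : seq bool) : seq bool :=
  flatten [seq if c then [:: false; true] else [:: false] | c <- w].

(** The list encodes a composite, outermost map first: [true] is the substitution a -> a, b -> ab
    and [false] exchanges a and b. [pmor] is the same composite as an automorphism. *)
Definition papply (l : seq bool) (w : seq bool) : seq bool :=
  foldr (fun o w => if o then subst w else map negb w) w l.

Definition Sg : F -> F := e2 ga (ga * gb).
Definition Ng : F -> F := e2 gb ga.
Fixpoint pmor (l : seq bool) (x : F) : F :=
  if l is o :: l' then if o then Sg (pmor l' x) else Ng (pmor l' x) else x.

Lemma pos_cat v w : pos (v ++ w) = pos v * pos w.
Proof. by rewrite /pos map_cat fw_cat. Qed.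

Lemma pos1 c : pos [:: c] = if c then gb else ga.
Proof. by rewrite /pos /= fw1; case: c. Qed.

Lemma pos_nil : pos [::] = 1. Proof. exact: fw_nil. Qed.

Lemma pos_cons c w : pos (c :: w) = (if c then gb else ga) * pos w.
Proof. by rewrite -cat1s pos_cat pos1. Qed.

Lemma word_pos w : word (pos w) = [seq ((if c then ord_max else ord0) : I2, false) | c <- w].
Proof.
apply: word_fw; case: w => // c w; rewrite /reduced /=.
by elim: w c => //= d w IH c; rewrite IH /letter_inv xpair_eqE andbF.
Qed.

Lemma len_pos w : len (pos w) = size w.
Proof. by rewrite /len word_pos size_map. Qed.

Lemma subst_cat v w : subst (v ++ w) = subst v ++ subst w.
Proof. by rewrite /subst map_cat flatten_cat. Qed.

Lemma pos_subst w : pos (subst w) = Sg (pos w).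
Proof.
elim: w => [|c w IH]; first by rewrite !pos_nil /Sg e21.
rewrite -cat1s subst_cat !pos_cat IH /Sg e2M; congr (_ * _).
by case: c; rewrite /subst /= !pos_cons pos_nil !mulg1 ?e2a ?e2b.
Qed.

Lemma pos_negb w : pos (map negb w) = Ng (pos w).
Proof.
elim: w => [|c w IH]; first by rewrite !pos_nil /Ng e21.
rewrite /= -cat1s -[c :: w]cat1s !pos_cat IH /Ng e2M; congr (_ * _).
by case: c; rewrite !pos1 ?e2a ?e2b.
Qed.

Lemma pos_papply l w : pos (papply l w) = pmor l (pos w).
Proof. by elim: l => //= -[] l IH; rewrite ?pos_subst ?pos_negb IH. Qed.

Lemma pmorM l : {morph pmor l : x y / x * y}.
Proof. by elim: l => //= -[] l IH x y; rewrite IH; apply: e2M. Qed.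

Lemma pmor_cat l k x : pmor (l ++ k) x = pmor l (pmor k x).
Proof. by elim: l => //= o l ->. Qed.

Lemma papply_cat l k x : papply (l ++ k) x = papply l (papply k x).
Proof. exact: foldr_cat. Qed.

Definition rs (c d : bool) : F -> F := e2 (lett (ord0 : I2, c)) (lett (ord_max : I2, d)).

Definition normal_form (p q : F) := exists (g : F) c d l (s t : L2),
  [/\ s.1 != t.1, p = (rs c d (pmor l (lett s))) ^ g & q = (rs c d (pmor l (lett t))) ^ g].

Definition swap2 (i : I2) : I2 := if i == ord0 then ord_max else ord0.

Lemma Ng_lett (s : L2) : Ng (lett s) = lett (swap2 s.1, s.2).
Proof.
case: s => i b; rewrite /Ng e2_lett /ev /letter_eval /im2 /=.
by case: (ord2P i) => -> /=; case: b; rewrite ?lett_gen.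
Qed.

Lemma rs_lett c d (s : L2) :
  rs c d (lett s) = lett (s.1, s.2 (+) (if s.1 == ord0 then c else d)).
Proof.
case: s => i b; rewrite /rs e2_lett /ev /letter_eval /im2 /=.
by case: (ord2P i) => -> /=; case: b; rewrite -?lettV //= /letter_inv /= ?addTb ?addFb //; rewrite addbC.
Qed.

(** Induction on the Nielsen moves, of which only the product p q needs work. With equal signs it is
    one more substitution; with opposite signs it undoes the last substitution. *)
Lemma tame_normal_form p q : tame p q -> normal_form p q.
Proof.
move: p q; pose nfl l p q := exists (g : F) c d (s t : L2),
  [/\ s.1 != t.1, p = (rs c d (pmor l (lett s))) ^ g & q = (rs c d (pmor l (lett t))) ^ g].
have rM c d l : {morph (fun x => rs c d (pmor l x)) : x y / x * y}.
  by move=> x y /=; rewrite pmorM; exact: e2M.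
have conv l k p q (g h : F) c d (s t s' t' : F) :
    p = (rs c d (pmor l s)) ^ g -> q = (rs c d (pmor l t)) ^ g ->
    s = pmor k s' ^ h -> t = pmor k t' ^ h ->
    p = (rs c d (pmor (l ++ k) s')) ^ (rs c d (pmor l h) * g) /\
    q = (rs c d (pmor (l ++ k) t')) ^ (rs c d (pmor l h) * g).
  move=> -> -> -> ->; rewrite !pmor_cat !conjgM -!(morJ _ _ (rM c d l)).
  by [].
(* A final exchange of a and b can be moved into the choice of the two letters. *)
have absorb l p q : nfl (rcons l false) p q -> nfl l p q.
  case=> g [c [d [s [t [st ep eq]]]]]; exists g, c, d, (swap2 s.1, s.2), (swap2 t.1, t.2).
  rewrite ep eq -cats1 !pmor_cat /= !Ng_lett; split=> //.
  by move: st; case: (ord2P s.1) => ->; case: (ord2P t.1) => ->.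
(* So the list may be assumed empty or ending in a genuine substitution. *)
have norm p q : normal_form p q -> nfl [::] p q \/ exists l, nfl (rcons l true) p q.
  case=> g [c [d [l [s [t [st ep eq]]]]]].
  have : nfl l p q by exists g, c, d, s, t.
  elim/last_ind: l {ep eq} => [|l [] IH] h; [by left | by right; exists l |].
  by apply: IH; apply: absorb.
(* With an empty list the signs of the letters move into the sign change [rs], which makes both
   letters positive. *)
have base p q : nfl [::] p q -> exists (g : F) c d (s t : L2),
    [/\ s.1 != t.1, p = (rs c d (lett s)) ^ g, q = (rs c d (lett t)) ^ g, s.2 = false & t.2 = false].
  case=> g [c [d [s [t [st ep eq]]]]].
  exists g, (c (+) (if s.1 == ord0 then s.2 else t.2)), (d (+) (if s.1 == ord0 then t.2 else s.2)).
  exists (s.1, false), (t.1, false); rewrite ep eq /= !rs_lett; split=> //=.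
    by congr (lett (_, _) ^ _); case: (ord2P s.1) st => ->; case: (ord2P t.1) => -> //= _; rewrite addbC.
  by congr (lett (_, _) ^ _); case: (ord2P s.1) st => ->; case: (ord2P t.1) => -> //= _; rewrite addbC.
have Sa : Sg ga = ga by rewrite /Sg e2a.
have Sb : Sg gb = ga * gb by rewrite /Sg e2b.
have Na : Ng ga = gb by rewrite /Ng e2a.
have Nb : Ng gb = ga by rewrite /Ng e2b.
have NSa : Ng (Sg ga) = gb by rewrite Sa Na.
have NSb : Ng (Sg gb) = gb * ga by rewrite Sb /Ng e2M -/Ng Na Nb.
have SV x : Sg x^-1 = (Sg x)^-1 by exact: e2V.
have NV x : Ng x^-1 = (Ng x)^-1 by exact: e2V.
pose A : L2 := (ord0, false); pose A' : L2 := (ord0, true).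
pose B : L2 := (ord_max, false); pose B' : L2 := (ord_max, true).
have eA : lett A = ga by []. have eB : lett B = gb by [].
have eA' : lett A' = ga^-1 by rewrite lett_gen. have eB' : lett B' = gb^-1 by rewrite lett_gen.
have same p q g c d l (s t : L2) : s.1 != t.1 -> s.2 = t.2 ->
    p = (rs c d (pmor l (lett s))) ^ g -> q = (rs c d (pmor l (lett t))) ^ g ->
    normal_form (p * q) q.
  move=> st s2 ep eq.
  suff [k [s' [t' [h [st' e1 e2]]]]] : exists k (s' t' : L2) (h : F),
      [/\ s'.1 != t'.1, lett s * lett t = pmor k (lett s') ^ h & lett t = pmor k (lett t') ^ h].
    have ep' : p * q = rs c d (pmor l (lett s * lett t)) ^ g by rewrite ep eq -conjMg -(rM c d l).
    have [E1 E2] := conv l k (p * q) q g h c d _ _ _ _ ep' eq e1 e2.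
    by eexists; exists c, d, (l ++ k), s', t'; split; [exact: st' | exact: E1 | exact: E2].
  case: s t st s2 {ep eq} => i b [j b'] /= st <-.
  case: (ord2P i) st => ->; case: (ord2P j) => -> // _; case: b.
  - exists [:: false; true], B', A', 1; split=> //; rewrite conjg1 /= ?eA' ?eB' SV NV ?NSa ?NSb ?invgM //.
  - exists [:: false; true], B, A, gb; split=> //; rewrite /= ?eA ?eB ?NSa ?NSb conjgE ?mulgA ?mulVg ?mul1g ?mulgK ?mulgVK ?mulKg //.
  - exists [:: true], B', A', 1; split=> //; rewrite conjg1 /= ?eA' ?eB' SV ?Sa ?Sb ?invgM //.
  - exists [:: true], B, A, ga; split=> //; rewrite /= ?eA ?eB ?Sa ?Sb conjgE -?mulgA ?mulKg //.
move=> p q; elim=> {p q} [|p q _|p q _|p q _].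
- exists 1, false, false, [::], A, B; split=> //; rewrite conjg1 /= rs_lett //.
- case=> g [c [d [l [s [t [st ep eq]]]]]]; exists g, c, d, l, t, s; by rewrite eq_sym.
- case=> g [c [d [l [s [t [st ep eq]]]]]]; exists g, c, d, l, (letter_inv s), t; split=> //.
  by rewrite ep lettV (morV (rM c d l)) conjVg.
move/norm=> [/base[g [c [d [s [t [st ep eq s2 t2]]]]]]|[l [g [c [d [s [t [st ep eq]]]]]]]].
  by apply: (@same p q g c d [::] s t); rewrite ?s2 ?t2.
have [s2|s2] := eqVneq s.2 t.2; first exact: (same _ _ _ _ _ _ _ _ st s2 ep eq).
(* Opposite signs: the final substitution meets a product such as a^-1 b, which it sends to the
   single letter b. The remaining sign and order patterns are computed below. *)
suff [k [s' [t' [h [st' e1 e2]]]]] : exists k (s' t' : L2) (h : F),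
    [/\ s'.1 != t'.1, Sg (lett s * lett t) = pmor k (lett s') ^ h & Sg (lett t) = pmor k (lett t') ^ h].
  have ep' : p * q = rs c d (pmor l (Sg (lett s * lett t))) ^ g.
    by rewrite ep eq -conjMg -(rM c d _) -cats1 pmor_cat.
  have eq' : q = rs c d (pmor l (Sg (lett t))) ^ g by rewrite eq -cats1 pmor_cat.
  have [E1 E2] := conv l k (p * q) q g h c d _ _ _ _ ep' eq' e1 e2.
  by eexists; exists c, d, (l ++ k), s', t'; split; [exact: st' | exact: E1 | exact: E2].
have SM x y : Sg (x * y) = Sg x * Sg y by exact: e2M.
case: s t st s2 {ep eq} => i b [j b'] /= st s2.
case: (ord2P i) st => ->; case: (ord2P j) => -> // _; case: b s2; case: b' => // _.
- exists [:: false; true], A, B, gb; split=> //; rewrite ?SM -/A' -/B /= ?eA ?eA' ?eB ?SV ?NSa ?NSb ?Sa ?Sb conjgE -?mulgA ?mulKg //.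
- exists [:: false; true], A', B', ga^-1; split=> //; rewrite ?SM -/A -/B' /= ?eA ?eA' ?eB' ?SV ?NV ?NSa ?NSb ?Sa ?Sb conjgE ?invgM ?invgK -?mulgA ?mulVKg //.
- exists [::], B', A, 1; split=> //; rewrite ?SM -/B' -/A /= ?eA ?eB' ?SV ?Sa ?Sb conjg1 ?invgM -?mulgA ?mulVg ?mulg1 //.
- exists [::], B, A', ga^-1; split=> //; rewrite ?SM -/B -/A' /= ?eA' ?eB ?SV ?Sa ?Sb conjgE ?invgK -?mulgA ?mulVKg //; by rewrite mulgV mulg1.
Qed.

(** * Christoffel words *)

Definition na (w : seq bool) : nat := count negb w.
Definition nb (w : seq bool) : nat := count id w.

Arguments na : simpl never.
Arguments nb : simpl never.

Lemma na_cat v w : na (v ++ w) = na v + na w. Proof. exact: count_cat. Qed.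
Lemma nb_cat v w : nb (v ++ w) = nb v + nb w. Proof. exact: count_cat. Qed.
Lemma na_cons c w : na (c :: w) = ~~ c + na w. Proof. by []. Qed.
Lemma nb_cons c w : nb (c :: w) = c + nb w. Proof. by []. Qed.
Lemma na_nil : na [::] = 0. Proof. by []. Qed.
Lemma nb_nil : nb [::] = 0. Proof. by []. Qed.
Definition nab_simp := (na_cat, nb_cat, na_cons, nb_cons, na_nil, nb_nil).

Lemma na_nb (w : seq bool) : na w + nb w = size w.
Proof. by elim: w => // c w /=; rewrite !nab_simp; case: c; lia. Qed.

Lemma subst_cons c w : subst (c :: w) = (if c then [:: false; true] else [:: false]) ++ subst w.
Proof. by []. Qed.

Lemma size_subst (w : seq bool) : size (subst w) = size w + nb w.
Proof. by elim: w => // c w; rewrite subst_cons size_cat nab_simp /=; case: c => /=; lia. Qed.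

Lemma na_subst (w : seq bool) : na (subst w) = size w.
Proof. by elim: w => // c w; rewrite subst_cons na_cat /= => ->; case: c. Qed.

Lemma nb_subst (w : seq bool) : nb (subst w) = nb w.
Proof. by elim: w => // c w; rewrite subst_cons !nb_cat nab_simp => ->; case: c. Qed.

Lemma nab_negb w : na (map negb w) = nb w /\ nb (map negb w) = na w.
Proof. by elim: w => //= c w; rewrite !nab_simp => -[-> ->]; rewrite negbK. Qed.

Lemma size_papply (l w : seq bool) : 0 < na w -> 0 < nb w ->
  [/\ 0 < na (papply l w), 0 < nb (papply l w) & size w + nb l <= size (papply l w)].
Proof.
move=> aw bw; elim: l => [|[] l [h1 h2 h3]] /=; first by rewrite addn0.
  have h4 := na_nb (papply l w); rewrite na_subst nb_subst size_subst nab_simp; split; lia.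
by have [-> ->] := nab_negb (papply l w); rewrite size_map nab_simp; split; lia.
Qed.

(** Substitutions that act trivially on a letter are dropped from the inner end of the list. Each of
    those kept adds at least one letter, so their number is bounded by the length of the word. *)
Lemma papply_strip l c :
  exists l', papply l' [:: false] = papply l [:: c] /\ nb l' <= size (papply l [:: c]).
Proof.
have [n] := ubnP (size l); elim: n l c => // n IH l c.
case/lastP: l => [|l o] lt.
  by case: c; [exists [:: false] | exists [::]].
rewrite size_rcons in lt; have lt1 : size l < n by lia.
rewrite -cats1 papply_cat; case: o c => -[].
- exists (l ++ [:: true; false]); rewrite papply_cat; split=> //.
  have [//|//|_ _] := @size_papply l [:: false; true].
  by rewrite !nab_simp /= -[subst _]/[:: false; true] /=; lia.
- exact: (IH l false).
- exact: (IH l false).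
- exact: (IH l true).
Qed.

(** The determinant of the abelianised pair; it equals the determinant of c and c d. *)
Definition det2 (c d : seq bool) : int := ((na c)%:Z * (nb d)%:Z - (nb c)%:Z * (na d)%:Z)%R.

Definition cyc (w X : seq bool) := exists u v, X = u ++ v /\ w = v ++ u.

Lemma cyc_refl w : cyc w w. Proof. by exists [::], w; rewrite cats0. Qed.

Lemma cyc_rot u v X : cyc (u ++ v) X -> cyc (v ++ u) X.
Proof.
case=> s [t [-> e]].
have [le|/ltnW le] := leqP (size u) (size t).
  have e1 : u = take (size u) t by have := congr1 (take (size u)) e; rewrite take_size_cat // takel_cat.
  have e2 : v = drop (size u) t ++ s.
    have := congr1 (drop (size u)) e; rewrite drop_size_cat // drop_cat.
    move: le; rewrite leq_eqVlt => /orP[/eqP ->|->] //.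
    by rewrite ltnn subnn drop0 drop_size.
  exists (s ++ take (size u) t), (drop (size u) t).
  by rewrite -catA cat_take_drop {1}e2 {2}e1 catA.
have e1 : t = take (size t) u.
  by have := congr1 (take (size t)) e; rewrite takel_cat // take_size_cat.
have e2 : s = drop (size t) u ++ v.
  have := congr1 (drop (size t)) e; rewrite [RHS]drop_size_cat // drop_cat.
  move: le; rewrite leq_eqVlt => /orP[/eqP ->|->] // <-.
  by rewrite ltnn subnn drop0 drop_size.
exists (drop (size t) u), (v ++ t); rewrite {1}e2 catA; split=> //.
by rewrite -catA {1}e1 cat_take_drop.
Qed.

Lemma cyc_map u X : cyc u (map negb X) -> exists2 u', cyc u' X & u = map negb u'.
Proof.
case=> s [t [e ->]]; exists (map negb (t ++ s)).
  exists (map negb s), (map negb t); rewrite !map_cat; split=> //.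
  by rewrite -map_cat -e mapK //; apply: negbK.
by rewrite mapK //; apply: negbK.
Qed.

Lemma subst_split X u v : subst X = u ++ v ->
  (exists u' v', [/\ X = u' ++ v', u = subst u' & v = subst v']) \/
  (exists u' v', [/\ X = u' ++ true :: v', u = subst u' ++ [:: false] & v = true :: subst v']).
Proof.
elim: X u v => [|c X IH] u v.
  by case: u v => [|? ?] [|? ?] // _; left; exists [::], [::].
case: u => [|x u] e; first by left; exists [::], (c :: X); split.
move: e; rewrite -cat1s subst_cat; case: c => /= -[<-]; last first.
  move=> /IH[[u' [v' [-> -> ->]]]|[u' [v' [-> -> ->]]]].
    by left; exists (false :: u'), v'.
  by right; exists (false :: u'), v'.
case: u => [|y u] /=; first by move=> <-; right; exists [::], X.
case=> <- /IH[[u' [v' [-> -> ->]]]|[u' [v' [-> -> ->]]]].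
  by left; exists (true :: u'), v'.
by right; exists (true :: u'), v'.
Qed.

Lemma cyc_subst w X : cyc w (subst X) ->
  (exists2 w', cyc w' X & w = subst w') \/
  (exists2 w', cyc (true :: w') X & w = true :: subst w' ++ [:: false]).
Proof.
case=> u [v [/subst_split[[u' [v' [-> -> ->]]]|[u' [v' [-> -> ->]]]] ->]].
  by left; exists (v' ++ u'); [exists u', v' | rewrite subst_cat].
right; exists (v' ++ u'); first by exists u', (true :: v').
by rewrite subst_cat /= catA.
Qed.

Lemma cyc_count w X : cyc w X -> na w = na X /\ nb w = nb X.
Proof. by case=> u [v [-> ->]]; rewrite !na_cat ?nb_cat ?nab_simp; split; lia. Qed.

(* The four relative positions of the two cutting points of a cyclic word     *)
(* subst X with respect to its blocks a and ab.                               *)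
Lemma cyc_subst_cases (P : seq bool -> seq bool -> Prop) X :
  (forall c d, P c d -> P d c) ->
  (forall c, P c [::]) ->
  (forall c d, cyc (c ++ d) X -> P (subst c) (subst d)) ->
  (forall c d, cyc (true :: c ++ true :: d) X ->
     P (subst (true :: c)) (subst (true :: d)) ->
     P (true :: subst c ++ [:: false]) (true :: subst d ++ [:: false])) ->
  (forall c d, cyc (true :: c ++ d) X ->
     cyc ((true :: subst c) ++ subst d ++ [:: false]) (subst X) ->
     P (true :: subst c) (subst d ++ [:: false])) ->
  forall c d, cyc (c ++ d) (subst X) -> P c d.
Proof.
move=> Psym P0 P1 P2 P3 c d h0; move: (h0) => /cyc_subst[[w cw]|[w cw]].
  move=> /esym/subst_split[[u [v [ew ec ed]]]|[u [v [ew ec ed]]]].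
    by rewrite ec ed; apply: P1; rewrite -ew.
  rewrite ec ed in h0 *; apply: Psym; apply: P3; last exact: cyc_rot.
  by apply: (@cyc_rot u (true :: v)); rewrite -ew.
case: c h0 => [|x c] h e; first exact/Psym/P0.
move: e; case/lastP: d h => [|d y] h; first by rewrite cats0; move=> _; exact: P0.
rewrite /= -rcons_cat cats1 => -[ex /eqP]; rewrite eqseq_rcons => /andP[/eqP e /eqP ey].
rewrite ex ey -cats1 in h *; case: (subst_split (esym e)) => -[u [v [ew ec ed]]].
  by rewrite ec ed in h *; apply: P3; rewrite -?ew.
rewrite ec ed; apply: P2; first by rewrite -ew.
by apply: P1; rewrite /= -ew.
Qed.

(** On the periodic lattice path of X the determinant is the difference of the levels, relative to
    the direction of X, of the two cutting points; the vertices of a period fill [size X]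
    consecutive levels. The proof pulls cuts back along the substitution. *)
Lemma chr_range l c d : cyc (c ++ d) (papply l [:: false]) ->
  (`|det2 c d| < size (papply l [:: false]))%N.
Proof.
elim: l c d => [|[] l IH] c d.
- case=> u [v [/= e1 e2]]; have : size (c ++ d) = 1%N.
    by rewrite e2 size_cat addnC -size_cat -e1.
  rewrite size_cat /det2; case: c {e2} => [|x c] /=; first by rewrite !nab_simp; lia.
  by case: d => [|y d] /=; [rewrite !nab_simp | ]; lia.
- rewrite [papply _ _]/=; set X := papply l _ in IH *.
  apply: (@cyc_subst_cases (fun c d => (`|det2 c d| < size (subst X))%N)) => {c d} [c d|c|c d h|c d h|c d h _].
  + by rewrite /det2; lia.
  + rewrite /det2 !GRing.mulr0 size_subst /=; have := IH [::] X (cyc_refl X); lia.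
  + have := IH _ _ h; rewrite /det2 !na_subst !nb_subst size_subst -!na_nb; lia.
  + by rewrite /det2 /= !na_cat ?nb_cat ?nab_simp !na_subst !nb_subst /=; lia.
  have [] := cyc_count h; have := IH (true :: c) d h.
  rewrite /det2 /= !na_cat ?nb_cat ?nab_simp !na_subst !nb_subst size_subst -!na_nb /=.
  set ac := na c; set bc := nb c; set ad := na d; set bd := nb d; nia.
move=> /cyc_map[w cw e].
have [c' ec] : exists c', c = map negb c'.
  by exists (map negb c); rewrite mapK //; apply: negbK.
have [d' ed] : exists d', d = map negb d'.
  by exists (map negb d); rewrite mapK //; apply: negbK.
move: e; rewrite ec ed -map_cat => /(inj_map negb_inj) e.
rewrite /= size_map; have := IH c' d'; rewrite e => /(_ cw).
by rewrite /det2; have [-> ->] := nab_negb c'; have [-> ->] := nab_negb d'; lia.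
Qed.

Definition gens (p q : F) := forall z, exists t, e2 p q t = z.

Lemma gens_mor (f : F -> F) p q : {morph f : x y / x * y} ->
  (forall z, exists t, f t = z) -> gens p q -> gens (f p) (f q).
Proof.
move=> fM fs h z; have [t <-] := fs z; have [w <-] := h t; exists w.
by rewrite (e2_comp _ _ _ fM).
Qed.

Lemma gens_e2 p q s t : gens (e2 p q s) (e2 p q t) -> gens p q.
Proof.
by move=> h z; have [w <-] := h z; exists (e2 s t w); rewrite (e2_comp _ _ _ (@e2M p q)).
Qed.

Lemma gensC p q : gens p q -> gens q p.
Proof. by move=> h; apply: (@gens_e2 _ _ gb ga); rewrite e2a e2b. Qed.

Lemma conj_mor (g : F) : {morph (fun x : F => x ^ g) : x y / x * y}.
Proof. by move=> x y; exact: conjMg. Qed.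

Lemma gensJ p q (g : F) : gens (p ^ g) (q ^ g) -> gens p q.
Proof.
move=> h; rewrite -(conjgK g p) -(conjgK g q).
apply: (@gens_mor (fun x => x ^ g^-1)) => //; first exact: conj_mor.
by move=> z; exists (z ^ g); rewrite conjgK.
Qed.

Lemma gens_id : gens ga gb. Proof. by move=> z; exists z; rewrite e2_id. Qed.

Lemma Sg_surj z : exists t, Sg t = z.
Proof.
exists (e2 ga (ga^-1 * gb) z); rewrite /Sg (e2_comp _ _ _ (@e2M _ _)).
by rewrite !e2M e2V !e2a e2b mulKg e2_id.
Qed.

Lemma Ng_surj z : exists t, Ng t = z.
Proof.
exists (e2 gb ga z); rewrite /Ng (e2_comp _ _ _ (@e2M _ _)).
by rewrite e2a e2b e2_id.
Qed.

Lemma gens_subst c d : gens (pos c) (pos d) -> gens (pos (subst c)) (pos (subst d)).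
Proof. rewrite !pos_subst; apply: gens_mor => //; [exact: e2M | exact: Sg_surj]. Qed.

Lemma posJ_a c : pos (false :: c) ^ ga = pos (c ++ [:: false]).
Proof. by rewrite pos_cat pos_cons pos1 conjgE !mulgA mulVg mul1g. Qed.

Lemma gens_rot_a c d : gens (pos (false :: c)) (pos (false :: d)) ->
  gens (pos (c ++ [:: false])) (pos (d ++ [:: false])).
Proof.
by rewrite -!posJ_a => h; apply: (@gensJ _ _ ga^-1); rewrite !conjgK.
Qed.

(** Cuts at the ends of blocks pull back along the substitution, and cuts inside blocks ab become
    such after conjugation by a. The configuration that resists is excluded by [chr_range]. *)
Lemma chr_basis l c d : cyc (c ++ d) (papply l [:: false]) ->
  `|det2 c d|%N = 1%N -> gens (pos c) (pos d).
Proof.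
elim: l c d => [|[] l IH] c d.
- move=> /chr_range; rewrite /= ltnS leqn0 => /eqP -> //.
- move=> h; have rng := @chr_range (true :: l); move: h rng.
  rewrite [papply _ _]/=; set X := papply l _ in IH * => h rng; move: h.
  apply: (@cyc_subst_cases (fun c d => `|det2 c d|%N = 1%N -> gens (pos c) (pos d))) => {c d}
    [c d h e|c|c d h|c d h|c d h hX].
  + by apply: gensC; apply: h; rewrite -e /det2; lia.
  + by rewrite /det2 !nab_simp !GRing.mulr0.
  + move=> e; apply: gens_subst; apply: IH => //; move: e.
    by rewrite /det2 !na_subst !nb_subst -!na_nb; lia.
  + move=> IH1 e.
    apply: (@gens_rot_a (true :: subst c) (true :: subst d)).
    apply: IH1; move: e; rewrite /det2 !subst_cons !nab_simp !na_subst !nb_subst /=.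
    by rewrite -!na_nb; lia.
  case/lastP: c h hX => [|c x] h hX e.
    have : size d = 0 by move: e; rewrite /det2 !nab_simp na_subst nb_subst /=; lia.
    by move/size0nil => ->; rewrite !pos1; apply: gensC gens_id.
  case: x h hX e => h hX e; last first.
    rewrite -cats1 subst_cat; apply: (@gens_rot_a (true :: subst c) (subst d)).
    apply: (@gens_subst (true :: c) (false :: d)); apply: IH; first by rewrite /= -cat_rcons.
    move: e; rewrite /det2 -cats1 subst_cat !nab_simp !na_subst !nb_subst /=.
    by rewrite -!na_nb; lia.
  (* Here c begins and ends with b. Lengthening c by an a at both ends, or shortening it by its b at
     both ends, gives two further cuts; the range allowed for them is incompatible with determinant
     +-1. *)
  exfalso; case: d h hX e => [|y d] h hX e.
    by move: e; rewrite /det2 -cats1 subst_cat !nab_simp !na_subst !nb_subst /= /na /nb /=; lia.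
  have [d3 ed] : exists d3, subst (y :: d) = false :: d3.
    by rewrite subst_cons; case: (y) => /=; eexists.
  move: hX e (na_subst (y :: d)) (nb_subst (y :: d)).
  rewrite ed -cats1 subst_cat -[subst [:: true]]/[:: false; true] => hX e nd bd.
  have h1 := rng (false :: (true :: subst c ++ [:: false; true]) ++ [:: false]) d3.
  have h2 := rng (subst c ++ [:: false]) (true :: false :: d3 ++ [:: false; true]).
  have {}h1 : (`|det2 (false :: (true :: subst c ++ [:: false; true]) ++ [:: false]) d3| < size (subst X))%N.
    apply: h1.
    have := @cyc_rot ((true :: subst c ++ [:: false; true]) ++ false :: d3) [:: false] (subst X).
    rewrite /= -!catA /=; apply; move: hX; by rewrite /= -!catA.
  have {}h2 : (`|det2 (subst c ++ [:: false]) (true :: false :: d3 ++ [:: false; true])| < size (subst X))%N.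
    apply: h2; have := @cyc_rot [:: true] (subst c ++ [:: false] ++ true :: false :: d3 ++ [:: false]) (subst X).
    rewrite -!catA /= -!catA /=; apply; move: hX; by rewrite /= -!catA.
  have [n1 n2] := cyc_count hX; move: h1 h2 e n1 n2; rewrite -[size (subst X)]na_nb => h1 h2 e n1 n2.
  rewrite -n1 -n2 in h1 h2; have := na_nb c; have := na_nb d; move: nd bd h1 h2 e; clear.
  rewrite /det2 !nab_simp !na_subst !nb_subst /=.
  move: (na d3) (nb d3) (size c) (nb c) (size d) (nb d) (na c) (na d) => A3 B3 S1 B1 S2 B2 A1 A2.
  case: y => /=; nia.
move=> /cyc_map[w cw e].
have [c' ec] : exists c', c = map negb c'.
  by exists (map negb c); rewrite mapK //; apply: negbK.
have [d' ed] : exists d', d = map negb d'.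
  by exists (map negb d); rewrite mapK //; apply: negbK.
move: e; rewrite ec ed -map_cat => /(inj_map negb_inj) e.
rewrite !pos_negb => h; apply: gens_mor; [exact: e2M | exact: Ng_surj |].
apply: IH; first by rewrite e.
move: h; rewrite /det2; have [-> ->] := nab_negb c'; have [-> ->] := nab_negb d'; lia.
Qed.

(** * Length of the word of a fixed primitive element *)

Section ExponentSum.
Variable X : choiceType.

Definition lsum (i : X) (s : seq (letter X)) : int :=
  ((count_mem (i, false) s)%:Z - (count_mem (i, true) s)%:Z)%R.

Definition esum (i : X) (x : freegroup X) : int := lsum i (word x).

Lemma lsum_cat i s t : lsum i (s ++ t) = (lsum i s + lsum i t)%R.
Proof. by rewrite /lsum !count_cat; lia. Qed.

Lemma lsum_inv i s : lsum i (word_inv s) = (- lsum i s)%R.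
Proof.
have e b : count_mem (i, b) (word_inv s) = count_mem (i, ~~ b) s.
  rewrite /word_inv count_rev count_map; apply: eq_count => -[j c] /=.
  by rewrite /letter_inv !xpair_eqE /=; case: b; case: c.
by rewrite /lsum !e /=; lia.
Qed.

Lemma esumM i x y : esum i (x * y) = (esum i x + esum i y)%R.
Proof.
have [s [p [t [e1 e2 e3]]]] := cancelP x y.
by rewrite /esum e1 e2 e3 !lsum_cat lsum_inv; lia.
Qed.

Lemma esum1 i : esum i 1 = 0%R. Proof. by rewrite /esum /lsum. Qed.

Lemma esumV i x : esum i x^-1 = (- esum i x)%R.
Proof. by have := esumM i x x^-1; rewrite mulgV esum1; lia. Qed.

Lemma esumJ i x y : esum i (x ^ y) = esum i x.
Proof. by rewrite conjgE !esumM esumV; lia. Qed.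

Lemma esum_xz i x k : esum i (xz x k) = (k * esum i x)%R.
Proof.
have e n : esum i (x ^+ n) = (n%:Z * esum i x)%R.
  by elim: n => [|n IH]; rewrite ?expg0 ?esum1 ?expgS ?esumM ?IH; lia.
case: k => n; first exact: e.
by rewrite -[xz _ _]/(x ^- n.+1) esumV e; lia.
Qed.

Lemma esum_len i x : (`|esum i x| <= len x)%N.
Proof.
rewrite /esum /len; elim: (word x) => // l s IH.
by move: IH; rewrite /lsum /=; do 2 case: (_ == _) => /=; lia.
Qed.

End ExponentSum.

Notation ea := (esum (ord0 : I2)).
Notation eb := (esum (ord_max : I2)).

Lemma ea_ga : ea ga = 1%R. Proof. by []. Qed.
Lemma eb_ga : eb ga = 0%R. Proof. by []. Qed.
Lemma ea_gb : ea gb = 0%R. Proof. by []. Qed.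
Lemma eb_gb : eb gb = 1%R. Proof. by []. Qed.
Definition esum_gen := (ea_ga, eb_ga, ea_gb, eb_gb).

Lemma esum_mor (f : F -> F) i x : {morph f : x y / x * y} ->
  esum i (f x) = (ea x * esum i (f ga) + eb x * esum i (f gb))%R.
Proof.
move=> fM; rewrite -[x]fwK; elim: (word x) => [|[j b] s IH].
  by rewrite fw_nil (mor1 fM) !esum1; lia.
rewrite fw_cons fM !esumM IH lett_gen.
case: (ord2P j) => ->; rewrite -/ga -/gb; case: b; rewrite ?(morV fM) ?esumV !esum_gen; ring.
Qed.

Lemma esum_pos w : ea (pos w) = na w /\ eb (pos w) = nb w.
Proof.
elim: w => [|c w [IH1 IH2]]; first by rewrite pos_nil !esum1.
by rewrite pos_cons !esumM IH1 IH2 !nab_simp; case: c; rewrite !esum_gen; split; lia.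
Qed.

Lemma det2_papply l c d : `|det2 (papply l c) (papply l d)|%N = `|det2 c d|%N.
Proof.
elim: l => //= -[] l <-; rewrite /det2.
  by rewrite !na_subst !nb_subst -!na_nb; congr absz; lia.
have [-> ->] := nab_negb (papply l c); have [-> ->] := nab_negb (papply l d); lia.
Qed.

Lemma reduced_power (X : choiceType) (s : seq (letter X)) n :
  0 < size s -> reduced (s ++ s) -> reduced (flatten (nseq n s)).
Proof.
move=> s0 r; case: n => // n; elim: n => [|n IH] /=.
  by rewrite cats0; case: (reduced_cat r).
exact: reduced_glue.
Qed.

(** Compare k-th powers: s^k is reduced, while the conjugated power of z has length at most k |z| +
    2 |g|. The choice k = 2 |g| + 1 is large enough. *)
Lemma conj_len (X : choiceType) (s : seq (letter X)) (z g : freegroup X) :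
  reduced (s ++ s) -> fw s = z ^ g -> size s <= len z.
Proof.
move=> r e; have [->//|s0] := posnP (size s).
pose k := (len g).*2.+1.
have ek : fw s ^+ k = fw (flatten (nseq k s)).
  by elim: k => [|k IH]; rewrite ?fw_nil // expgS /= fw_cat IH.
have l1 : len (fw s ^+ k) = (k * size s)%N.
  rewrite ek /len word_fw ?reduced_power // size_flatten /shape map_nseq.
  by rewrite sumn_nseq mulnC.
have l2 : (len (fw s ^+ k) <= k * len z + (len g).*2)%N.
  rewrite e -conjXg conjgE; apply: leq_trans (lenM _ _) _; rewrite lenV.
  have h1 := lenM (z ^+ k) g; have h2 := lenX z k.
  apply: leq_trans (leq_add (leqnn _) h1) _; lia.
rewrite leqNgt; apply/negP => lt; move: l2; rewrite l1 /k; nia.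
Qed.

Definition comm2 (x y : F) : F := x * y * x^-1 * y^-1.

Lemma comm2_mor (f : F -> F) x y : {morph f : x y / x * y} -> f (comm2 x y) = comm2 (f x) (f y).
Proof. by move=> fM; rewrite /comm2 !fM !(morV fM). Qed.

(** Each generating automorphism sends [a, b] to a conjugate of [a, b] or of its inverse. *)
Lemma comm2_pmor l : exists (h : F) e, (e = 1 \/ e = -1)%R /\
  comm2 (pmor l ga) (pmor l gb) = xz (comm2 ga gb) e ^ h.
Proof.
elim: l => [|o l [h [e [e1 eq]]]]; first by exists 1, 1%R; rewrite conjg1; split; auto.
have SM : {morph Sg : x y / x * y} by exact: e2M.
have NM : {morph Ng : x y / x * y} by exact: e2M.
case: o => /=.
  rewrite -(comm2_mor _ _ SM) eq (morJ _ _ SM) (mor_xz _ _ SM) (comm2_mor _ _ SM).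
  have -> : comm2 (Sg ga) (Sg gb) = comm2 ga gb ^ ga^-1.
    by rewrite /Sg e2a e2b /comm2 conjgE invgK invgM !mulgA.
  by exists (ga^-1 * Sg h), e; rewrite xzJ conjgM.
rewrite -(comm2_mor _ _ NM) eq (morJ _ _ NM) (mor_xz _ _ NM) (comm2_mor _ _ NM).
have -> : comm2 (Ng ga) (Ng gb) = (comm2 ga gb)^-1.
  by rewrite /Ng e2a e2b /comm2 !invgM !invgK !mulgA.
exists (Ng h), (- e)%R; rewrite xzVx; split=> //; case: e1 => ->; auto.
Qed.

Lemma wf_min (P : nat -> Prop) : (exists m, P m) ->
  exists m, P m /\ forall k, P k -> m <= k.
Proof.
move=> [m]; have [n] := ubnP m; elim: n m => // n IH m lt pm.
have [[k [pk lk]]|no] := pselect (exists k, P k /\ k < m).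
  by apply: (IH k) => //; lia.
exists m; split=> // k pk; rewrite leqNgt; apply/negP => lk; apply: no; by exists k.
Qed.

(** * The axis of a positive word in the Cayley tree *)

Section Axis.
Variable X : seq bool.
Hypothesis X0 : 0 < size X.

Definition axis (g : F) := exists k i, i <= size X /\ g = xz (pos X) k * pos (take i X).

Lemma axis_norm g : axis g -> exists k i, i < size X /\ g = xz (pos X) k * pos (take i X).
Proof.
move=> [k [i [le ->]]]; move: le; rewrite leq_eqVlt => /predU1P[->|lt]; last by exists k, i.
by exists (k + 1)%R, 0; rewrite take_size take0 pos_nil mulg1 xzS.
Qed.

Lemma pos_rot i : pos (rot i X) = pos X ^ pos (take i X).
Proof. by rewrite /rot pos_cat -{3}(cat_take_drop i X) pos_cat conjgE !mulgA mulVg mul1g. Qed.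

(* Geometrically: the two neighbours of a vertex on the axis of X in the Cayley tree. *)
Lemma axis_step g : axis g -> exists w : seq bool, [/\ 0 < size w, cyc w X,
  pos w = pos X ^ g,
  axis (g * pos [:: head false w]) & axis (g * (pos [:: last false w])^-1)].
Proof.
move=> /axis_norm[k [i [lt ->]]]; exists (rot i X); split.
- by rewrite size_rot.
- by exists (take i X), (drop i X); rewrite cat_take_drop.
- by rewrite pos_rot conjgM; congr (_ ^ _); rewrite conjgE (xz_commute k (commute_refl (pos X))) mulKg.
- exists k, i.+1; split=> //; rewrite -mulgA -pos_cat (take_nth false lt) -cats1.
  by rewrite /rot (drop_nth false lt).
case: i lt => [|i] lt.
  exists (k - 1)%R, (size X).-1; rewrite leq_pred; split=> //.
  rewrite take0 pos_nil mulg1 rot0 xzP -mulgA; congr (_ * _).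
  apply/eqP; rewrite eq_sym -(inj_eq (@mulgI _ (pos X))) mulVKg; apply/eqP.
  have -> : take (size X).-1 X = belast (head false X) (behead X).
    by case: (X) X0 => //= x s _; rewrite (lastI x s) -cats1 take_size_cat // size_belast.
  case: (X) X0 => //= x s _; rewrite {1}(lastI x s) -cats1 pos_cat mulgK //.
exists k, i; split; first exact: ltnW (ltnW lt).
rewrite -mulgA; congr (_ * _).
have -> : last false (rot i.+1 X) = nth false X i.
  by rewrite /rot last_cat (take_nth false (ltnW lt)) last_rcons.
by rewrite (take_nth false (ltnW lt)) -cats1 pos_cat mulgK.
Qed.

End Axis.

Definition edet (x y : F) : int := (ea x * eb y - eb x * ea y)%R.

(** Seen from the vertex q, X becomes a rotation c d of itself, and w becomes a power of that
    rotation times a segment of the axis or its inverse. The determinant condition passes to the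
    pair (c, d), to which [chr_basis] applies. *)
Lemma axis_meet l (p q w : F) :
  let X := papply l [:: false] in 0 < size X ->
  axis X p -> axis X q -> w * q = p -> `|edet (pos X) w|%N = 1%N -> gens (pos X) w.
Proof.
move=> X X0 /(axis_norm X0)[k1 [i1 [lt1 e1]]] /(axis_norm X0)[k2 [i2 [lt2 e2]]] ewq.
have -> : edet (pos X) w = edet (pos X ^ q) (w ^ q) by rewrite /edet !esumJ.
move=> dt; apply: (@gensJ _ _ q); move: dt.
have eR : pos X ^ q = pos (rot i2 X).
  by rewrite pos_rot e2 conjgM; congr (_ ^ _); rewrite conjgE (xz_commute k2 (commute_refl (pos X))) mulKg.
have ew : w ^ q = xz (pos (rot i2 X)) (k1 - k2)%R * ((pos (take i2 X))^-1 * pos (take i1 X)).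
  rewrite pos_rot xzJ conjgE ewq e1 e2 invgM -(xzN _ k2) conjgE !mulgA mulgK.
  by rewrite -[_ * xz _ _ * xz _ _]mulgA -xzD GRing.addrC.
rewrite eR ew; set K := (k1 - k2)%R.
have [le|lt] := leqP i2 i1.
  pose c := drop i2 (take i1 X); pose d := drop i1 X ++ take i2 X.
  have ec : take i1 X = take i2 X ++ c.
    by rewrite -{1}(cat_take_drop i2 (take i1 X)) take_takel.
  have er : rot i2 X = c ++ d.
    rewrite /d catA; congr (_ ++ _); rewrite /c -[in LHS](cat_take_drop i1 X) drop_cat.
    rewrite size_takel; last exact: ltnW.
    move: le; rewrite leq_eqVlt => /predU1P[e|->] //.
    rewrite e ltnn subnn drop0; have -> // : drop i1 (take i1 X) = [::].
    by apply: drop_oversize; rewrite size_take lt1.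
  rewrite er ec (pos_cat (take i2 X)) mulKg => dt.
  (* With X' = c d and w' = X'^K c, these two words express c and d through X' and w'. *)
  apply: (@gens_e2 _ _ (xz ga (-K)%R * gb) (gb^-1 * xz ga K * ga)).
  rewrite !e2M !(mor_xz _ _ (@e2M _ _)) e2V e2a e2b xzN mulKg.
  rewrite invgM mulgVK pos_cat mulKg.
  apply: (@chr_basis l); first by rewrite -er; exists (take i2 X), (drop i2 X); rewrite cat_take_drop.
  move: dt; rewrite /edet /det2 !esumM !esum_xz.
  have [-> ->] := esum_pos (c ++ d); have [-> ->] := esum_pos c.
  by rewrite !nab_simp => <-; rewrite -[LHS]abszN; congr absz; rewrite !PoszD; ring.
pose c := drop i1 (take i2 X); pose d := drop i2 X ++ take i1 X.
have le : i1 <= i2 by exact: ltnW.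
have ec : take i2 X = take i1 X ++ c.
  by rewrite -{1}(cat_take_drop i1 (take i2 X)) take_takel.
have er : rot i2 X = d ++ c by rewrite /rot ec catA.
rewrite er ec (pos_cat (take i1 X)) invgM mulgVK => dt.
apply: (@gens_e2 _ _ (gb^-1 * xz ga K) (ga * xz ga (-K)%R * gb)).
rewrite !e2M !(mor_xz _ _ (@e2M _ _)) e2V e2a e2b xzN invgM invgK mulgVK.
rewrite -!mulgA mulKg pos_cat mulgK.
apply: (@chr_basis l).
  apply: (@cyc_rot d c); rewrite -er; exists (take i2 X), (drop i2 X); by rewrite cat_take_drop.
move: dt; rewrite /edet /det2 !esumM !esum_xz !esumV.
have [-> ->] := esum_pos (d ++ c); have [-> ->] := esum_pos c.
by rewrite !nab_simp => <-; congr absz; rewrite !PoszD; ring.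
Qed.

(** Take a shortest bridge w0 from the axis to its translate by w. Going once along the axis,
    across, back along the translate and across again spells a cyclically reduced conjugate of
    [X, w] that contains two copies of X or its inverse. *)
Lemma axis_disjoint X (w z g : F) : 0 < size X ->
  (forall p q, axis X p -> axis X q -> w * q != p) ->
  comm2 (pos X) w = z ^ g -> (size X).*2 <= len z.
Proof.
move=> X0 dis ez.
have [m [[p [q [ap aq em]]] min]] : exists m, (exists p q, [/\ axis X p, axis X q & len (p^-1 * w * q) = m]) /\
    forall k, (exists p q, [/\ axis X p, axis X q & len (p^-1 * w * q) = k]) -> m <= k.
  apply: wf_min; exists (len (1^-1 * w * 1)), 1, 1.
  have a1 : axis X 1 by exists 0%R, 0; rewrite take0 pos_nil mulg1.
  by split.
set w0 := p^-1 * w * q in em.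
have w1 : w0 != 1.
  apply: contra (dis p q ap aq) => /eqP e; apply/eqP.
  have : p * w0 = w * q by rewrite /w0 -!mulgA mulVKg.
  by rewrite e mulg1.
have [wp [sp cp ep ap1 ap2]] := axis_step X0 ap.
have [wq [sq cq eq aq1 aq2]] := axis_step X0 aq.
pose L (c : bool) : L2 := ((if c then ord_max else ord0), false).
have Lp c : pos [:: c] = lett (L c) by rewrite pos1; case: c.
have decl (x : F) l : ohead (word x) = Some l -> len ((lett l)^-1 * x) < len x.
  move=> e; case ex : (word x) e => [|l' s] //= [<-].
  by rewrite -{1}[x]fwK ex fw_cons mulKg /len ex ltnS; apply: len_fw.
have hp p1 q1 : axis X p1 -> axis X q1 -> len w0 <= len (p1^-1 * w * q1).
  by move=> a1 a2; rewrite em; apply: min; exists p1, q1.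
(* By minimality the bridge does not start with a step along the axis; likewise at its other end. *)
have nostepL (l : L2) : axis X (p * lett l) -> ohead (word w0) != Some l.
  move=> a; apply/eqP => /decl; rewrite ltnNge; apply/negP; rewrite negbK.
  have -> : (lett l)^-1 * w0 = (p * lett l)^-1 * w * q by rewrite invgM !mulgA.
  exact: hp.
have nostepR (l : L2) : axis X (q * lett l) -> ohead (word w0^-1) != Some l.
  move=> a; apply/eqP => /decl; rewrite ltnNge; apply/negP; rewrite negbK.
  have -> : (lett l)^-1 * w0^-1 = (p^-1 * w * (q * lett l))^-1.
    by rewrite /w0 -invgM !mulgA.
  by rewrite !lenV; exact: hp.
rewrite Lp in ap1 aq1; rewrite Lp -lettV in ap2 aq2.
have n1 := nostepL _ ap1; have n2 := nostepL _ ap2.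
have n3 := nostepR _ aq1; have n4 := nostepR _ aq2.
have spX : size wp = size X by case: cp => u [v [-> ->]]; rewrite !size_cat addnC.
have sqX : size wq = size X by case: cq => u [v [-> ->]]; rewrite !size_cat addnC.
pose W := word (pos wp) ++ word w0 ++ word_inv (word (pos wq)) ++ word_inv (word w0).
have eW : fw W = z ^ (g * p).
  rewrite /W !fw_cat !fw_inv !fwK ep eq conjgM -ez /comm2 /w0 !conjgE !invgM !invgK !mulgA.
  by rewrite !(mulgK, mulgVK).
suff rW : reduced (W ++ W).
  have := conj_len rW eW; rewrite /W !size_cat !size_word_inv -!/(len _) !len_pos.
  by move: em; lia.
have red_join (s t : seq L2) : reduced s -> reduced t ->
    (forall l m, last l s = m -> 0 < size s -> ohead t != Some (letter_inv m)) -> reduced (s ++ t).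
  case/lastP: s => // s l rs rt h; case: t rt h => [|k t] rt h; first by rewrite cats0.
  rewrite reduced_rcons2 rs rt andbT /=.
  have := h l l; rewrite last_rcons size_rcons /= => /(_ erefl isT).
  by rewrite (inj_eq (@Some_inj _)).
have glue4 (s1 s2 s3 s4 : seq L2) : 0 < size s1 -> 0 < size s2 -> 0 < size s3 -> 0 < size s4 ->
    reduced (s1 ++ s2) -> reduced (s2 ++ s3) -> reduced (s3 ++ s4) -> reduced (s4 ++ s1) ->
    reduced ((s1 ++ s2 ++ s3 ++ s4) ++ (s1 ++ s2 ++ s3 ++ s4)).
  move=> z1 z2 z3 z4 r12 r23 r34 r41.
  rewrite -!catA; do 6 (apply: reduced_glue => //).
have zw : 0 < size (word w0) by rewrite -/(len w0) len_gt0.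
have zp : 0 < size (word (pos wp)) by rewrite -/(len _) len_pos.
have zq : 0 < size (word (pos wq)) by rewrite -/(len _) len_pos.
have hw c s l : head l (word (pos (c :: s))) = L c by rewrite word_pos.
have lastP' s c l : last l (word (pos (rcons s c))) = L c.
  by rewrite word_pos map_rcons last_rcons.
apply: glue4; rewrite ?size_word_inv //.
- apply: red_join; [exact: reduced_word | exact: reduced_word |].
  move=> l k <- _; move: n2; case/lastP: (wp) sp => // s c _.
  by rewrite last_rcons lastP'.
- rewrite -(invgK w0) wordV -word_inv_cat; apply: word_inv_reduced.
  apply: red_join; [exact: reduced_word | exact: reduced_word |].
  move=> l k <- _; move: n4; case/lastP: (wq) sq => // s c _.
  by rewrite last_rcons lastP'.
- rewrite -wordV -wordV; apply: red_join; [exact: reduced_word | exact: reduced_word |].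
  move=> l k <- _; move: n3; case: (wq) sq => // c s _; rewrite [head _ _]/=.
  by rewrite (wordV (pos _)) word_pos map_cons /word_inv map_cons rev_cons last_rcons letter_invK.
- apply: red_join; [exact: word_inv_reduced (reduced_word _) | exact: reduced_word |].
  move=> l k <- _; move: n1; case: (wp) sp => // c s _.
  rewrite [head _ _]/= word_pos map_cons; case ew : (word w0) zw => [|k0 t] // _.
  by rewrite /word_inv map_cons rev_cons last_rcons letter_invK eq_sym.
Qed.

Section Step1.
Variables (l : seq bool) (lam : F -> F) (L : nat) (z h : F).
Hypotheses (lamM : {morph lam : x y / x * y}) (lns : ~ (forall z, exists t, lam t = z)).
Let X := papply l [:: false].
Let Y := papply l [:: true].
Hypothesis lamX : lam (pos X) = pos X \/ lam (pos X) = (pos X)^-1.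
Hypothesis (lz : len z <= L.*2) (ez : comm2 (lam ga) (lam gb) = z ^ h).
Hypothesis ab_bound : forall i, (`|esum i (lam ga)| <= L)%N /\ (`|esum i (lam gb)| <= L)%N.

Lemma Xpos : 0 < size X.
Proof. by have := @chr_range l [::] X (cyc_refl X); rewrite -/X; lia. Qed.

(** Automorphisms preserve [a, b] up to conjugation and inversion, so [lam(X), lam(Y)] is as short
    up to conjugation as [lam(a), lam(b)]. Replacing lam(X) = X^-1 by X again costs only a
    conjugation and an inversion. *)
Lemma comm_XY : exists g e, (e = 1 \/ e = -1)%R /\ comm2 (pos X) (lam (pos Y)) = xz z e ^ g.
Proof.
have [g [e [e1 eq]]] := comm2_pmor l.
have eXY : comm2 (lam (pos X)) (lam (pos Y)) = xz z e ^ (h * lam g).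
  rewrite -(comm2_mor _ _ lamM) !pos_papply !pos1 eq (morJ _ _ lamM) (mor_xz _ _ lamM).
  by rewrite (comm2_mor _ _ lamM) ez xzJ conjgM.
case: lamX => eX; first by exists (h * lam g), e; rewrite -{1}eX.
exists (h * lam g * (pos X)^-1), (- e)%R; split; first by case: e1 => ->; [right|left; rewrite GRing.opprK].
rewrite conjgM xzN conjVg -eXY eX /comm2 conjgE !invgM !invgK !mulgA.
by rewrite !(mulgK, mulgVK).
Qed.

(** If X were longer, lam would abelianise to +-1. Then the axis of X and its translate by lam(Y)
    either meet, making lam onto, or are disjoint, making X shorter than the commutator allows. *)
Lemma primitive_word_size : size X <= L.*2 + 2.
Proof.
have X0 := Xpos.
rewrite leqNgt; apply/negP => big.
have [eps [eps1 eX]] : exists eps : int, (eps = 1 \/ eps = -1)%R /\ lam (pos X) = xz (pos X) eps.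
  by case: lamX => ->; [exists 1%R | exists (-1)%R; rewrite (xzN _ 1)]; rewrite xz1; split; auto.
have [eaX ebX] := esum_pos X; have [eaY ebY] := esum_pos Y.
have sX := na_nb X.
have dt : `|det2 X Y|%N = 1%N by rewrite det2_papply.
rewrite /det2 in dt.
have e1 := esum_mor (ord0 : I2) (pos X) lamM; have eb2 := esum_mor (ord_max : I2) (pos X) lamM.
rewrite eX !esum_xz eaX ebX in e1 eb2.
(* The counts of a and b in X are coprime because X, Y has determinant +-1, so a relation between
   them is a multiple of (nb X, - na X), too large unless it vanishes. *)
have key (s t : int) : (s * (na X)%:Z + t * (nb X)%:Z = 0)%R -> (`|s| + `|t| <= L.*2 + 1)%N -> s = 0%R /\ t = 0%R.
  move=> st bd.
  have [k ek] : exists k : int, s = (k * (nb X)%:Z)%R /\ t = (- k * (na X)%:Z)%R.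
    move: dt st; move: (na X) (nb X) (na Y) (nb Y) => A B C D dt st.
    have [d1|d1] : (A%:Z * D%:Z - B%:Z * C%:Z = 1 \/ A%:Z * D%:Z - B%:Z * C%:Z = -1)%R by lia.
      by exists (- (s * C%:Z + t * D%:Z))%R; split; nia.
    by exists (s * C%:Z + t * D%:Z)%R; split; nia.
  have [k0|k0] : k = 0%R \/ (1 <= `|k|)%N by lia.
    by rewrite k0 in ek; lia.
  exfalso; case: ek => es et; move: bd; rewrite es et !abszM abszN.
  by move: sX big; move: (na X) (nb X) => A B; nia.
have [b1 b2] := ab_bound ord0; have [b3 b4] := ab_bound ord_max.
(* The rows of the abelianised lam minus eps annihilate the vector of X, and their entries sum to at
   most 2L + 1 in absolute value. *)
have [m11 m12] : (ea (lam ga) - eps = 0 /\ ea (lam gb) = 0)%R.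
  by apply: key; [move: e1; lia | move: b1 b2 eps1; lia].
have [m21 m22] : (eb (lam ga) = 0 /\ eb (lam gb) - eps = 0)%R.
  by apply: key; [move: eb2; lia | move: b3 b4 eps1; lia].
have [g [e [ee eg]]] := comm_XY.
have lze : len (xz z e) <= L.*2.
  by case: ee => ->; rewrite ?(xzN z 1) ?lenV xz1.
have [meet|nomeet] := pselect (exists p q, [/\ axis X p, axis X q & lam (pos Y) * q = p]).
  case: meet => p [q [ap aq epq]]; apply: lns.
  have : gens (pos X) (lam (pos Y)).
    apply: (axis_meet (l := l) X0 ap aq epq).
    rewrite -/X /edet eaX ebX !(esum_mor _ (pos Y) lamM) eaY ebY m12 m21.
    rewrite (GRing.subr0_eq m11) (GRing.subr0_eq m22).
    by move: dt; case: eps1 => ->; rewrite /=; lia.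
  move=> gXY zz; have [w ew] := gXY zz.
  (* lam sends X^eps to X and Y to lam(Y), which generate. *)
  exists (e2 (xz (pos X) eps) (pos Y) w); rewrite (e2_comp _ _ _ lamM).
  rewrite (mor_xz _ _ lamM) eX -xzM (_ : (eps * eps)%R = 1%R) ?xz1 //.
  by case: eps1 => ->.
have := axis_disjoint X0 _ eg; have dis p q : axis X p -> axis X q -> lam (pos Y) * q != p.
  by move=> ap aq; apply/eqP => epq; apply: nomeet; exists p, q.
by move=> /(_ dis); lia.
Qed.

End Step1.

(** * Length of the conjugator *)

Section Runs.
Variable T : eqType.
Implicit Types (s : seq T) (t : T).

(** The number of maximal blocks of equal letters, when [o] is the preceding letter. *)
Fixpoint runs_after (o : option T) s : nat :=
  if s is y :: s' then (o != Some y) + runs_after (Some y) s' else 0.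

Definition olast (o : option T) s : option T := last o (map Some s).

Lemma runs_after_rcons o s y :
  runs_after o (rcons s y) = runs_after o s + (olast o s != Some y).
Proof. by elim: s o => [|x s IH] o /=; rewrite ?IH ?addn0 ?addnA. Qed.

Fixpoint run_bound (C D n : nat) : nat :=
  if n is n'.+1 then let b := run_bound C D n' in b + (C + D * b) else 0.

Lemma run_bound_mono C D m n : m <= n -> run_bound C D m <= run_bound C D n.
Proof.
move=> /subnK <-; elim: (n - m) => //= d IH; rewrite ?addSn /=.
exact: leq_trans IH (leq_addr _ _).
Qed.

Lemma last_run s : s = [::] \/ exists u t f,
  [/\ s = u ++ nseq f.+1 t, olast None u != Some t & runs_after None s = (runs_after None u).+1].
Proof.
elim/last_ind: s => [|s y [->|[u [t [f [e ne er]]]]]]; first by left.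
  by right; exists [::], y, 0.
have lst : olast None s = Some t.
  rewrite e -addn1 nseqD catA /olast map_cat last_cat //.
have [ty|ty] := eqVneq t y.
  right; exists u, t, f.+1; split=> //.
    by rewrite e -cats1 -catA -ty -(addn1 f.+1) nseqD.
  by rewrite runs_after_rcons lst ty eqxx addn0 er.
have ne' : olast None s != Some y by rewrite lst (inj_eq (@Some_inj _)).
right; exists s, y, 0; rewrite cats1; split=> //.
by rewrite runs_after_rcons ne' addn1.
Qed.

(** If each block is bounded linearly in what stands before it, adding a block turns a bound b into
    at most b + (C + D b), which is the recursion of [run_bound]. *)
Lemma run_bound_size C D s :
  (forall u t f r, s = u ++ nseq f t ++ r -> olast None u != Some t -> f <= C + D * size u) ->
  size s <= run_bound C D (runs_after None s).
Proof.
have [n] := ubnP (size s); elim: n s => // n IH s lt h.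
case: (last_run s) => [->//|[u [t [f [e ne ->]]]]] /=.
have lu : size u <= run_bound C D (runs_after None u).
  apply: IH; first by move: lt; rewrite e size_cat size_nseq; lia.
  by move=> u' t' f' r e' ne'; apply: (h u' t' f' (r ++ nseq f.+1 t)); rewrite // e e' -!catA.
rewrite {1}e size_cat size_nseq; apply: leq_add => //.
apply: leq_trans (h u t f.+1 [::] _ ne) _; first by rewrite cats0.
by rewrite leq_add2l leq_mul2l lu orbT.
Qed.
End Runs.

(** * Counting the letters b and b^-1 *)

Definition isb (l : L2) : bool := l.1 == ord_max.

Definition blen (x : F) : nat := count isb (word x).

Lemma isb_inv l : isb (letter_inv l) = isb l. Proof. by []. Qed.

Lemma count_word_inv s : count isb (word_inv s) = count isb s.
Proof. by rewrite /word_inv count_rev count_map. Qed.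

Lemma blenV x : blen x^-1 = blen x.
Proof. by rewrite /blen wordV count_word_inv. Qed.

Lemma blenM x y : blen (x * y) <= blen x + blen y.
Proof.
have [s [p [t [e1 e2 e3]]]] := cancelP x y.
by rewrite /blen e1 e2 e3 !count_cat; lia.
Qed.

Lemma blen_len x : blen x <= len x. Proof. exact: count_size. Qed.

Lemma blen_ga_xz m : blen (xz ga m) = 0.
Proof. by rewrite /blen word_ga_xz count_nseq. Qed.

Lemma blen_aM m x : blen (xz ga m * x) = blen x.
Proof.
apply/eqP; rewrite eqn_leq; have := blenM (xz ga m) x.
rewrite blen_ga_xz => -> /=; rewrite -{1}[x](mulKg (xz ga m)).
by apply: leq_trans (blenM _ _) _; rewrite blenV blen_ga_xz.
Qed.

Lemma blen_Ma m x : blen (x * xz ga m) = blen x.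
Proof. by rewrite -blenV invgM -xzN blen_aM blenV. Qed.

Lemma blen_e2 p q x n : blen p = 0 -> blen q <= n -> blen (e2 p q x) <= n * blen x.
Proof.
move=> p0 qn; rewrite -[x in e2 _ _ x]fwK /blen -/(blen _); elim: (word x) => [|[i b] s IH].
  by rewrite fw_nil e21.
rewrite fw_cons e2M e2_lett; apply: leq_trans (blenM _ _) _.
rewrite [count _ _]/= mulnDr; apply: leq_add => //.
rewrite /ev /letter_eval /im2 /isb /=; case: (ord2P i) => -> /=; case: b; rewrite ?blenV; lia.
Qed.

Definition shear (j : int) : F -> F := e2 ga (gb * xz ga j).

Lemma shearK j x : shear (- j) (shear j x) = x.
Proof.
rewrite /shear (e2_comp _ _ _ (@e2M _ _)) e2M (mor_xz _ _ (@e2M _ _)) e2a e2b.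
by rewrite -mulgA -xzD GRing.addNr mulg1 e2_id.
Qed.

Lemma blen_shear j x : blen (shear j x) = blen x.
Proof.
have le i y : blen (shear i y) <= blen y.
  rewrite -[X in _ <= X]mul1n; apply: blen_e2; first exact: (blen_ga_xz 1).
  by rewrite blen_Ma.
by apply/eqP; rewrite eqn_leq le -{1}[x](shearK j) le.
Qed.

(** v begins and ends with b or b^-1, so that a power of a next to it never cancels. *)
Definition btied (v : F) : Prop :=
  exists l s, word v = l :: s /\ isb l /\ isb (last l s).

Lemma cn_eq0 (X : choiceType) (x y : freegroup X) : reduced (word x ++ word y) -> cn x y = 0.
Proof.
move=> r; have := len_cn x y; rewrite {1}/len wordM_red // size_cat -!/(len _); lia.
Qed.

Lemma reduced_join (X : choiceType) (s t : seq (letter X)) : reduced s -> reduced t ->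
  (forall l, 0 < size s -> 0 < size t -> head l t != letter_inv (last l s)) -> reduced (s ++ t).
Proof.
case/lastP: s => // s l rs rt h; case: t rt h => [|m t] rt h; first by rewrite cats0.
rewrite reduced_rcons2 rs rt andbT /=.
by have := h l; rewrite last_rcons size_rcons /=; apply.
Qed.

Lemma btied_inv v : btied v -> btied v^-1.
Proof.
move=> [l [s [e [h1 h2]]]]; rewrite /btied wordV e lastI /word_inv map_rcons rev_rcons.
eexists; eexists; split; first by [].
rewrite isb_inv; split=> //; case: s h1 {e h2} => [|m s] h1 //=.
by rewrite rev_cons last_rcons.
Qed.

Section TiedPair.
Variable v : F.
Hypothesis vb : btied v.
Let c := cn v v.
Notation y := (ev ga v).

Lemma v_neq1 : v != 1.
Proof. by case: vb => l [s [e _]]; rewrite -len_gt0 /len e. Qed.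

Lemma y_b b : btied (y (ord_max, b)).
Proof. by rewrite /ev /letter_eval /im2 /=; case: b => //; apply: btied_inv. Qed.

Lemma y_a b : y (ord0, b) = lett (ord0 : I2, b).
Proof. by rewrite /ev /letter_eval /im2 /= lett_gen. Qed.

Lemma len_y l : len (y l) = if isb l then len v else 1%N.
Proof. by rewrite len_ev; case: l => i b; case: (ord2P i) => ->. Qed.

(** In the pair (a, v) cancellation occurs only between two copies of v or of v^-1; this makes the
    pair Nielsen reduced. *)
Lemma cn_tied (l m : L2) : m != letter_inv l ->
  cn (y l) (y m) = if isb l && isb m then c else 0.
Proof.
case: l m => i b [j b'] ne; case: (ord2P i) ne => ->; case: (ord2P j) => -> ne /=.
- have eb' : b' = b by move: ne; rewrite /letter_inv xpair_eqE eqxx /=; case: b; case: b'.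
  by rewrite !y_a eb'; apply: cn_eq0; apply: reduced_join => // l _ _; exact: letter_invN.
- rewrite y_a; apply: cn_eq0; apply: reduced_join => //; first exact: reduced_word.
  case: (y_b b') => l [s [-> [h1 h2]]] k _ _ /=.
  by apply: contraTneq h1 => ->.
- rewrite y_a; apply: cn_eq0; apply: reduced_join => //; first exact: reduced_word.
  case: (y_b b) => l [s [-> [h1 h2]]] k _ _ /=.
  by apply: contraTneq h2 => e; rewrite -isb_inv -e.
have -> : b' = b by move: ne; rewrite /letter_inv xpair_eqE eqxx /=; case: b; case: b'.
by rewrite /ev /letter_eval /im2 /=; case: b {ne}; rewrite ?cnV.
Qed.

Lemma c_lt : c.*2 < len v. Proof. exact: cn_self v_neq1. Qed.

Lemma nred_tied : nred ga v.
Proof.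
rewrite /nred ga_neq1 v_neq1 /=; apply/andP; split.
  apply/forallP => l; apply/forallP => m; apply/implyP => ne.
  rewrite cn_tied // !len_y; have := c_lt; case: (isb l); case: (isb m); rewrite /=; lia.
apply/forallP => l; apply/forallP => m; apply/forallP => k; apply/implyP => ne; apply/implyP => ne'.
rewrite !cn_tied // len_y; have := c_lt; case: (isb l); case: (isb m); case: (isb k); rewrite /=; lia.
Qed.

End TiedPair.

Section Prefix.
Variables p q : F.
Hypothesis nr : nred p q.
Notation y := (ev p q).

(** What follows in the word can remove from the image of a prefix only what the next factor
    removes. *)
Lemma nred_prefix s l m t : reduced (rcons s l ++ m :: t) ->
  let x := e2 p q (fw (rcons s l)) in
  exists r, word (e2 p q (fw (rcons s l ++ m :: t))) =
    take (len x - cn (y l) (y m)) (word x) ++ r.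
Proof.
move=> r x; suff : exists r1 k0 t0 c0,
   [/\ m :: t = rcons t0 k0, word (e2 p q (fw (rcons s l ++ m :: t))) =
    take (len x - cn (y l) (y m)) (word x) ++ r1 ++ drop c0 (word (y k0)) &
    forall k, k != letter_inv k0 -> c0 + cn (y k0) (y k) < len (y k0)].
  by move=> [r1 [k0 [t0 [c0 [_ -> _]]]]]; eexists.
elim/last_ind: t r => [|t k IH] r.
  rewrite cats1 in r *; have [e _] := nred_step nr r.
  exists [::], m, [::], (cn (y l) (y m)); rewrite e; split=> // k km.
  by move: r; rewrite -cats1 reduced_rcons2 => /and3P[_ lm _]; apply: nred_N2.
have r' : reduced (rcons s l ++ m :: t) by move: r; rewrite -rcons_cons -rcons_cat -[rcons (_ ++ _) _]cats1 => /reduced_cat[].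
have [r1 [k0 [t0 [c0 [e0 e1 h]]]]] := IH r'.
have kk0 : k != letter_inv k0.
  move: r; rewrite -rcons_cons e0 -!rcons_cat -[rcons (rcons _ _) _]cats1.
  by rewrite reduced_rcons2 => /and3P[].
exists (r1 ++ take (len (y k0) - c0 - cn (y k0) (y k)) (drop c0 (word (y k0)))), k, (m :: t), (cn (y k0) (y k)).
split=> //; last by move=> k1 n1; apply: nred_N2.
rewrite -rcons_cons -rcons_cat e2_rcons.
have lt := h _ kk0.
rewrite catA in e1.
rewrite (small_cancel e1 lt) /len e1 !catA; congr (_ ++ _).
rewrite take_cat size_cat size_drop -/(len (y k0)).
rewrite ifF; last by apply/negbTE; rewrite -leqNgt; lia.
congr (_ ++ take _ _); lia.
Qed.

End Prefix.

(** If the b-lengths add up, no letter b^(+-1) cancels, so the surviving part of x keeps all of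
    them. *)
Lemma blen_prefix x y : blen (x * y) = blen x + blen y -> exists Q R,
  [/\ word (x * y) = Q ++ R, size Q <= len x & count isb Q = blen x].
Proof.
have [s [p [t [e1 e2 e3]]]] := cancelP x y.
rewrite /blen /len e1 e2 e3 !count_cat size_cat count_word_inv => e.
by exists s, t; split; [by [] | lia | lia].
Qed.

Lemma take_mul (X : choiceType) (x y : freegroup X) n : n + len y <= len x ->
  take n (word (x * y)) = take n (word x).
Proof.
have [s [p [t [e1 e2 e3 e4]]]] := cnP x y => le.
have [_ h] := cn_le x y; rewrite -e4 in h.
have lx : len x = size s + size p by rewrite /len e1 size_cat.
have ls : n <= size s by lia.
by rewrite e3 e1 !takel_cat.
Qed.

Lemma prefix_nth (T : Type) (x0 : T) (s P r Q r' : seq T) : s = P ++ r -> s = Q ++ r' ->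
  size Q <= size P -> exists r2, P = Q ++ r2.
Proof.
move=> e1 e2 le; exists (drop (size Q) P).
have <- : take (size Q) P = Q.
  by have := congr1 (take (size Q)) e2; rewrite e1 takel_cat // take_size_cat.
by rewrite size_takel // cat_take_drop.
Qed.

(** * The equation W k = a^m theta(W) *)

Section Core.
Variables (v : F) (j m : int) (W k : F) (N : nat).
Hypotheses (vb : btied v) (v2 : 1 < len v).
Hypothesis Wb : forall l s, word W = l :: s -> isb l.
Let theta := e2 ga (v * xz ga j).
Hypothesis ek : W * k = xz ga m * theta W.
Hypotheses (kN : len k <= N) (vN : len v <= N) (jN : (`|j| <= N)%N).

Let kW := len k < len W.

Lemma len_theta x : len (theta x) <= (2 * N + 1) * len x.
Proof.
apply: leq_trans (len_e2 _ _ _) _; rewrite leq_mul2r; apply/orP; right.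
have := lenM v (xz ga j); rewrite len_ga_xz len_lett; lia.
Qed.

(** Multiplication by k on the right cannot reach the first letter of a longer W. *)
Lemma first_W : kW -> exists l s, [/\ word W = l :: s, isb l & exists r, word (xz ga m * theta W) = l :: r].
Proof.
rewrite /kW => lt; case e : (word W) (@Wb) => [|l s] h.
  by move: lt; rewrite /len e.
exists l, s; split=> //; first exact: h.
have := @take_mul _ W k 1; rewrite add1n => /(_ lt).
rewrite ek e; case: (word (_ * _)) => [|x r] //; case=> ->; by exists r.
Qed.

(* If v v is reduced, no b-letter cancels in theta x, so theta multiplies b-lengths by blen v. *)
Section NoFold.
Hypothesis nf : exists l s, word v = l :: s /\ last l s = l.

Lemma cn_vv : cn v v = 0.
Proof.
case: nf => l [s [e el]]; apply: cn_eq0; rewrite {1}e.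
apply: reduced_join; rewrite -?e; try exact: reduced_word.
by move=> l0 _ _; rewrite e /= el letter_invN.
Qed.

Lemma blen_tied x : blen (e2 ga v x) = (blen v * blen x)%N.
Proof.
rewrite -[x in e2 _ _ x]fwK [blen x]/blen; have := reduced_word x.
elim/last_ind: (word x) => [|s l IH]; first by rewrite fw_nil e21 muln0.
have ey : blen (ev ga v l) = (blen v * isb l)%N.
  case: l => i b; case: (ord2P i) => ->; rewrite /isb /= ?muln0 ?muln1.
    by rewrite (y_a v).
  by rewrite /ev /letter_eval /im2 /=; case: b; rewrite ?blenV.
case/lastP: s IH => [|s k0] IH r; first by rewrite /= fw1 e2_lett ey addn0.
have [e _] := nred_step (nred_tied vb) r.
have ml : l != letter_inv k0 by move: r; rewrite -[rcons (rcons _ _) _]cats1 reduced_rcons2 => /and3P[].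
rewrite {1}/blen e cn_tied // cn_vv if_same subn0 take_size drop0 count_cat -/(blen _) -/(blen (ev _ _ _)).
rewrite IH ?ey -?mulnDr; last by move: r; rewrite -[rcons (rcons _ _) _]cats1 => /reduced_cat[].
by rewrite -(cats1 (rcons s k0)) count_cat /= addn0.
Qed.

Lemma blen_theta x : blen (theta x) = (blen v * blen x)%N.
Proof.
have -> : theta x = e2 ga v (shear j x).
  by rewrite /shear (e2_comp _ _ _ (@e2M ga v)) e2M (mor_xz _ _ (@e2M ga v)) e2a e2b.
by rewrite blen_tied blen_shear.
Qed.

Lemma blen_v2 : 1 < blen v.
Proof.
case: nf => l [s [e el]]; case: vb => l' [s' [e' [h1 h2]]].
move: e'; rewrite e => -[ell es]; subst l' s'.
rewrite /blen e /=; move: v2; rewrite /len e.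
case/lastP: s {e} el h2 => // s x; rewrite last_rcons => -> h2 _.
by rewrite -cats1 count_cat /= h1; lia.
Qed.

(** theta multiplies the b-length by at least 2, while passing from W to W k adds at most |k|. *)
Lemma blen_W : blen W <= len k.
Proof.
have := blenM W k; rewrite ek blen_aM blen_theta.
have := blen_len k; have := blen_v2; nia.
Qed.

Lemma runs_blen x : runs_after None (word x) <= 2 * blen x + 1.
Proof.
rewrite /blen; have := reduced_word x.
suff H s l : reduced (rcons s l) ->
    runs_after None (rcons s l) + isb l <= 2 * count isb (rcons s l) + 1.
  by case/lastP: (word x) => // s l /H; lia.
elim/last_ind: s l => [|s h IH] l r; first by rewrite /= addn0; case: (isb l).
have := r; rewrite -[rcons (rcons _ _) _]cats1 reduced_rcons2 => /and3P[r1 lh _].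
have ol : olast None (rcons s h) = Some h by rewrite /olast map_rcons last_rcons.
have := IH _ r1; rewrite !(cats1 (rcons s h)) (runs_after_rcons _ (rcons s h)) ol -(cats1 (rcons s h)) count_cat /= addn0.
rewrite (inj_eq (@Some_inj _)).
have [->|hl] := eqVneq h l; first by rewrite /= addn0; case: (isb l); lia.
have -> : isb l = ~~ isb h.
  move: lh hl; rewrite /isb /letter_inv; case: (h) => a b; case: (l) => a' b'.
  by case: (ord2P a) => ->; case: (ord2P a') => ->; case: b; case: b'.
by case: (isb h); rewrite /=; lia.
Qed.

(** If |m| were large, theta(W) would start with a long power of a, since a^m theta(W) starts with
    b^(+-1). But theta(W) keeps the letters b^(+-1) of the image of the first letter of W within its
    first 2N letters. *)
Lemma m_bound : kW -> (`|m| <= 2 * N)%N.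
Proof.
move=> lt; have [l [s [eW lb [r eZ]]]] := first_W lt.
have [m0|m0] := posnP `|m|%N; first by rewrite m0.
have eT : word (theta W) = word (xz ga (-m)%R) ++ l :: r.
  have -> : theta W = xz ga (-m)%R * (xz ga m * theta W) by rewrite mulgA -xzD GRing.addNr mul1g.
  rewrite wordM_red eZ //; apply: reduced_join; [exact: reduced_word | by rewrite -eZ; exact: reduced_word |].
  have ln (x t : L2) n : last x (nseq n.+1 t) = t by elim: n x => //= n IH x; exact: IH.
  move=> l0 _ _; rewrite word_ga_xz abszN -(prednK m0) ln /=.
  by apply: contraTneq lb => ->.
have eW2 : W = lett l * fw s by rewrite -fw_cons -eW fwK.
have add : blen (theta (lett l) * theta (fw s)) = blen (theta (lett l)) + blen (theta (fw s)).
  rewrite -[theta (lett l) * _](@e2M ga (v * xz ga j)) -/theta -eW2 !blen_theta -mulnDr; congr (_ * _)%N.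
  have rs : reduced s by have := reduced_word W; rewrite eW => /path_sorted.
  by rewrite /blen eW word_fw //= addn0.
have [Q [R [eQ sQ cQ]]] := blen_prefix add.
rewrite -[theta (lett l) * _](@e2M ga (v * xz ga j)) -/theta -eW2 in eQ.
rewrite leqNgt; apply/negP => big.
have [|r2 e2'] := prefix_nth l eT eQ.
  rewrite -/(len _) len_ga_xz abszN; apply: leq_trans sQ _.
  rewrite /theta e2_lett len_ev; have := lenM v (xz ga j); rewrite len_ga_xz.
  by case: l lb {eW eZ eT eW2 add cQ eQ} => i b; rewrite /isb /= => /eqP ->; rewrite -[ord_max == ord0]/false /= => h; lia.
have : count isb (word (xz ga (-m)%R)) = 0 by rewrite word_ga_xz count_nseq.
rewrite e2' count_cat cQ blen_theta /blen /= lb; have := blen_v2; rewrite /blen; lia.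
Qed.

(** The number of runs is bounded through the b-length. A long run of a after u is copied into W k;
    but a^m theta(u) holds more letters b^(+-1) than u, and they all survive in a prefix of length
    at most |m| + (2N + 1)|u|. *)
Lemma core_nofold : len W <= run_bound (3 * N + 2) (2 * N + 1) (2 * N + 1) + N.
Proof.
have [le|lt] := leqP (len W) (len k); first by lia.
have mb := m_bound lt; have bW := blen_W.
apply: leq_trans (leq_addr N _).
apply: leq_trans (run_bound_mono _ _ (_ : runs_after None (word W) <= _)); last first.
  by apply: leq_trans (runs_blen _) _; lia.
apply: run_bound_size => u t f R eW ne.
have [tb|ta] := boolP (isb t).
  have : f <= blen W by rewrite /blen eW !count_cat count_nseq tb; lia.
  lia.
have [f0|f0] := leqP f (len k); first by lia.
have ub : 0 < count isb u.
  case: u eW ne => [|x u] eW _; last by have /= -> := Wb eW.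
  by move: (@Wb t (nseq f.-1 t ++ R)); rewrite eW (negbTE ta) -{1}(prednK (leq_ltn_trans (leq0n _) f0)) => /(_ erefl).
have ru : reduced u by have := reduced_word W; rewrite eW => /reduced_cat[].
have rr : reduced (nseq f t ++ R) by have := reduced_word W; rewrite eW => /reduced_cat[].
have eW2 : W = fw u * fw (nseq f t ++ R) by rewrite -fw_cat -eW fwK.
have add : blen (xz ga m * theta (fw u) * theta (fw (nseq f t ++ R))) =
    blen (xz ga m * theta (fw u)) + blen (theta (fw (nseq f t ++ R))).
  rewrite -mulgA -[theta (fw u) * _](@e2M ga (v * xz ga j)) -/theta -eW2.
  rewrite !blen_aM !blen_theta -mulnDr; congr (_ * _)%N.
  by rewrite /blen eW !word_fw // count_cat.
have [Q [R' [eQ sQ cQ]]] := blen_prefix add.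
rewrite -mulgA -[theta (fw u) * _](@e2M ga (v * xz ga j)) -/theta -eW2 in eQ.
have lW : len W = size u + (f + size R) by rewrite /len eW !size_cat size_nseq.
have eP : word (xz ga m * theta W) = (u ++ nseq (f - len k) t) ++
     drop (size u + (f - len k)) (word (xz ga m * theta W)).
  rewrite -{1}(cat_take_drop (size u + (f - len k)) (word _)); congr (_ ++ _).
  rewrite -ek take_mul; last by rewrite lW; lia.
  rewrite eW take_cat ltnNge leq_addr /= addKn; congr (_ ++ _).
  by rewrite takel_cat ?size_nseq ?leq_subr // take_nseq // leq_subr.
(* If Q fits inside u followed by the run, it has at most the b-letters of u, which is too few. *)
have [sPQ|sPQ] := leqP (size Q) (size (u ++ nseq (f - len k) t)).
  have [r2 e2'] := prefix_nth t eP eQ sPQ.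
  have : count isb (u ++ nseq (f - len k) t) = count isb u.
    by rewrite count_cat count_nseq (negbTE ta) addn0.
  rewrite e2' count_cat cQ blen_aM blen_theta /blen word_fw //.
  by have := blen_v2; rewrite /blen; nia.
move: sPQ; rewrite size_cat size_nseq => sPQ.
have := lenM (xz ga m) (theta (fw u)); rewrite len_ga_xz.
have := len_theta (fw u); rewrite {2}/len word_fw //; move: sPQ sQ kN mb f0; set d := ((2 * N + 1) * size u)%N; set A := len (_ * _); set B := len (theta (fw u)); move: (len k) (size Q) (size u) A B d `|m|%N => *; lia.
Qed.

End NoFold.

Section Fold.
Hypothesis j0 : j = 0%R.
Hypothesis fd : exists l s, word v = l :: s /\ last l s = letter_inv l.
Notation y := (ev ga v).
Let c := cn v v.

Lemma thetaE x : theta x = e2 ga v x.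
Proof. by rewrite /theta j0 xz0 mulg1. Qed.

Lemma c_gt0 : 0 < c.
Proof.
case: fd => l [s [e el]]; apply/cn_geP; split; try by rewrite (ltnW v2).
have -> : word v^-1 = l :: word_inv (belast l s).
  by rewrite wordV e lastI /word_inv map_rcons rev_rcons el letter_invK.
by rewrite e /= !take0.
Qed.

(** The first factor is a copy of v or v^-1, and the next one cancels less than half of it. *)
Lemma head_theta x l s : word x = l :: s -> isb l ->
  exists l' s', word (e2 ga v x) = l' :: s' /\ isb l'.
Proof.
move=> e lb; rewrite -[x]fwK e.
have [l' [s' [ey [hb _]]]] : btied (y l).
  by case: l lb {e} => i b /eqP /= ->; exact: y_b.
case: s e => [|m0 s] e; first by rewrite fw1 e2_lett ey; exists l', s'.
have r : reduced (rcons [::] l ++ m0 :: s) by have := reduced_word x; rewrite e.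
have [t' /= ->] := nred_prefix (nred_tied vb) r.
rewrite fw1 e2_lett ey.
have : cn (y l) (y m0) < len (y l).
  have ml : m0 != letter_inv l by move: r; rewrite reduced_rcons2 => /and3P[].
  rewrite (cn_tied vb ml) len_y // lb; have := c_lt vb; rewrite -/c; case: ifP; lia.
rewrite -subn_gt0; case: (_ - _) => // n _ /=.
by exists l', (take n s' ++ t').
Qed.

(** As 2c < |v| and c > 0, starting a run of b^(+-1) adds at least three letters: one for the
    letter, one for the run, and one saved in the term [isb l] to pay for the next run of a.
    Continuing a run adds at least one letter. *)
Lemma len_runs s l : reduced (rcons s l) ->
  (size s).+1 + runs_after None (rcons s l) + isb l <= len (e2 ga v (fw (rcons s l))) + 1.
Proof.
have cv := c_lt vb; rewrite -/c in cv; have c0 := c_gt0.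
elim/last_ind: s l => [|s h IH] l r.
  rewrite /= fw1 e2_lett len_y //; case: (isb l); lia.
have := r; rewrite -{1}[rcons (rcons s h) l]cats1 reduced_rcons2 => /and3P[r1 lh _].
have := IH _ r1; have := nred_len_step (nred_tied vb) r; rewrite (cn_tied vb lh) len_y // size_rcons -/c.
have ol : olast None (rcons s h) = Some h by rewrite /olast map_rcons last_rcons.
rewrite (runs_after_rcons _ (rcons s h)) ol (inj_eq (@Some_inj _)).
set A := len _; set B := len _.
have [e|hl] := eqVneq h l; first by rewrite /= -e; case: (isb h) => /=; lia.
have -> : isb l = ~~ isb h.
  move: lh hl; rewrite /isb /letter_inv; case: (h) => a b; case: (l) => a' b'.
  by case: (ord2P a) => ->; case: (ord2P a') => ->; case: b; case: b'.
by case: (isb h); rewrite /=; lia.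
Qed.

(** theta(W) begins with b^(+-1), so a^m theta(W) is reduced as written; its first letter is that of
    W only if m = 0. *)
Lemma m_eq0 : kW -> m = 0%R.
Proof.
move=> lt; have [l [s [eW lb [r eZ]]]] := first_W lt.
have [l' [s' [eT lb']]] := head_theta eW lb.
have [/eqP|m0] := posnP `|m|%N; first by rewrite absz_eq0 => /eqP.
move: eZ; rewrite wordM_red thetaE eT word_ga_xz -(prednK m0).
  by case=> el; move: lb; rewrite -el.
apply: reduced_join.
- by have := reduced_word (xz ga m); rewrite word_ga_xz -(prednK m0).
- by have := reduced_word (e2 ga v W); rewrite eT.
move=> l0 _ _ /=; apply: contraTneq lb' => ->.
have ln (x t : L2) n : last x (nseq n t) \in [:: x; t].
  by elim: n x => [|n IH] x /=; rewrite !inE ?eqxx //; have := IH t; rewrite !inE orbb => ->; rewrite orbT.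
by have := ln (ord0 : I2, sgnb m) (ord0 : I2, sgnb m) `|m|.-1%N; rewrite !inE orbb => /eqP ->.
Qed.

Lemma runs_W : kW -> runs_after None (word W) <= len k + 1.
Proof.
move=> lt; have := ek; rewrite (m_eq0 lt) xz0 mul1g thetaE => e.
have key w : reduced w -> size w + runs_after None w <= len (e2 ga v (fw w)) + 1.
  by case/lastP: w => // w l /len_runs; rewrite size_rcons; lia.
have := key _ (reduced_word W); rewrite fwK -e.
by have := lenM W k; rewrite /len; lia.
Qed.

(** Now W k = theta(W). A long run after u forces theta(u), or theta(u) with the uncancelled part of
    one more factor, to be longer than u followed by most of the run; this bounds the run linearly
    in |u|. *)
Lemma core_fold : len W <= run_bound (3 * N + 2) (2 * N + 1) (2 * N + 1) + N.
Proof.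
have [le|lt] := leqP (len W) (len k); first by lia.
have m0 := m_eq0 lt; have rW := runs_W lt.
have cv := c_lt vb; rewrite -/c in cv; have c0 := c_gt0.
have eT : W * k = e2 ga v W by rewrite ek m0 xz0 mul1g thetaE.
apply: leq_trans (leq_addr N _).
apply: leq_trans (run_bound_mono _ _ (_ : runs_after None (word W) <= _)); last by lia.
apply: run_bound_size => u t f R eW ne.
have [f0|f0] := leqP f (len k); first by lia.
have [f1|f1] := leqP f 1; first by lia.
have lW : len W = size u + (f + size R) by rewrite /len eW !size_cat size_nseq.
have eP : word (e2 ga v W) = (u ++ nseq (f - len k) t) ++
     drop (size u + (f - len k)) (word (e2 ga v W)).
  rewrite -{1}(cat_take_drop (size u + (f - len k)) (word _)); congr (_ ++ _).
  rewrite -eT take_mul; last by rewrite lW; lia.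
  rewrite eW take_cat ltnNge leq_addr /= addKn; congr (_ ++ _).
  by rewrite takel_cat ?size_nseq ?leq_subr // take_nseq // leq_subr.
have ru : reduced u by have := reduced_word W; rewrite eW => /reduced_cat[].
have lu : len (e2 ga v (fw u)) <= (2 * N + 1) * size u.
  by rewrite -thetaE; have := len_theta (fw u); rewrite {2}/len word_fw.
have [f2 ef] : exists f2, f = f2.+2 by exists f.-2; lia.
have hu h u0 : u = rcons u0 h -> t != letter_inv h /\ isb t = ~~ isb h.
  move=> eu; have := reduced_word W; rewrite eW eu ef /= reduced_rcons2 => /and3P[_ th _].
  split=> //; move: ne; rewrite eu /olast map_rcons last_rcons (inj_eq (@Some_inj _)).
  move: th; rewrite /isb /letter_inv; case: (h) => a b; case: (t) => a' b'.
  by case: (ord2P a) => ->; case: (ord2P a') => ->; case: b; case: b'.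
(* For a run of a, theta(u) is longer than u and survives whole, so if it fitted it would end inside
   the run; but it ends with b^(+-1). *)
have [tb|ta] := boolP (isb t); last first.
  case/lastP: u eW ne lu lW eP ru hu => [|u0 h] eW ne lu lW eP ru hu.
    by have := @Wb t (nseq f2.+1 t ++ R); rewrite eW ef (negbTE ta) => /(_ erefl).
  have [th bt] := hu _ _ erefl.
  have hb : isb h by rewrite (negbTE ta) in bt; rewrite -[isb h]negbK -bt.
  have r : reduced (rcons u0 h ++ t :: (nseq f2.+1 t ++ R)) by have := reduced_word W; rewrite eW ef.
  have [r' /=] := nred_prefix (nred_tied vb) r.
  have -> : rcons u0 h ++ t :: t :: (nseq f2 t ++ R) = word W by rewrite eW ef.
  rewrite fwK (cn_tied vb th) hb (negbTE ta) subn0 take_size => eQ.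
  have [sPQ|sPQ] := leqP (size (word (e2 ga v (fw (rcons u0 h))))) (size (rcons u0 h ++ nseq (f - len k) t)).
    have [r2 e2'] := prefix_nth t eP eQ sPQ.
    have lA : size (rcons u0 h) < size (word (e2 ga v (fw (rcons u0 h)))).
      have := len_runs ru; rewrite hb [size (rcons u0 h)]size_rcons /len.
      set ra := runs_after _ _; have : 0 < ra by rewrite /ra; case: (u0).
      by move=> r0; rewrite leq_add2r; apply: leq_trans; rewrite -addn1 leq_add2l.
    have [z [s' [ez zb]]] : exists z s', word (e2 ga v (fw (rcons u0 h)))^-1 = z :: s' /\ isb z.
      rewrite -(morV (@e2M _ _)) -fw_inv /word_inv map_rcons rev_rcons.
      set w := letter_inv h :: _.
      have ew : word (fw w) = w by rewrite word_fw // /w -rev_rcons -map_rcons; exact: word_inv_reduced.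
      apply: (head_theta ew hb).
    have ez2 : word (e2 ga v (fw (rcons u0 h))) = rcons (word_inv s') (letter_inv z).
      by rewrite -[LHS]word_invK -wordV ez /word_inv map_cons rev_cons.
    have := congr1 (drop (size (rcons u0 h))) e2'; rewrite drop_size_cat // drop_cat lA ez2.
    rewrite drop_rcons; last by move: lA; rewrite ez2 [size (rcons (word_inv _) _)]size_rcons.
    rewrite -cats1 -catA => /(congr1 (all (pred1 t))).
    rewrite all_pred1_nseq all_cat /= => /esym /andP[_ /andP[/eqP zt _]].
    by move: ta; rewrite -zt isb_inv zb.
  move: sPQ; rewrite size_cat size_nseq; move: lu; rewrite /len.
  by set d := ((2 * N + 1) * _)%N; move: kN; rewrite /len; lia.
have ltt : t != letter_inv t by exact: letter_invN.
have ctt : cn (y t) (y t) = c by rewrite (cn_tied vb ltt) tb.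
have lyt : len (y t) = len v by rewrite len_y // tb.
have r : reduced (rcons u t ++ t :: (nseq f2 t ++ R)) by have := reduced_word W; rewrite eW ef /= -cat_rcons.
have rut : reduced (rcons u t) by have [] := reduced_cat r.
have [r' /=] := nred_prefix (nred_tied vb) r.
have -> : rcons u t ++ t :: (nseq f2 t ++ R) = word W by rewrite eW ef cat_rcons.
have -> : e2 ga v (fw (rcons u t)) = e2 ga v (fw u) * y t by rewrite e2_rcons.
have eA : word (e2 ga v (fw u) * y t) = word (e2 ga v (fw u)) ++ word (y t).
  case/lastP: u {eW ne lu lW eP r ru} hu rut => [|u0 h] hu rut.
    by rewrite fw_nil e21 mul1g.
  have [th bt] := hu _ _ erefl.
  have [] := nred_step (nred_tied vb) rut; rewrite e2_rcons => -> _.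
  have hb : isb h = false by rewrite tb in bt; rewrite -[isb h]negbK -bt.
  by rewrite (cn_tied vb th) hb subn0 take_size drop0.
rewrite fwK ctt {1}/len eA size_cat -!/(len _) lyt -addnBA; last by lia.
rewrite take_cat ltnNge leq_addr /= addKn => eQ.
have lB : size u <= len (e2 ga v (fw u)) by apply: nred_len ru; exact: nred_tied.
have [sPQ|sPQ] := leqP (size (word (e2 ga v (fw u)) ++ take (len v - c) (word (y t)))) (size (u ++ nseq (f - len k) t)).
  have [r2 e2'] := prefix_nth t eP eQ sPQ.
  (* For a run of b^(+-1) =: t, the surviving part of the image of t would consist of letters t
     only. Its beginning is inverse to its cancelled end, so the image would contain t t^-1. *)
  have eT2 : take (len v - c) (word (y t)) = nseq (len v - c) t.
    have := congr1 (drop (size u)) e2'; rewrite drop_size_cat // -catA drop_cat.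
    have allT w1 w2 : nseq (f - len k) t = w1 ++ take (len v - c) (word (y t)) ++ w2 -> 
        take (len v - c) (word (y t)) = nseq (len v - c) t.
      move=> /(congr1 (all (pred1 t))); rewrite all_pred1_nseq !all_cat => /esym /and3P[_ /all_pred1P + _].
      by rewrite size_takel // -/(len _) lyt leq_subr.
    case: ifP => lt'; first exact: allT.
    have -> : size u - size (word (e2 ga v (fw u))) = 0 by move: lB; rewrite /len; lia.
    by rewrite drop0; exact: (@allT [::]).
  have [s1 [p [t1 [e1 e2 _ sp]]]] := cnP (y t) (y t).
  rewrite ctt in sp.
  have es : s1 = nseq (len v - c) t.
    have ss : size s1 = len v - c by move: lyt; rewrite /len e1 size_cat sp; lia.
    by rewrite -eT2 e1 take_size_cat.
  have ep : word_inv p = nseq c t.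
    have <- : take c (word (y t)) = word_inv p by rewrite e2 take_size_cat // size_word_inv.
    rewrite -(@take_nseq _ c (len v - c)); last by lia.
    by rewrite -eT2 take_takel //; lia.
  have := reduced_word (y t); rewrite e1 es -[p]word_invK ep.
  have [n1 ->] : exists n1, len v - c = n1 + 1 by exists (len v - c).-1; lia.
  have [n2 ->] : exists n2, c = n2 + 1 by exists c.-1; lia.
  rewrite !nseqD !cats1 /word_inv map_rcons rev_rcons reduced_rcons2 eqxx andbF //.
move: sPQ; rewrite !size_cat size_nseq size_takel; last by rewrite -/(len _) lyt leq_subr.
move: lu; rewrite /len; set d := ((2 * N + 1) * _)%N; move: kN vN; rewrite /len; lia.
Qed.

End Fold.
End Core.

Definition afree (y : F) := forall i s, word y = i :: s -> isb i.

Lemma strip_afree y : exists k y1, y = xz ga k * y1 /\ afree y1.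
Proof.
have [k [y1 [e h]]] := strip_a y; exists k, y1; split=> // -[i b] s /h /=.
by rewrite /isb /=; case: (ord2P i) => ->.
Qed.

Lemma last_nseq_mem (x t : L2) n : 0 < n -> last x (nseq n t) = t.
Proof. by case: n => // n _; elim: n x => //= n IH x; exact: IH. Qed.

Lemma reduced_xz_afree k y : afree y -> reduced (word (xz ga k) ++ word y).
Proof.
move=> h; apply: reduced_join; try exact: reduced_word.
move=> l; rewrite word_ga_xz size_nseq => k0 s0; rewrite last_nseq_mem //.
by case e : (word y) s0 => [|m s] // _; have := h _ _ e; apply: contraTneq => /= ->.
Qed.

(** Remove the powers of a at both ends; something is left because V is not itself such a power. *)
Lemma strip_ends V : (forall k, V != xz ga k) ->
  exists i1 i2 v, btied v /\ V = xz ga i1 * (v * xz ga i2).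
Proof.
move=> h; have [i1 [y1 [e1 h1]]] := strip_afree V.
have [e [y2 [e2 h2]]] := strip_afree y1^-1.
have ey1 : y1 = y2^-1 * xz ga (- e)%R by rewrite xzN -invgM -e2 invgK.
exists i1, (- e)%R, y2^-1; rewrite -ey1; split=> //.
case ew : (word y2) => [|l s].
  have y1a : y2 = 1 by rewrite -[y2]fwK ew fw_nil.
  by case/eqP: (h (i1 - e)%R); rewrite e1 ey1 y1a invg1 mul1g xzD.
have ew1 : word y1 = word y2^-1 ++ word (xz ga (- e)).
  rewrite -[LHS]word_invK -wordV e2 wordM_red; last exact: reduced_xz_afree.
  by rewrite word_inv_cat -!wordV -xzN.
have lb := h2 _ _ ew.
rewrite /btied wordV ew /word_inv map_cons rev_cons.
case er : (rcons _ _) => [|l' s']; first by have := congr1 size er; rewrite size_rcons.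
exists l', s'; split=> //; split.
  by apply: (h1 l' (s' ++ word (xz ga (- e)))); rewrite ew1 wordV ew /word_inv map_cons rev_cons er.
by have := congr1 (last l) er; rewrite last_rcons /= => <-; rewrite isb_inv.
Qed.

Lemma afree_tied v : btied v -> afree v.
Proof. by case=> l [s [e [h _]]] l' s'; rewrite e => -[<- _]. Qed.

Lemma len_tied v i j : btied v -> len (xz ga i * (v * xz ga j)) = (`|i| + (len v + `|j|))%N.
Proof.
move=> vb.
have w1 : word (v * xz ga j) = word v ++ word (xz ga j).
  have := reduced_xz_afree (- j) (afree_tied (btied_inv vb)).
  move/word_inv_reduced; rewrite word_inv_cat -!wordV -xzN GRing.opprK invgK => r.
  by rewrite wordM_red.
rewrite /len wordM_red; last first.
  apply: reduced_xz_afree => l s; rewrite w1; case: vb => l' [s' [-> [h _]]].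
  by case=> <-.
by rewrite w1 !size_cat -!/(len _) !len_ga_xz.
Qed.

Lemma len_aJ y : afree y -> len (ga ^ y) = (len y).*2.+1.
Proof.
move=> h.
have w1 : word (ga * y) = (ord0 : I2, false) :: word y.
  by rewrite wordM_red //; exact: (reduced_xz_afree 1).
rewrite conjgE /len wordM_red w1; last first.
  apply: reduced_join; try exact: reduced_word.
    by rewrite -w1; exact: reduced_word.
  move=> l; rewrite wordV size_word_inv /word_inv; case e : (word y) => [|m s] // _ _.
  rewrite map_cons rev_cons last_rcons letter_invK.
  by have := h _ _ e; apply: contraTneq => /= <-.
by rewrite size_cat /= -[size (word y^-1)]/(len _) lenV /len; lia.
Qed.

Lemma len_shear j x : (len (shear j x) <= (2 + `|j|) * len x)%N.
Proof.
apply: leq_trans (len_e2 _ _ _) _; rewrite leq_mul2r; apply/orP; right.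
by have := lenM gb (xz ga j); rewrite len_ga_xz; rewrite -[len ga]/1%N -[len gb]/1%N; lia.
Qed.

(** Conjugating psi by W makes it fix a, and a further conjugation by a power of a moves all of the
    a-power next to v to the right. The total conjugator k satisfies the equation and is short
    because psi(a) and psi(b) are. *)
Lemma axis_core (psi : F -> F) W l : {morph psi : x y / x * y} -> injective psi ->
  ~ (forall z, exists t, psi t = z) -> psi (ga ^ W) = ga ^ W ->
  len (psi ga) <= l -> len (psi gb) <= l ->
  exists v j m k, [/\ btied v, 1 < len v, W * k = xz ga m * e2 ga (v * xz ga j) W,
    (len k <= 3 * l)%N & (len v <= 2 * l)%N /\ (`|j| <= 2 * l)%N].
Proof.
move=> pM pI nsurj fixW la lb.
pose th0 z := (psi (z ^ W)) ^ W^-1.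
have th0M : {morph th0 : x y / x * y} by move=> x y; rewrite /th0 conjMg pM conjMg.
have th0a : th0 ga = ga by rewrite /th0 fixW conjgK.
have th0E x : th0 x = psi x ^ (psi W * W^-1) by rewrite /th0 (morJ _ _ pM) conjgM.
have Vna k : th0 gb != xz ga k.
  apply/eqP => e.
  have : ga * gb = gb * ga.
    by apply: pI; apply: (@conjg_inj _ (psi W * W^-1)); rewrite -!th0E !th0M th0a e (xzC ga 1 k).
  by move/(congr1 (@word _)).
have [i1 [i2 [v [vb eV]]]] := strip_ends Vna.
pose j : int := (i2 + i1)%R; pose k : F := psi W * W^-1 * xz ga i1.
pose th := e2 ga (v * xz ga j).
have thE x : th x = th0 x ^ xz ga i1.
  symmetry; apply: (@e2_ext (fun x => th0 x ^ xz ga i1)).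
  - by move=> x1 x2; rewrite th0M conjMg.
  - by rewrite th0a conjgE (xzC ga 1 i1) mulKg.
  by rewrite eV conjgE !mulgA mulVg mul1g -mulgA -xzD.
have psiE x : psi x = th x ^ k^-1.
  by rewrite thE th0E -!conjgM ?mulgA -/k mulgV conjg1.
have [e [y [ek yf]]] := strip_afree k^-1.
have ga_e : ga ^ xz ga e = ga by rewrite conjgE (xzC ga 1 e) mulKg.
(* With k^-1 = a^e y, psi(a) is the reduced word y^-1 a y, so its length gives |y|. *)
have ly : (len y).*2.+1 <= l.
  by rewrite -len_aJ //; move: la; rewrite psiE ek conjgM /th e2a ga_e.
(* Conjugating psi(b) back by y leaves a^(-e) v a^(j + e), which is reduced as written. *)
have lvj : (`|e| + (len v + `|(j + e)%R|) <= 2 * l)%N.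
  rewrite -abszN -len_tied //.
  have -> : xz ga (- e) * (v * xz ga (j + e)) = psi gb ^ y^-1.
    by rewrite psiE ek conjgM conjgK /th e2b conjgE -xzN xzD !mulgA.
  rewrite conjgE invgK; have h1 := lenM y (psi gb * y^-1); have h2 := lenM (psi gb) y^-1.
  rewrite lenV in h2; apply: leq_trans h1 _; apply: leq_trans (leq_add (leqnn _) h2) _; lia.
exists v, j, i1, k; split=> //; last by split; lia.
(* If v is a single letter b^(+-1), then a and v a^j generate and psi is onto. *)
- rewrite ltnNge; apply/negP => v1; case: nsurj => z.
  have g : gens ga (v * xz ga j).
    case: vb => x [s [ev [xb _]]]; move: v1; rewrite /len ev; case: s ev => // ev _.
    have ev2 : v = lett x by rewrite -[v]fwK ev fw1.
    have evb : v = gb \/ v = gb^-1.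
      by case: x xb {ev} ev2 => i b /eqP /= -> ->; rewrite lett_gen; case: b; auto.
    have es : e2 ga (v * xz ga j) (gb * xz ga (- j)) = v.
      by rewrite e2M (mor_xz _ _ (@e2M _ _)) e2a e2b -mulgA -xzD GRing.subrr mulg1.
    case: evb => evb.
      by apply: (@gens_e2 _ _ ga (gb * xz ga (- j))); rewrite es e2a evb; exact: gens_id.
    apply: (@gens_e2 _ _ ga (gb * xz ga (- j))^-1); rewrite e2V es e2a evb invgK; exact: gens_id.
  by have [t et] := g (z ^ k); exists t; rewrite psiE /th et conjgK.
- by rewrite -/th thE th0E /k conjgE mulVKg conjgE invgM invgK -!mulgA mulKg.
have ek2 : k = y^-1 * xz ga (- e) by rewrite xzN -invgM -ek invgK.
rewrite ek2; have := lenM y^-1 (xz ga (- e)); rewrite lenV len_ga_xz abszN => h.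
apply: leq_trans h _; lia.
Qed.

Lemma blen_lettM l x : isb l -> blen (lett l * x) = (blen x).+1 -> word (lett l * x) = l :: word x.
Proof.
move=> lb; have [s [p [t [e1 e2 e3]]]] := cancelP (lett l) x.
rewrite /blen e3 e2; case: s e1 e3 => [|m s] /= e1 e3; last first.
  by case: e1 => <-; case: s e3 => //= _ <-.
rewrite -e1 count_cat /= isb_inv lb; lia.
Qed.

Lemma blen_Mlett l x : isb l -> blen (x * lett l) = (blen x).+1 -> word (x * lett l) = rcons (word x) l.
Proof.
move=> lb e; rewrite -[LHS]word_invK -wordV invgM -lettV blen_lettM //.
  by rewrite {1}/word_inv map_cons rev_cons letter_invK -/(word_inv _) wordV word_invK.
by rewrite lettV -invgM !blenV.
Qed.

Lemma blen_conj_lett l x : isb l -> blen (lett l * x * (lett l)^-1) = (blen x).+2 ->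
  word (lett l * x * (lett l)^-1) = l :: rcons (word x) (letter_inv l).
Proof.
move=> lb; rewrite -lettV => e.
have e1 : blen (lett l * x) = (blen x).+1.
  have := blenM (lett l * x) (lett (letter_inv l)); rewrite e.
  have := blenM (lett l) x.
  by rewrite -[blen (lett (letter_inv l))]/(isb l + 0) -[blen (lett l)]/(isb l + 0) lb /=; lia.
by rewrite blen_Mlett ?e ?e1 // blen_lettM.
Qed.

Definition core_bound N := run_bound (3 * N + 2) (2 * N + 1) (2 * N + 1) + N.

(** The first summand serves the case where v v is reduced. In the other, the data of the equation
    grow under a shear before the bound applies, and the result is sheared back. *)
Definition axis_bound l :=
  core_bound (3 * l) + (2 + 2 * l) * core_bound ((2 + 2 * l) * (3 * l) + 4 * l).

(** The conjugator matters only modulo powers of a on the left, so it may be replaced by a W that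
    does not begin with a^(+-1), to which the equation of [axis_core] applies. *)
Lemma axis_len (psi : F -> F) h l : {morph psi : x y / x * y} -> injective psi ->
  ~ (forall z, exists t, psi t = z) -> psi (ga ^ h) = ga ^ h ->
  len (psi ga) <= l -> len (psi gb) <= l ->
  exists2 g, ga ^ h = ga ^ g & len g <= axis_bound l.
Proof.
move=> pM pI nsurj + la lb; have [k0 [W [-> Wf]]] := strip_afree h.
have gaJ k : ga ^ xz ga k = ga by rewrite conjgE (xzC ga 1 k) mulKg.
rewrite conjgM gaJ => fixW.
have [v [j [m [k [vb v2 ek kN [vN jN]]]]]] := axis_core pM pI nsurj fixW la lb.
have [x [s [ev [xb lb']]]] := vb.
have [nf|nf] := eqVneq (last x s) x.
  exists W => //; apply: leq_trans (leq_addr _ _).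
  by apply: (@core_nofold v j m W k _ vb v2 Wf ek kN); [lia | lia | exists x, s].
have fd : last x s = letter_inv x.
  move: nf xb lb'; rewrite /isb /letter_inv; case: (last _ _) => a' b'; case: (x) => a b /=.
  move=> + /eqP ea /eqP ea'; rewrite ea ea' xpair_eqE eqxx /=.
  by case: (b); case: (b').
(* v = x y x^-1; up to conjugation by a power of a, the shear b -> b a^j     *)
(* turns a -> a, b -> v a^j into a -> a, b -> v1 with v1 = x y1 x^-1.         *)
have [s0 es] : exists s0, s = rcons s0 (letter_inv x).
  by move: v2 fd; rewrite /len ev; case/lastP: (s) => // s0 z _; rewrite last_rcons => ->; exists s0.
pose y : F := fw s0.
have ey : v = lett x * y * (lett x)^-1.
  by rewrite -[v]fwK ev es fw_cons -cats1 fw_cat fw1 lettV mulgA.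
have by2 : blen v = (blen y).+2.
  have r0 : reduced s0.
    by have := reduced_word v; rewrite ev es => /path_sorted; rewrite -cats1 => /reduced_cat[].
  by rewrite /blen ev es /y word_fw //= -cats1 count_cat /= isb_inv xb; lia.
have sM : {morph shear j : a b / a * b} by exact: e2M.
have sa i : shear j (xz ga i) = xz ga i by rewrite (mor_xz _ _ sM) /shear e2a.
have [n [y1 [nj e1 by1]]] : exists n (y1 : F), [/\ (`|n| <= `|j|)%N,
    shear j v = xz ga n * (lett x * y1 * (lett x)^-1) * xz ga (- n) & blen y1 = blen y].
  rewrite ey !sM (morV sM); case: (x) xb => i b /eqP /= ->; rewrite lett_gen -/gb; case: b.
    exists (- j)%R, (shear j y); rewrite blen_shear; split=> //; first by rewrite abszN.
    by rewrite !(morV sM) /shear e2b GRing.opprK xzN !invgM !invgK !mulgA.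
  exists 0%R, (xz ga j * shear j y * xz ga (- j)); rewrite blen_Ma blen_aM blen_shear; split=> //.
  by rewrite xz0 mul1g mulg1 {1 3}/shear e2b invgM -xzN !mulgA.
(* The shear preserves the b-length, so the letters x and x^-1 at the ends of v1 do not cancel. *)
have bv : blen (lett x * y1 * (lett x)^-1) = (blen y1).+2.
  by rewrite by1 -by2 -(blen_shear j v) e1 blen_Ma blen_aM.
have ev1 := blen_conj_lett xb bv.
set v1 := lett x * y1 * (lett x)^-1 in e1 bv ev1.
have [e [W2 [eW W2f]]] := strip_afree (shear j W).
(* The equation transported by the shear; the power a^e stripped from the sheared W commutes
   through. *)
have ek2 : W2 * (shear j k * xz ga n) = xz ga (m + n) * e2 ga v1 W2.
  have th z : shear j (e2 ga (v * xz ga j) z) = xz ga n * e2 ga v1 (shear j z) * xz ga (- n).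
    rewrite (e2_comp _ _ _ sM) sM !(sa 1%R) sa; symmetry.
    apply: (@e2_ext (fun z => xz ga n * e2 ga v1 (shear j z) * xz ga (- n))) => [a b||].
    - by rewrite sM e2M xzN -!mulgA mulKg.
    - by rewrite (sa 1%R) e2a (xzC ga n 1) xzN mulgK.
    by rewrite /shear e2b e2M (mor_xz _ _ (@e2M ga v1)) e2b e2a -/(shear j v) e1 -!mulgA -!xzD; rewrite GRing.addrC.
  have := congr1 (shear j) ek; rewrite !sM sa th eW e2M (mor_xz _ _ (@e2M ga v1)) e2a => eq1.
  apply: (@mulgI _ (xz ga e)); rewrite !mulgA eq1 xzN !mulgA mulgVK -!xzD.
  by congr (xz ga _ * _); lia.
exists (shear (- j) W2).
  rewrite -[W in LHS](shearK j) eW /shear e2M (mor_xz _ _ (@e2M _ _)) e2a conjgM gaJ //.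
apply: leq_trans (leq_addl _ _); apply: leq_trans (len_shear _ _) _.
rewrite abszN; apply: leq_mul; first by rewrite leq_add2l.
have vb1 : btied v1 by exists x, (rcons (word y1) (letter_inv x)); rewrite last_rcons isb_inv.
have v12 : 1 < len v1 by rewrite /len ev1 /= size_rcons.
have ek3 : W2 * (shear j k * xz ga n) = xz ga (m + n) * e2 ga (v1 * xz ga 0) W2 by rewrite mulg1.
apply: (core_fold vb1 v12 W2f ek3) => //.
- apply: leq_trans (lenM _ _) _; rewrite len_ga_xz; have := len_shear j k.
  have : ((2 + `|j|) * len k <= (2 + 2 * l) * (3 * l))%N by apply: leq_mul => //; rewrite leq_add2l.
  by move: nj jN; lia.
- have : len v1 <= len (shear j v) + `|n| + `|n|.
    have -> : v1 = xz ga (- n) * (shear j v * xz ga n) by rewrite e1 xzN mulgVK mulKg.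
    apply: leq_trans (lenM _ _) _; rewrite len_ga_xz abszN.
    by have := lenM (shear j v) (xz ga n); rewrite len_ga_xz; lia.
  have := len_shear j v.
  have : ((2 + `|j|) * len v <= (2 + 2 * l) * (2 * l))%N by apply: leq_mul => //; rewrite leq_add2l.
  have : ((2 + 2 * l) * (2 * l) <= (2 + 2 * l) * (3 * l))%N by rewrite leq_mul2l leq_mul2r ?orbT.
  by move: nj jN; lia.
by exists x, (rcons (word y1) (letter_inv x)); rewrite last_rcons.
Qed.

(** * The bound for a primitive element fixed up to inversion *)

Lemma len_e2_max p q x n : len p <= n -> len q <= n -> len (e2 p q x) <= n * len x.
Proof.
move=> pn qn; rewrite e2_word; apply: len_prod => -[i b].
by rewrite /ev /letter_eval /im2 /=; case: b; rewrite ?lenV; case: ifP.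
Qed.

Lemma rsK c d : involutive (rs c d).
Proof.
move=> x; rewrite {1}/rs (e2_comp _ _ _ (@e2M _ _)) -/(rs c d) !rs_lett /=.
by rewrite -[RHS]e2_id !addbb.
Qed.

Lemma rsM c d : {morph rs c d : x y / x * y}. Proof. exact: e2M. Qed.

Lemma len_rs c d x : len (rs c d x) <= len x.
Proof. by rewrite -[X in _ <= X]mul1n; apply: len_e2_max. Qed.

Lemma pmor_inv l : exists ip : F -> F, [/\ {morph ip : x y / x * y}, cancel (pmor l) ip,
  cancel ip (pmor l) &
  forall x, (len (pmor l x) <= 2 ^ nb l * len x)%N /\ (len (ip x) <= 2 ^ nb l * len x)%N].
Proof.
elim: l => [|o l [ip [ipM h1 h2 h3]]].
  by exists id; split=> // x; rewrite mul1n.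
have [i1 [i1M k1 k2 k3]] : exists i1 : F -> F, [/\ {morph i1 : x y / x * y},
    cancel (if o then Sg else Ng) i1, cancel i1 (if o then Sg else Ng) &
    forall x, (len ((if o then Sg else Ng) x) <= 2 ^ o * len x)%N /\ (len (i1 x) <= 2 ^ o * len x)%N].
  have chk (s t s' t' : F) : e2 s t s' = ga -> e2 s t t' = gb -> cancel (e2 s' t') (e2 s t).
    by move=> e1 e3 x; rewrite (e2_comp _ _ _ (@e2M s t)) e1 e3 e2_id.
  case: o; [exists (e2 ga (ga^-1 * gb)) | exists (e2 gb ga)]; split; try exact: e2M.
  - by apply: chk; rewrite ?e2M ?e2V ?e2a ?e2b // mulVKg.
  - by apply: chk; rewrite ?e2M ?e2V ?e2a ?e2b // mulKg.
  - by move=> x; split; apply: len_e2_max.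
  - by apply: chk; rewrite ?e2a ?e2b.
  - by apply: chk; rewrite ?e2a ?e2b.
  by move=> x; split; apply: len_e2_max.
have pE x : pmor (o :: l) x = (if o then Sg else Ng) (pmor l x) by case: (o).
have nE : nb (o :: l) = o + nb l by [].
exists (ip \o i1); split=> [x y|x|x|x].
- by rewrite /= i1M ipM.
- by rewrite pE /= k1 h1.
- by rewrite pE /= h2 k2.
rewrite pE nE expnD; split; last first.
  apply: leq_trans (h3 _).2 _; rewrite -mulnA mulnCA leq_mul2l (k3 _).2 orbT //.
apply: leq_trans (k3 _).1 _; rewrite -mulnA leq_mul2l (h3 _).1 orbT //.
Qed.

Lemma comm2_rs c d : exists (w : F) e, (e = 1 \/ e = -1)%R /\
  rs c d (comm2 ga gb) = xz (comm2 ga gb) e ^ w.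
Proof.
rewrite (comm2_mor _ _ (@rsM c d)) /rs e2a e2b !lett_gen -/ga -/gb.
case: c; case: d.
- exists (gb * ga), 1%R; split; first by left.
  by rewrite xz1 conjgE /comm2 !invgM !invgK !mulgA !(mulgVK, mulgK).
- exists ga, (-1)%R; split; first by right.
  by rewrite (xzN _ 1) xz1 conjgE /comm2 !invgM !invgK !mulgA !(mulgVK, mulgK).
- exists gb, (-1)%R; split; first by right.
  by rewrite (xzN _ 1) xz1 conjgE /comm2 !invgM !invgK !mulgA mulVg mul1g.
by exists 1, 1%R; rewrite conjg1 xz1; split; first by left.
Qed.

Lemma len_comm2 (x y : F) : len (comm2 x y) <= (len x + len y).*2.
Proof.
have h1 := lenM (x * y * x^-1) y^-1; have h2 := lenM (x * y) x^-1; have h3 := lenM x y.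
rewrite !lenV in h1 h2; apply: leq_trans h1 _; lia.
Qed.

Lemma esum_e2_sign c d i x : `|esum i (rs c d x)|%N = `|esum i x|%N.
Proof.
rewrite (esum_mor i x (@rsM c d)) /rs e2a e2b !lett_gen -/ga -/gb.
by case: (ord2P i) => ->; case: c; case: d; rewrite ?esumV !esum_gen; lia.
Qed.

(** B = 2^(2L + 2) bounds the stretch of the change of basis and of its inverse. Then (B L B)^2
    bounds psi^2 on letters, and B (2 |g| + 1) the length of the image of g^-1 a g. *)
Definition fix_bound (L : nat) : nat :=
  (2 ^ (L.*2 + 2) * (axis_bound ((2 ^ (L.*2 + 2) * (L * 2 ^ (L.*2 + 2))) ^ 2)).*2.+1)%N.

Section FixBound.
Variables (f : F -> F) (L : nat).
Hypotheses (fM : {morph f : x y / x * y}) (fI : injective f).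
Hypothesis nsurj : ~ (forall z, exists t, f t = z).
Hypothesis fL : len (f ga) + len (f gb) <= L.

Lemma len_f x : len (f x) <= L * len x.
Proof.
rewrite (e2_ext fM erefl erefl); apply: leq_trans (len_e2 _ _ _) _.
by rewrite leq_mul2r fL orbT.
Qed.

(** Normal form splits p into a positive word X and a conjugator. The first is bounded by
    [primitive_word_size], hence so is the change of basis taking a to X; in the new basis
    [axis_len] bounds the conjugator. *)
Theorem fixed_primitive_len p q : tame p q -> f p = p \/ f p = p^-1 -> len p <= fix_bound L.
Proof.
move=> /tame_normal_form[g [c [d [l [[i b] [_ [_ ep0 _]]]]]]] fp0.
pose p1 := if b then p^-1 else p.
have fp : f p1 = p1 \/ f p1 = p1^-1.
  by rewrite /p1; case: b {p1 ep0} => //; rewrite (morV fM); case: fp0 => ->; auto.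
have -> : len p = len p1 by rewrite /p1; case: (b); rewrite ?lenV.
have [l' [el' nl']] := papply_strip l (i == ord_max).
have ep : p1 = rs c d (pmor l' ga) ^ g.
  have <- : pos [:: false] = ga by rewrite pos1.
  rewrite -pos_papply el' pos_papply pos1 /p1 ep0.
  have -> : lett (i, b) = if b then (if i == ord_max then gb else ga)^-1 else if i == ord_max then gb else ga.
    by rewrite lett_gen; case: (ord2P i) => ->.
  by case: (b) => //; rewrite (morV (@pmorM l)) (morV (@rsM c d)) conjVg invgK.
set X := papply l' [:: false]; rewrite -el' -/X in nl'.
(* f conjugated so as to send the positive word X to X^(+-1). *)
pose lam x := rs c d (f (rs c d x ^ g) ^ g^-1).
have lamM : {morph lam : x y / x * y} by move=> x y; rewrite /lam rsM conjMg fM conjMg rsM.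
have eX : pos X = pmor l' ga by rewrite pos_papply pos1.
have sX : size X <= L.*2 + 2.
  have [w [e [e1 ew]]] := comm2_rs c d.
  apply: (@primitive_word_size l' lam L (rs c d (f (xz (comm2 ga gb) e))) (rs c d (f (w * g) * g^-1))) => //.
  - move=> h; apply: nsurj => z; have [t et] := h (rs c d (z ^ g^-1)).
    exists (rs c d t ^ g); apply: (@conjg_inj _ g^-1); apply: (can_inj (@rsK c d)); exact: et.
  - rewrite -/X eX /lam -ep; case: fp => ->; [left | right]; rewrite ?conjVg ep conjgK ?(morV (@rsM c d)) rsK //.
  - apply: leq_trans (len_rs _ _ _) _; rewrite (mor_xz _ _ fM) (comm2_mor _ _ fM).
    apply: leq_trans (_ : len (comm2 (f ga) (f gb)) <= _).
      by case: e1 => ->; rewrite ?(xzN _ 1) xz1 ?lenV.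
    by apply: leq_trans (len_comm2 _ _) _; rewrite leq_double.
  - rewrite -(comm2_mor _ _ lamM) /lam ew -conjgM (morJ _ _ fM) -(morJ _ _ (@rsM c d)) -conjgM //.
  move=> j; rewrite /lam !esum_e2_sign !esumJ !(morJ _ _ fM) !esumJ /rs e2a e2b !lett_gen -/ga -/gb.
  have h1 := esum_len j (f ga); have h2 := esum_len j (f gb).
  by case: (c); case: (d); rewrite ?(morV fM) ?esumV ?abszN; split; lia.
have [ip [ipM k1 k2 k3]] := pmor_inv l'.
(* The change of basis sending a to the signed X. It involves at most |X| substitutions, and each at
   most doubles lengths. *)
pose rho x := rs c d (pmor l' x); pose irho x := ip (rs c d x).
have rhoM : {morph rho : x y / x * y} by move=> x y; rewrite /rho pmorM rsM.
have irhoM : {morph irho : x y / x * y} by move=> x y; rewrite /irho rsM ipM.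
have rhoK : cancel rho irho by move=> x; rewrite /rho /irho rsK k1.
have irhoK : cancel irho rho by move=> x; rewrite /rho /irho k2 rsK.
have nB : (2 ^ nb l' <= 2 ^ (L.*2 + 2))%N by rewrite leq_exp2l // (leq_trans nl').
set B := (2 ^ (L.*2 + 2))%N in nB *.
have rhoL x : (len (rho x) <= B * len x)%N.
  apply: leq_trans (len_rs _ _ _) _; apply: leq_trans (k3 x).1 _; by rewrite leq_mul2r nB orbT.
have irhoL x : (len (irho x) <= B * len x)%N.
  apply: leq_trans (k3 _).2 _; apply: leq_mul => //; exact: len_rs.
pose psi x := irho (f (rho x)).
have psiL x : (len (psi x) <= B * (L * B) * len x)%N.
  apply: leq_trans (irhoL _) _; rewrite -mulnA leq_mul2l; apply/orP; right.
  apply: leq_trans (len_f _) _; rewrite -mulnA leq_mul2l; apply/orP; right.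
  exact: rhoL.
have psiM : {morph psi : x y / x * y} by move=> x y; rewrite /psi rhoM fM irhoM.
have psiI : injective psi.
  by move=> x y e; apply: (can_inj rhoK); apply: fI; apply: (can_inj irhoK).
have psi2L x : len x = 1%N -> (len (psi (psi x)) <= (B * (L * B)) ^ 2)%N.
  move=> lx; apply: leq_trans (psiL _) _; rewrite expnS expn1 leq_mul2l; apply/orP; right.
  by apply: leq_trans (psiL _) _; rewrite lx muln1.
pose h := irho g.
have ep1 : rho (ga ^ h) = p1 by rewrite (morJ _ _ rhoM) /h irhoK ep.
have psih : psi (ga ^ h) = ga ^ h \/ psi (ga ^ h) = (ga ^ h)^-1.
  have eh : ga ^ h = irho p1 by rewrite -ep1 rhoK.
  by rewrite /psi ep1 eh; case: fp => ->; rewrite ?(morV irhoM); auto.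
(* Squaring removes the sign, as [axis_len] requires a fixed element. *)
have psih2 : psi (psi (ga ^ h)) = ga ^ h.
  by case: psih => e; rewrite !(e, morV psiM, invgK).
have [|||//|||g2 eg2 lg2] := @axis_len (fun x => psi (psi x)) h ((B * (L * B)) ^ 2)%N.
- by move=> x y; rewrite !psiM.
- by move=> x y /psiI/psiI.
- move=> hs; apply: nsurj => z; have [t et] := hs (irho z).
  by exists (rho (psi t)); apply: (can_inj irhoK).
- exact: psi2L.
- exact: psi2L.
rewrite -ep1 eg2 /fix_bound -/B; apply: leq_trans (rhoL _) _; rewrite leq_mul2l; apply/orP; right.
rewrite conjgE; have h1 := lenM g2^-1 (ga * g2); have h2 := lenM ga g2.
rewrite lenV in h1; rewrite -[len ga]/1%N in h2; apply: leq_trans h1 _; lia.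
Qed.

End FixBound.

(** * The dichotomy *)

Section PowerLength.
Variables (X : choiceType) (x : freegroup X).
Hypothesis x1 : x != 1.

Lemma word_expS n : exists s, word (x ^+ n.+1) = s ++ drop (cn x x) (word x).
Proof.
have lt := cn_self x1; elim: n => [|n [s e]].
  by exists (take (cn x x) (word x)); rewrite cat_take_drop.
rewrite expgSr (small_cancel e) ?addnn //; by eexists.
Qed.

(** Every positive power ends with the part of x left uncancelled by another x, so one more factor
    adds |x| - 2 cn x x > 0 letters. *)
Lemma len_expS n : len (x ^+ n) < len (x ^+ n.+1).
Proof.
have lt := cn_self x1; case: n => [|n]; first by rewrite len_gt0.
have [s e] := word_expS n.
have e1 := small_cancel e (_ : cn x x + cn x x < len x).
rewrite [x ^+ n.+2]expgSr /len e1 ?addnn // size_cat size_takel ?leq_subr // size_drop -!/(len _).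
have : cn x x < len (x ^+ n.+1) by rewrite [X in _ < X]/len e size_cat size_drop -!/(len _); lia.
lia.
Qed.

Lemma len_exp_mono m n : m <= n -> len (x ^+ m) <= len (x ^+ n).
Proof. by move=> /subnK <-; elim: (n - m) => //= d IH; exact: leq_trans IH (ltnW (len_expS _)). Qed.

Lemma len_xz_abs k : len (xz x k) = len (x ^+ `|k|%N).
Proof. by case: k => n //=; rewrite lenV. Qed.

Lemma xz_eq1 k : xz x k = 1 -> k = 0%R.
Proof.
move=> e; have [/eqP|k0] := posnP `|k|%N; first by rewrite absz_eq0 => /eqP.
by have := len_exp_mono k0; rewrite -len_xz_abs e leqn0 len_eq0 (negbTE x1).
Qed.

Lemma xz_inj j k : xz x j = xz x k -> j = k.
Proof. by move=> e; apply/GRing.subr0_eq/xz_eq1; rewrite xzD xzN e mulgV. Qed.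

Lemma len_xz_le k : len (xz x k) <= len x -> (`|k| <= 1)%N.
Proof.
rewrite len_xz_abs leqNgt => lt; rewrite leqNgt; apply: contra lt => /len_exp_mono.
by apply: leq_trans; exact: (len_expS 1).
Qed.

End PowerLength.

(** Let f(c) = c^k. If k = +-1, the powers of c are stable. Otherwise the exponent of a stable
    element is divisible by all powers of k, so it is 0. *)
Lemma stab_cyclic_image (f : F -> F) c : {morph f : x y / x * y} -> (forall z, exists k, f z = xz c k) ->
  (forall z, stab f z -> z = 1) \/
  f (f c) = c /\ forall z, stab f z <-> exists k, z = xz c k.
Proof.
move=> fM im; have [k ek] := im c.
have [s1|s1] : (k = 1 \/ k = -1)%R \/ ~ (k = 1 \/ k = -1)%R by lia.
  right; split; first by rewrite ek (mor_xz _ _ fM) ek -xzM; case: s1 => ->.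
  move=> z; split=> [/(_ 1%N)[t <-]|[j ->]]; first exact: im.
  exact/stab_xz/(fix_stab fM ek s1).
left=> z sz; apply/eqP; apply: contraT => z1.
have c1 : c != 1.
  by apply: contra z1 => /eqP c1; have [t <-] := sz 1%N; have [i /= ->] := im t; rewrite c1; case: i => n /=; rewrite expg1n ?invg1.
have itc n : iter n f c = xz c (k ^+ n)%R.
  elim: n => [|n IH]; first by rewrite GRing.expr0 xz1.
  by rewrite iterS IH (mor_xz _ _ fM) ek -xzM GRing.exprS.
have zn n : exists i, z = xz c (k ^+ n * i)%R.
  have [t <-] := sz n.+1; rewrite iterSr; have [i ->] := im t; exists i.
  by rewrite (mor_xz _ _ (iterM n fM)) itc xzM.
have [j ej] := zn 0; rewrite GRing.expr0 GRing.mul1r in ej.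
have j0 : j != 0%R by apply: contraNneq z1 => j0; rewrite ej j0.
have [i ei] := zn `|j|%N; have /(congr1 absz) := xz_inj c1 (etrans (esym ej) ei).
rewrite abszM abszX; have : (0 < `|j|)%N by rewrite absz_gt0.
have [k0|k2] : (`|k| = 0 \/ 1 < `|k|)%N by lia.
  by rewrite k0; case: `|j|%N => // n _; rewrite expnS mul0n.
by have := ltn_expl `|j|%N k2; case: `|i|%N => [|i']; rewrite ?muln0; nia.
Qed.

(** The exponent bounds [nmu] of (f(a), f(b)); the factor 2 is |a| + |b|. *)
Definition preim_bound (L : nat) : nat := (2 ^ (3 * L ^ 2 + L.*2) * 2)%N.

(** Reduce the image of the basis. Degenerate pairs have cyclic image; for a reduced pair f is
    injective and is either onto or covered by [stable_cyclic]. A trivial stable image is generated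
    by x = 1. *)
Theorem stable_dichotomy (f : F -> F) L : {morph f : x y / x * y} -> len (f ga) + len (f gb) <= L ->
  (exists p q, [/\ len p <= preim_bound L, len q <= preim_bound L, f p = ga & f q = gb]) \/
  exists x, [/\ len x <= fix_bound L + L, f (f x) = x & forall z, stab f z <-> exists k, z = xz x k].
Proof.
move=> fM fL.
have trivial : (forall z, stab f z -> z = 1) -> exists x,
    [/\ len x <= fix_bound L + L, f (f x) = x & forall z, stab f z <-> exists k, z = xz x k].
  move=> h; exists 1; split; [by [] | by rewrite !(mor1 fM) |].
  move=> z; split=> [/h ->|[k ->]]; first by exists 0%R.
  by apply: (stab_xz fM) => n; exists 1; apply: (mor1 (iterM n fM)).
have [p [q [tpq lpq lt end_]]] := nielsen_reduction fM TameId.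
have fE z : f (e2 p q z) = e2 (f p) (f q) z by exact: e2_comp.
have ps := tame_surj tpq.
have degen c : (forall z, exists k, e2 (f p) (f q) z = xz c k) -> len c <= L -> exists x,
    [/\ len x <= fix_bound L + L, f (f x) = x & forall z, stab f z <-> exists k, z = xz x k].
  move=> im lc; case: (@stab_cyclic_image f c fM) => [z|/trivial//|[h1 h2]].
    by have [t <-] := ps z; rewrite fE.
  by exists c; split=> //; apply: leq_trans lc (leq_addl _ _).
have lL : len (f p) <= L /\ len (f q) <= L.
  by move: lt; rewrite /tlen; lia.
have pow1 c z : exists k, e2 1 c z = xz c k /\ exists k', e2 c 1 z = xz c k'.
  rewrite -[z]fwK; elim: (word z) => [|[i b] s [k [IH1 [k' IH2]]]].
    by rewrite fw_nil !e21; exists 0%R; split=> //; exists 0%R.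
  have [j [j' [e1 e3]]] : exists j j', ev 1 c (i, b) = xz c j /\ ev c 1 (i, b) = xz c j'.
    rewrite /ev /letter_eval /im2 /=; case: (ord2P i) => -> /=; case: b.
    - by exists 0%R, (-1)%R; rewrite invg1 (xzN _ 1).
    - by exists 0%R, 1%R.
    - by exists (-1)%R, 0%R; rewrite invg1 (xzN _ 1).
    by exists 1%R, 0%R.
  exists (j + k)%R; rewrite fw_cons !e2M !e2_lett IH1 IH2 e1 e3 xzD; split=> //.
  by exists (j' + k')%R; rewrite xzD.
case: end_ => [u1|v1|nr].
- right; apply: (degen (f q)) => [z|]; last exact: lL.2.
  by rewrite u1; have [k [-> _]] := pow1 (f q) z; exists k.
- right; apply: (degen (f p)) => [z|]; last exact: lL.1.
  by rewrite v1; have [_ [_ [k ->]]] := pow1 (f p) z; exists k.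
have fI : injective f.
  move=> x y; have [s <-] := ps x; have [t <-] := ps y; rewrite !fE.
  by move/(nred_inj nr) => ->.
have [surj|nsurj] := pselect (forall z, exists t, f t = z); [left | right].
  (* A letter is the image of a word in p and q that is no longer than the letter itself, hence of
     p^(+-1) or q^(+-1). *)
  have pre z : len z = 1%N -> exists2 y, len y <= len p + len q & f y = z.
    move=> lz; have [t et] := surj z; have [w ew] := ps t.
    have := nred_len nr (reduced_word w); rewrite fwK -fE ew et lz.
    case ww : (word w) => [|l [|//]] _.
      move: lz; rewrite -et -ew -[w]fwK ww fw_nil e21 (mor1 fM) //.
    exists t => //; rewrite -ew -[w]fwK ww fw1 e2_lett len_ev.
    by case: ifP => _; lia.
  have R1 : len p + len q <= preim_bound L.
    apply: leq_trans lpq _; rewrite -[len ga + len gb]/2 leq_mul2r leq_exp2l //=.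
    rewrite /nmu /qlen /tlen.
    have h1 := lenM (f ga) (f ga); have h2 := lenM (f gb) (f gb).
    have h3 : ((len (f ga) + len (f gb)) ^ 2 <= L ^ 2)%N by rewrite leq_exp2r.
    lia.
  have [x lx ex] := pre ga erefl; have [y ly ey] := pre gb erefl.
  by exists x, y; split=> //; [apply: leq_trans lx R1 | apply: leq_trans ly R1].
have [nt|nt] := pselect (exists2 x, stab f x & x != 1); last first.
  by apply: trivial => z sz; apply: contrapT => /eqP z1; apply: nt; exists z.
have [p1 [q1 [t1 fp1 h]]] := stable_cyclic fM fI nsurj nt.
exists p1; split=> //.
- by apply: leq_trans (leq_addr _ _); apply: (fixed_primitive_len fM fI nsurj fL t1 fp1).
by case: fp1 => e; rewrite !(e, morV fM, invgK).
Qed.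

Local Close Scope group_scope.

(** * Recursive functions *)

Definition comput (n : nat) (f : seq nat -> nat) : Prop :=
  exists p, forall xs, size xs = n -> rec_eval p xs (f xs).

Definition computs (n : nat) (hs : seq (seq nat -> nat)) : Prop :=
  exists ps, forall xs, size xs = n -> rec_evals ps xs [seq h xs | h <- hs].

Lemma comput_ext n f g : (forall xs, size xs = n -> f xs = g xs) -> comput n f -> comput n g.
Proof. by move=> e [p h]; exists p => xs sx; rewrite -e //; exact: h. Qed.

Lemma computs_nil n : computs n [::].
Proof. by exists [::] => xs _; exact: EvalNil. Qed.

Lemma computs_cons n h hs : comput n h -> computs n hs -> computs n (h :: hs).
Proof.
move=> [p ph] [ps phs]; exists (p :: ps) => xs sx.
by apply: EvalCons; [exact: ph | exact: phs].
Qed.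

Lemma comput_comp n g hs : comput (size hs) g -> computs n hs ->
  comput n (fun xs => g [seq h xs | h <- hs]).
Proof.
move=> [p ph] [ps phs]; exists (Comp p ps) => xs sx.
by apply: EvalComp (phs _ sx) _; apply: ph; rewrite size_map.
Qed.

Lemma comput_nth n i : i < n -> comput n (fun xs => nth 0 xs i).
Proof. by move=> lt; exists (Proj i) => xs sx; apply: EvalProj; rewrite sx. Qed.

Lemma computs_iota n m k : m + k <= n -> computs n [seq (fun xs => nth 0 xs i) | i <- iota m k].
Proof.
elim: k m => [|k IH] m le /=; first exact: computs_nil.
by apply: computs_cons; [apply: comput_nth; lia | apply: IH; lia].
Qed.

Lemma map_iota_drop n m k xs : size xs = n -> m + k = n ->
  [seq h xs | h <- [seq (fun xs : seq nat => nth 0 xs i) | i <- iota m k]] = drop m xs.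
Proof.
move=> sx e; rewrite -map_comp (eq_map (g := fun i => nth 0 xs i)) //.
have ek : k = size xs - m by rewrite sx -e addKn.
by rewrite map_nth_iota -?ek // take_oversize // size_drop ek.
Qed.

Lemma comput_behead n f : comput n f -> comput n.+1 (fun ys => f (behead ys)).
Proof.
move=> cf; apply: comput_ext (comput_comp (n := n.+1) (hs := [seq (fun xs => nth 0 xs i) | i <- iota 1 n]) _ _).
- by move=> xs sx; rewrite (map_iota_drop sx) // drop1.
- by rewrite size_map size_iota.
exact: computs_iota.
Qed.

Lemma comput_subst n g a : comput n.+1 g -> comput n.+1 a ->
  comput n.+1 (fun ys => g (a ys :: behead ys)).
Proof.
move=> cg ca; apply: comput_ext (comput_comp (n := n.+1) (hs := a :: [seq (fun xs => nth 0 xs i) | i <- iota 1 n]) _ _).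
- by move=> xs sx; rewrite map_cons (map_iota_drop sx) // drop1.
- by rewrite /= size_map size_iota.
by apply: computs_cons => //; exact: computs_iota.
Qed.

Lemma comput1 f n a : comput 1 (fun xs => f (nth 0 xs 0)) -> comput n a ->
  comput n (fun xs => f (a xs)).
Proof.
move=> cf ca; apply: (comput_comp (hs := [:: a]) cf).
exact: computs_cons ca (computs_nil _).
Qed.

Lemma comput2 f n a b : comput 2 (fun xs => f (nth 0 xs 0) (nth 0 xs 1)) ->
  comput n a -> comput n b -> comput n (fun xs => f (a xs) (b xs)).
Proof.
move=> cf ca cb; apply: (comput_comp (hs := [:: a; b]) cf).
exact: computs_cons ca (computs_cons cb (computs_nil _)).
Qed.

Lemma comput3 f n a b c : comput 3 (fun xs => f (nth 0 xs 0) (nth 0 xs 1) (nth 0 xs 2)) ->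
  comput n a -> comput n b -> comput n c -> comput n (fun xs => f (a xs) (b xs) (c xs)).
Proof.
move=> cf ca cb cc; apply: (comput_comp (hs := [:: a; b; c]) cf).
exact: computs_cons ca (computs_cons cb (computs_cons cc (computs_nil _))).
Qed.

Lemma comput_succ n a : comput n a -> comput n (fun xs => (a xs).+1).
Proof.
move=> ca; apply: (comput1 (f := S)) => //; exists Succ => -[|x [|]] //= _.
exact: EvalSucc.
Qed.

Lemma comput_const n k : comput n (fun=> k).
Proof.
elim: k => [|k IH]; last exact: comput_succ.
by exists Zero => xs _; exact: EvalZero.
Qed.

(** [Prec] recurses on its first argument; the counter, computed by k, is supplied there by
    composition. *)
Lemma comput_iteri n k b g : comput n k -> comput n b -> comput n.+2 g ->
  comput n (fun xs => iteri (k xs) (fun i y => g [:: i, y & xs]) (b xs)).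
Proof.
move=> ck [p pb] [q qg].
pose G ys := iteri (head 0 ys) (fun i y => g [:: i, y & behead ys]) (b (behead ys)).
have h : comput n.+1 G.
  exists (Prec p q) => -[|m xs] //= [sx]; elim: m => [|m IH] /=.
    by apply: EvalPrec0; exact: pb.
  by apply: EvalPrecS IH _; apply: qg; rewrite /= sx.
apply: comput_ext (comput_comp (n := n) (g := G) (hs := k :: [seq (fun xs => nth 0 xs i) | i <- iota 0 n]) _ _).
- by move=> xs sx; rewrite map_cons (map_iota_drop sx) // drop0.
- by rewrite /= size_map size_iota; exact: h.
by apply: computs_cons => //; exact: computs_iota.
Qed.

Lemma comput_mu n g (f : seq nat -> nat) : comput n.+1 g ->
  (forall xs, size xs = n -> g (f xs :: xs) = 0 /\ forall m, m < f xs -> 0 < g (m :: xs)) ->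
  comput n f.
Proof.
move=> [p pg] h; exists (Mu p) => xs sx; have [h0 h1] := h _ sx.
apply: (EvalMu (k := fun m => (g (m :: xs)).-1)).
  by move=> m lt; rewrite prednK ?h1 //; apply: pg; rewrite /= sx.
by rewrite -h0; apply: pg; rewrite /= sx.
Qed.

Lemma comput_add n a b : comput n a -> comput n b -> comput n (fun xs => a xs + b xs).
Proof.
apply: (comput2 (f := addn)).
apply: comput_ext (comput_iteri (comput_nth (n := 2) (i := 0) isT) (comput_nth (n := 2) (i := 1) isT)
  (comput_succ (comput_nth (n := 4) (i := 1) isT))) => xs _ /=.
by elim: (nth 0 xs 0) => //= m ->.
Qed.

Lemma comput_mul n a b : comput n a -> comput n b -> comput n (fun xs => a xs * b xs).
Proof.
apply: (comput2 (f := muln)).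
apply: comput_ext (comput_iteri (comput_nth (n := 2) (i := 0) isT) (comput_const 2 0)
  (comput_add (comput_nth (n := 4) (i := 3) isT) (comput_nth (n := 4) (i := 1) isT))) => xs _ /=.
by elim: (nth 0 xs 0) => //= m ->; rewrite mulSn.
Qed.

Lemma comput_exp n a b : comput n a -> comput n b -> comput n (fun xs => a xs ^ b xs).
Proof.
apply: (comput2 (f := expn)).
apply: comput_ext (comput_iteri (comput_nth (n := 2) (i := 1) isT) (comput_const 2 1)
  (comput_mul (comput_nth (n := 4) (i := 2) isT) (comput_nth (n := 4) (i := 1) isT))) => xs _ /=.
by elim: (nth 0 xs 1) => //= m ->; rewrite expnS.
Qed.

Lemma comput_pred n a : comput n a -> comput n (fun xs => (a xs).-1).
Proof.
apply: (comput1 (f := predn)).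
apply: comput_ext (comput_iteri (comput_nth (n := 1) (i := 0) isT) (comput_const 1 0)
  (comput_nth (n := 3) (i := 0) isT)) => xs _ /=.
by case: (nth 0 xs 0).
Qed.

Lemma comput_sub n a b : comput n a -> comput n b -> comput n (fun xs => a xs - b xs).
Proof.
apply: (comput2 (f := subn)).
apply: comput_ext (comput_iteri (comput_nth (n := 2) (i := 1) isT) (comput_nth (n := 2) (i := 0) isT)
  (comput_pred (comput_nth (n := 4) (i := 1) isT))) => xs _ /=.
by elim: (nth 0 xs 1) => [|m /= ->] /=; rewrite ?subn0 ?subnS.
Qed.

Definition computb n (P : seq nat -> bool) := comput n (fun xs => P xs).

Lemma computb_not n P : computb n P -> computb n (fun xs => ~~ P xs).
Proof.
move=> cP; apply: comput_ext (comput_sub (comput_const n 1) cP) => xs _ /=.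
by case: (P xs).
Qed.

Lemma computb_and n P Q : computb n P -> computb n Q -> computb n (fun xs => P xs && Q xs).
Proof.
move=> cP cQ; apply: comput_ext (comput_mul cP cQ) => xs _ /=.
by case: (P xs); case: (Q xs).
Qed.

Lemma computb_or n P Q : computb n P -> computb n Q -> computb n (fun xs => P xs || Q xs).
Proof.
move=> cP cQ; have := computb_not (computb_and (computb_not cP) (computb_not cQ)).
by apply: comput_ext => xs _; rewrite negb_and !negbK.
Qed.

Lemma computb_leq n a b : comput n a -> comput n b -> computb n (fun xs => a xs <= b xs).
Proof.
move=> ca cb; apply: comput_ext (comput_sub (comput_const n 1) (comput_sub ca cb)) => xs _ /=.
by case: leqP => h /=; lia.
Qed.

Lemma computb_lt n a b : comput n a -> comput n b -> computb n (fun xs => a xs < b xs).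
Proof. by move=> ca; apply: computb_leq; exact: comput_succ. Qed.

Lemma computb_eq n a b : comput n a -> comput n b -> computb n (fun xs => a xs == b xs).
Proof.
move=> ca cb; have := computb_and (computb_leq ca cb) (computb_leq cb ca).
by apply: comput_ext => xs _; rewrite -eqn_leq.
Qed.

Lemma comput_if n P a b : computb n P -> comput n a -> comput n b ->
  comput n (fun xs => if P xs then a xs else b xs).
Proof.
move=> cP ca cb.
apply: comput_ext (comput_add (comput_mul cP ca) (comput_mul (computb_not cP) cb)) => xs _ /=.
by case: (P xs); rewrite ?mul1n ?mul0n ?addn0.
Qed.

(** Allowing k <= f as a stopping condition turns the bounded search into a minimisation that always
    halts. *)
Lemma find_iotaE (P : pred nat) k (f := find P (iota 0 k)) :
  (k <= f) || P f /\ forall m, m < f -> ~~ ((k <= m) || P m).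
Proof.
have le : f <= k by rewrite -[X in _ <= X](size_iota 0 k); exact: find_size.
split=> [|m lt].
  have [lt|le2] := ltnP f k; last by [].
  have := @nth_find _ 0 P (iota 0 k); rewrite has_find size_iota -/f => /(_ lt).
  by rewrite nth_iota.
have := @before_find _ 0 P (iota 0 k) m lt; rewrite nth_iota ?(leq_trans lt) // add0n => ->.
by rewrite orbF -ltnNge; exact: leq_trans lt le.
Qed.

Lemma comput_find n k P : comput n k -> computb n.+1 P ->
  comput n (fun xs => find (fun i => P (i :: xs)) (iota 0 (k xs))).
Proof.
move=> ck cP; apply: (comput_mu (g := fun ys => ~~ ((k (behead ys) <= nth 0 ys 0) || P ys))).
  apply: computb_not; apply: computb_or => //.
  by apply: computb_leq; [exact: comput_behead | exact: comput_nth].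
move=> xs _; have [h0 h1] := find_iotaE (fun i => P (i :: xs)) (k xs).
by split=> [|m /h1 h2]; rewrite /= ?h0 //= h2.
Qed.

Lemma computb_has n k P : comput n k -> computb n.+1 P ->
  computb n (fun xs => has (fun i => P (i :: xs)) (iota 0 (k xs))).
Proof.
move=> ck cP; have := computb_lt (comput_find ck cP) ck.
by apply: comput_ext => xs _; rewrite has_find size_iota.
Qed.

(** * Computing with coded words *)

Notation code := CodeSeq.code.
Notation decode := CodeSeq.decode.

Definition cconsn (x c : nat) : nat := 2 ^ x * (2 * c + 1).
Definition chead (c : nat) : nat := head 0 (decode c).
Definition ctail (c : nat) : nat := code (behead (decode c)).
Definition csize (c : nat) : nat := size (decode c).
Definition cnth (c i : nat) : nat := nth 0 (decode c) i.

Lemma cconsnE x c : cconsn x c = code (x :: decode c).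
Proof. by rewrite /= CodeSeq.decodeK /cconsn; congr (_ * _); lia. Qed.

Lemma cconsn_inj x c y d : cconsn x c = cconsn y d -> x = y /\ c = d.
Proof.
rewrite !cconsnE => /(can_inj CodeSeq.codeK)[-> /(can_inj CodeSeq.decodeK) ->].
by split.
Qed.

Lemma code_cases c : c = 0 \/ c = cconsn (chead c) (ctail c).
Proof.
rewrite -[c]CodeSeq.decodeK /chead /ctail; case: (decode c) => [|x s]; first by left.
by right; rewrite cconsnE !CodeSeq.codeK.
Qed.

Lemma ltn_cconsn x c : x < cconsn x c /\ c < cconsn x c.
Proof.
have h1 := ltn_expl x (isT : 1 < 2); have h2 : 0 < 2 ^ x by rewrite expn_gt0.
by rewrite /cconsn; split; nia.
Qed.

Lemma comput_cconsn n a b : comput n a -> comput n b -> comput n (fun xs => cconsn (a xs) (b xs)).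
Proof.
move=> ca cb; apply: comput_mul; first by apply: comput_exp => //; exact: comput_const.
by apply: comput_add; [apply: comput_mul => //|]; exact: comput_const.
Qed.

(** Head and tail of a nonempty list are smaller than its code, so they are found by search below
    it; the code 0 of the empty list stops the search at once. *)
Lemma comput_chead n a : comput n a -> comput n (fun xs => chead (a xs)).
Proof.
apply: (comput1 (f := chead)).
apply: (@comput_mu _ (fun ys => ~~ ((nth 0 ys 1 == 0) ||
  has (fun i => nth 0 (i :: ys) 2 == cconsn (nth 0 (i :: ys) 1) (nth 0 (i :: ys) 0)) (iota 0 (nth 0 ys 1))))).
  apply: computb_not; apply: computb_or.
    by apply: computb_eq; [exact: comput_nth | exact: comput_const].
  apply: (computb_has (k := fun ys => nth 0 ys 1) (P := fun zs => nth 0 zs 2 == cconsn (nth 0 zs 1) (nth 0 zs 0))).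
    exact: comput_nth.
  by apply: computb_eq; [|apply: comput_cconsn]; exact: comput_nth.
move=> [|c [|]] //= _; case: (code_cases c) => [->|ec]; first by [].
have [h1 h2] := ltn_cconsn (chead c) (ctail c); rewrite -ec in h1 h2.
split=> [|m lt].
  suff -> : has (fun i => c == cconsn (chead c) i) (iota 0 c) by rewrite orbT.
  by apply/hasP; exists (ctail c); rewrite ?mem_iota //= -ec.
case: eqP h1 => [->|_ _] //=; case: hasP => // -[i _ /eqP e].
by move: lt; rewrite ec in e; have [<-] := cconsn_inj e; rewrite ltnn.
Qed.

Lemma comput_ctail n a : comput n a -> comput n (fun xs => ctail (a xs)).
Proof.
apply: (comput1 (f := ctail)).
apply: (@comput_mu _ (fun ys => ~~ ((nth 0 ys 1 == 0) || (nth 0 ys 1 == cconsn (chead (nth 0 ys 1)) (nth 0 ys 0))))).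
  apply: computb_not; apply: computb_or.
    by apply: computb_eq; [exact: comput_nth | exact: comput_const].
  by apply: computb_eq; [|apply: comput_cconsn; [apply: comput_chead|]]; exact: comput_nth.
move=> [|c [|]] //= _; case: (code_cases c) => [->|ec]; first by [].
split=> [|m lt]; first by rewrite -ec eqxx orbT.
have [h1 h2] := ltn_cconsn (chead c) (ctail c); rewrite -ec in h1 h2.
case: eqP h1 => [->|_ _] //=; case: eqP => // e; move: lt.
by rewrite {1}ec in e; have [_ <-] := cconsn_inj e; rewrite ltnn.
Qed.

Lemma iter_ctail i c : iter i ctail c = code (drop i (decode c)).
Proof.
elim: i => [|i IH]; first by rewrite drop0 CodeSeq.decodeK.
by rewrite iterS IH /ctail CodeSeq.codeK -drop1 drop_drop add1n.
Qed.

Lemma comput_iter_ctail n a b : comput n a -> comput n b -> comput n (fun xs => iter (a xs) ctail (b xs)).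
Proof.
apply: (comput2 (f := fun i c => iter i ctail c)).
apply: comput_ext (comput_iteri (comput_nth (n := 2) (i := 0) isT) (comput_nth (n := 2) (i := 1) isT)
  (comput_ctail (comput_nth (n := 4) (i := 1) isT))) => xs _ /=.
by elim: (nth 0 xs 0) => //= m ->.
Qed.

Lemma comput_cnth n a b : comput n a -> comput n b -> comput n (fun xs => cnth (a xs) (b xs)).
Proof.
move=> ca cb; apply: comput_ext (comput_chead (comput_iter_ctail cb ca)) => xs _.
by rewrite iter_ctail /chead CodeSeq.codeK -nth0 nth_drop addn0.
Qed.

Lemma code_eq0 s : (code s == 0) = (s == [::]).
Proof. by rewrite -[X in _ == X]/(code [::]) (inj_eq (can_inj CodeSeq.codeK)). Qed.

Lemma comput_csize n a : comput n a -> comput n (fun xs => csize (a xs)).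
Proof.
apply: (comput1 (f := csize)).
apply: (@comput_mu _ (fun ys => ~~ (iter (nth 0 ys 0) ctail (nth 0 ys 1) == 0))).
  apply: computb_not; apply: computb_eq; last exact: comput_const.
  by apply: comput_iter_ctail; exact: comput_nth.
move=> [|c [|]] //= _; split=> [|m lt]; rewrite iter_ctail code_eq0.
  by rewrite drop_oversize.
by rewrite -size_eq0 size_drop subn_eq0 -ltnNge lt.
Qed.

Lemma foldl_iteri (h : nat -> nat -> nat) z s :
  iteri (size s) (fun i y => h (nth 0 s i) y) z = foldl (fun y x => h x y) z s.
Proof.
elim/last_ind: s => // s x IH; rewrite size_rcons foldl_rcons -IH /= nth_rcons ltnn eqxx.
congr (h x _); have : size s <= size s by [].
by elim: {1 3 4}(size s) => //= m IHm lt; rewrite nth_rcons lt IHm // ltnW.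
Qed.

Section Folds.
Variables (n : nat) (c z g : seq nat -> nat).
Hypotheses (cc : comput n c) (cz : comput n z) (cg : comput n.+2 g).

Lemma comput_foldl :
  comput n (fun xs => foldl (fun y x => g [:: x, y & xs]) (z xs) (decode (c xs))).
Proof.
have cg' : comput n.+2 (fun ys => g (cnth (c (behead (behead ys))) (nth 0 ys 0) :: behead ys)).
  apply: comput_subst => //; apply: comput_cnth; last exact: comput_nth.
  by apply: (comput_behead (f := fun ys => c (behead ys))); exact: comput_behead.
apply: comput_ext (comput_iteri (comput_csize cc) cz cg') => xs _ /=.
exact: (foldl_iteri (fun x y => g [:: x, y & xs])).
Qed.

Lemma comput_foldr :
  comput n (fun xs => foldr (fun x y => g [:: x, y & xs]) (z xs) (decode (c xs))).
Proof.
have cc2 : comput n.+2 (fun ys => c (behead (behead ys))).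
  by apply: (comput_behead (f := fun ys => c (behead ys))); exact: comput_behead.
have cg' : comput n.+2 (fun ys => g (cnth (c (behead (behead ys)))
    (csize (c (behead (behead ys))) - (nth 0 ys 0).+1) :: behead ys)).
  apply: comput_subst => //; apply: comput_cnth => //.
  by apply: comput_sub; [exact: comput_csize | apply: comput_succ; exact: comput_nth].
apply: comput_ext (comput_iteri (comput_csize cc) cz cg') => xs _ /=.
rewrite -(foldl_rev (fun y x => g [:: x, y & xs])).
rewrite -(foldl_iteri (fun x y => g [:: x, y & xs])) size_rev /csize /cnth.
have : size (decode (c xs)) <= size (decode (c xs)) by [].
elim: {1 3 5}(size (decode (c xs))) => //= m IHm lt.
by rewrite nth_rev // IHm // ltnW.
Qed.

End Folds.

Definition clinv (m : nat) : nat :=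
  if m == 0 then 1 else if m == 1 then 0 else if m == 2 then 3 else 2.

Definition cpush (m c : nat) : nat :=
  if (0 < c) && (chead c == clinv m) then ctail c else cconsn m c.

Definition cmul (u c : nat) : nat := foldr cpush c (decode u).
Definition cmulV (u c : nat) : nat := foldl (fun y m => cpush (clinv m) y) c (decode u).

(* Every number is read as a letter, those above 3 standing for b^-1.         *)
Definition cact (u v m c : nat) : nat :=
  if m == 0 then cmul u c else if m == 1 then cmulV u c
  else if m == 2 then cmul v c else cmulV v c.

(** On codes, this applies the endomorphism a -> u, b -> v to the word c, reducing as it multiplies
    ([cevalE]). *)
Definition ceval (u v c : nat) : nat := foldr (cact u v) 0 (decode c).

Definition letter_decode (m : nat) : L2 :=
  if m == 0 then (ord0 : I2, false) else if m == 1 then (ord0 : I2, true)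
  else if m == 2 then (ord_max : I2, false) else (ord_max : I2, true).

Definition word_decode (c : nat) : F := fw (map letter_decode (decode c)).

Local Notation lc := (map letter_code).

Lemma letter_codeK (l : L2) : letter_decode (letter_code l) = l.
Proof. by case: l => i b; case: (ord2P i) => ->; case: b. Qed.

Lemma letter_code_lt (l : L2) : letter_code l < 4.
Proof. by case: l => i b; case: (ord2P i) => ->; case: b. Qed.

Lemma clinvE (l : L2) : clinv (letter_code l) = letter_code (letter_inv l).
Proof. by case: l => i b; case: (ord2P i) => ->; case: b. Qed.

Lemma cpushE (l : L2) (w : seq L2) : cpush (letter_code l) (code (lc w)) = code (lc (push l w)).
Proof.
have li : injective (letter_code : L2 -> nat) := can_inj letter_codeK.
case: w => [|m w]; first by rewrite /cpush /cconsn /=; lia.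
rewrite /cpush /chead /ctail clinvE lt0n code_eq0 cconsnE CodeSeq.codeK /= (inj_eq li).
by case: ifP.
Qed.

Lemma cmulE (u x : F) : cmul (word_code u) (word_code x) = word_code (u * x)%g.
Proof.
rewrite /cmul /word_code CodeSeq.codeK -[word (u * x)%g]/(reduce (word u ++ word x)).
rewrite reduce_cat reduce_id; last exact: reduced_word.
by elim: (word u) => //= l s ->; rewrite cpushE.
Qed.

Lemma cmulVE (u x : F) : cmulV (word_code u) (word_code x) = word_code (u^-1 * x)%g.
Proof.
rewrite /cmulV /word_code CodeSeq.codeK -[word (u^-1 * x)%g]/(reduce (word_inv (word u) ++ word x)).
rewrite reduce_cat reduce_id; last exact: reduced_word.
rewrite /word_inv -(foldl_rev (fun y l => push l y)) revK.
elim/last_ind: (word u) => // s l IH.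
by rewrite !map_rcons !foldl_rcons IH clinvE cpushE.
Qed.

Lemma cactE (u v x : F) m :
  cact (word_code u) (word_code v) m (word_code x) = word_code (ev u v (letter_decode m) * x)%g.
Proof.
rewrite /cact /letter_decode !cmulE !cmulVE.
by case: eqP => // _; case: eqP => // _; case: eqP.
Qed.

Lemma cevalE (u v : F) c : ceval (word_code u) (word_code v) c = word_code (e2 u v (word_decode c)).
Proof.
rewrite /ceval /word_decode; elim: (decode c) => [|m s IH]; first by rewrite fw_nil e21.
by rewrite /= IH cactE fw_cons e2M e2_lett.
Qed.

Lemma word_codeK (x : F) : word_decode (word_code x) = x.
Proof.
by rewrite /word_decode /word_code CodeSeq.codeK -map_comp (eq_map letter_codeK) map_id fwK.
Qed.

Lemma word_code_inj (x y : F) : word_code x = word_code y -> x = y.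
Proof. exact: (can_inj word_codeK). Qed.

Lemma csizeE (x : F) : csize (word_code x) = len x.
Proof. by rewrite /csize /word_code CodeSeq.codeK size_map. Qed.

(** Letter codes are at most 3, so a letter in front turns the code c into at most 8 (2c + 1) < 16
    (c + 1). *)
Lemma word_code_lt (x : F) n : len x <= n -> word_code x < 16 ^ n.
Proof.
move=> le; apply: leq_trans (_ : 16 ^ len x <= _); last by rewrite leq_exp2l.
rewrite /word_code /len; elim: (word x) => //= l s IH.
have : 2 ^ letter_code l <= 8 by rewrite -[8]/(2 ^ 3) leq_exp2l // -ltnS letter_code_lt.
by rewrite expnS; nia.
Qed.

Section Comput.
Variables (n : nat) (a b c d : seq nat -> nat).
Hypotheses (ca : comput n a) (cb : comput n b) (cc : comput n c) (cd : comput n d).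

Lemma comput_clinv : comput n (fun xs => clinv (a xs)).
Proof.
by do 3![apply: comput_if; [apply: computb_eq => //; exact: comput_const | exact: comput_const |]];
  exact: comput_const.
Qed.

End Comput.

Lemma comput_cpush n a b : comput n a -> comput n b -> comput n (fun xs => cpush (a xs) (b xs)).
Proof.
move=> ca cb; apply: comput_if; [|exact: comput_ctail|exact: comput_cconsn].
apply: computb_and; first by apply: computb_lt => //; exact: comput_const.
by apply: computb_eq; [exact: comput_chead | exact: comput_clinv].
Qed.

Lemma comput_cmul n a b : comput n a -> comput n b -> comput n (fun xs => cmul (a xs) (b xs)).
Proof.
move=> ca cb; apply: (comput_foldr (g := fun ys => cpush (nth 0 ys 0) (nth 0 ys 1))) => //.
by apply: comput_cpush; exact: comput_nth.
Qed.

Lemma comput_cmulV n a b : comput n a -> comput n b -> comput n (fun xs => cmulV (a xs) (b xs)).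
Proof.
move=> ca cb; apply: (comput_foldl (g := fun ys => cpush (clinv (nth 0 ys 0)) (nth 0 ys 1))) => //.
by apply: comput_cpush; [apply: comput_clinv|]; exact: comput_nth.
Qed.

Lemma comput_cact n a b c d : comput n a -> comput n b -> comput n c -> comput n d ->
  comput n (fun xs => cact (a xs) (b xs) (c xs) (d xs)).
Proof.
move=> ca cb cc cd.
have cq k : computb n (fun xs => c xs == k) by apply: computb_eq => //; exact: comput_const.
apply: comput_if; [exact: cq | exact: comput_cmul |].
apply: comput_if; [exact: cq | exact: comput_cmulV |].
by apply: comput_if; [exact: cq | exact: comput_cmul | exact: comput_cmulV].
Qed.

Lemma comput_ceval n a b c : comput n a -> comput n b -> comput n c ->
  comput n (fun xs => ceval (a xs) (b xs) (c xs)).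
Proof.
apply: (comput3 (f := ceval)).
apply: (comput_foldr (n := 3) (c := fun xs => nth 0 xs 2) (z := fun=> 0)
  (g := fun ys => cact (nth 0 ys 2) (nth 0 ys 3) (nth 0 ys 0) (nth 0 ys 1))).
- exact: comput_nth.
- exact: comput_const.
by apply: comput_cact; exact: comput_nth.
Qed.

(** * The algorithm *)

(** It exceeds the codes of all words within the length bounds of either alternative of
    [stable_dichotomy]. *)
Definition search_bound (L : nat) : nat := 16 ^ (preim_bound L + (fix_bound L + L)).

Section ComputBounds.
Variables (n : nat) (a b c : seq nat -> nat).
Hypotheses (ca : comput n a) (cb : comput n b) (cc : comput n c).

Lemma comput_double : comput n (fun xs => (a xs).*2).
Proof. by apply: comput_ext (comput_add ca ca) => xs _; rewrite addnn. Qed.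

Lemma comput_run_bound : comput n (fun xs => run_bound (a xs) (b xs) (c xs)).
Proof.
move: ca cb cc; apply: (comput3 (f := run_bound)).
apply: comput_ext (comput_iteri (n := 3) (k := fun xs => nth 0 xs 2) (b := fun=> 0)
  (g := fun ys => nth 0 ys 1 + (nth 0 ys 2 + nth 0 ys 3 * nth 0 ys 1)) _ _ _).
- by move=> xs _ /=; elim: (nth 0 xs 2) => //= m ->.
- exact: comput_nth.
- exact: comput_const.
by apply: comput_add; [|apply: comput_add; [|apply: comput_mul]]; exact: comput_nth.
Qed.

End ComputBounds.

Ltac arith := repeat first
  [ assumption | apply: comput_const | apply: comput_run_bound | apply: comput_succ
  | apply: comput_double | apply: comput_exp | apply: comput_mul | apply: comput_add ].

Lemma comput_search_bound n a : comput n a -> comput n (fun xs => search_bound (a xs)).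
Proof.
have core k e : comput k e -> comput k (fun xs => core_bound (e xs)).
  by move=> ce; rewrite /core_bound; arith.
have ax k e : comput k e -> comput k (fun xs => axis_bound (e xs)).
  by move=> ce; rewrite /axis_bound; apply: comput_add; [|apply: comput_mul]; rewrite /=; try apply: core; arith.
move=> ca; rewrite /search_bound /preim_bound /fix_bound.
apply: comput_exp; first exact: comput_const.
apply: comput_add; first by arith.
by apply: comput_add => //; apply: comput_mul; [arith | apply/comput_succ/comput_double/ax; arith].
Qed.

Definition csurj (M u v : nat) : bool :=
  has (fun c => ceval u v c == 1) (iota 0 M) && has (fun c => ceval u v c == 4) (iota 0 M).

(* 1 and 4 are the codes of a and b, so the middle condition says that c is   *)
(* the code of a reduced word.                                                *)
Definition cfix (u v c : nat) : bool :=
  [&& 0 < c, ceval 1 4 c == c & ceval u v (ceval u v c) == c].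

Definition cmin (M u v c : nat) : bool :=
  cfix u v c && ~~ has (fun d => cfix u v d && (csize d < csize c)) (iota 0 M).

(** The value is M itself when the search fails. *)
Definition croot (M u v : nat) : nat := find (cmin M u v) (iota 0 M).

Lemma comput_cfix n a b c : comput n a -> comput n b -> comput n c ->
  computb n (fun xs => cfix (a xs) (b xs) (c xs)).
Proof.
move=> ca cb cc; apply: computb_and; first by apply: computb_lt => //; exact: comput_const.
apply: computb_and; apply: computb_eq => //; apply: comput_ceval => //; try exact: comput_const.
exact: comput_ceval.
Qed.

Lemma computb_csurj n m a b : comput n m -> comput n a -> comput n b ->
  computb n (fun xs => csurj (m xs) (a xs) (b xs)).
Proof.
move=> cm ca cb.
have h k : computb n (fun xs => has (fun c => ceval (a xs) (b xs) c == k) (iota 0 (m xs))).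
  apply: (computb_has (P := fun ys => ceval (a (behead ys)) (b (behead ys)) (nth 0 ys 0) == k)) => //.
  apply: computb_eq; last exact: comput_const.
  by apply: comput_ceval; [exact: comput_behead | exact: comput_behead | exact: comput_nth].
by apply: computb_and.
Qed.

Lemma comput_croot n m a b : comput n m -> comput n a -> comput n b ->
  comput n (fun xs => croot (m xs) (a xs) (b xs)).
Proof.
move=> cm ca cb.
apply: (comput_find (P := fun ys => cmin (m (behead ys)) (a (behead ys)) (b (behead ys)) (nth 0 ys 0))) => //.
have bh e : comput n e -> comput n.+1 (fun ys => e (behead ys)) by exact: comput_behead.
have bh2 e : comput n e -> comput n.+2 (fun ys => e (behead (behead ys))).
  by move=> ce; apply: (comput_behead (f := fun ys => e (behead ys))); exact: comput_behead.
apply: computb_and; first by apply: comput_cfix; [exact: bh | exact: bh | exact: comput_nth].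
apply/computb_not/(computb_has (P := fun zs => cfix (a (behead (behead zs))) (b (behead (behead zs))) (nth 0 zs 0)
   && (csize (nth 0 zs 0) < csize (nth 0 (behead zs) 0)))); first exact: bh.
apply: computb_and; first by apply: comput_cfix; [exact: bh2 | exact: bh2 | exact: comput_nth].
apply: computb_lt; apply: comput_csize; first exact: comput_nth.
by apply: (comput_behead (f := fun ys => nth 0 ys 0)); exact: comput_nth.
Qed.

Definition basis (u v : F2) : seq F2 :=
  let M := search_bound (len (u : F) + len (v : F)) in
  if csurj M (word_code u) (word_code v) then [:: gen_a; gen_b]
  else if croot M (word_code u) (word_code v) < M
  then [:: word_decode (croot M (word_code u) (word_code v))] else [::].

Lemma ceval_id c : ceval 1 4 c = word_code (word_decode c).
Proof. by rewrite -[in RHS](e2_id (word_decode c)) -cevalE. Qed.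

Lemma cfixE (u v : F) c : cfix (word_code u) (word_code v) c ->
  exists x : F, [/\ c = word_code x, (x != 1)%g & e2 u v (e2 u v x) = x].
Proof.
case/and3P => c0 /eqP ec /eqP ex.
have e1 : c = word_code (word_decode c).
  by rewrite -{1}ec ceval_id.
exists (word_decode c); split=> //.
  by apply: contraTneq c0 => e; rewrite e1 e.
by apply: word_code_inj; rewrite -e1 -[in RHS]ex !cevalE !word_codeK.
Qed.

Lemma cfix_word (u v x : F) : (x != 1)%g -> e2 u v (e2 u v x) = x ->
  cfix (word_code u) (word_code v) (word_code x).
Proof.
move=> x1 ex; apply/and3P; split.
- by rewrite lt0n code_eq0 -size_eq0 size_map -/(len x) len_eq0.
- by rewrite ceval_id word_codeK.
by rewrite !cevalE !word_codeK ex.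
Qed.

Lemma croot_min M u v : croot M u v < M -> cmin M u v (croot M u v).
Proof.
move=> lt; have := @nth_find _ 0 (cmin M u v) (iota 0 M).
by rewrite has_find size_iota -/(croot M u v) => /(_ lt); rewrite nth_iota.
Qed.

Lemma computable_basis : computable_words basis.
Proof.
pose M (xs : seq nat) := search_bound (csize (nth 0 xs 0) + csize (nth 0 xs 1)).
have cM : comput 2 M.
  by apply: comput_search_bound; apply: comput_add; apply: comput_csize; exact: comput_nth.
have c0 : comput 2 (fun xs => nth 0 xs 0) by exact: comput_nth.
have c1 : comput 2 (fun xs => nth 0 xs 1) by exact: comput_nth.
have cr := comput_croot cM c0 c1.
(* In the cyclic case the number found is already the code of a reduced word, so consing it to 0
   gives the code of the one-element list. *)
have [p h] := comput_if (computb_csurj cM c0 c1) (comput_const 2 (words_code [:: gen_a; gen_b]))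
  (comput_if (computb_lt cr cM) (comput_cconsn cr (comput_const 2 0)) (comput_const 2 0)).
exists p => u v; have := h [:: word_code u; word_code v] erefl.
rewrite /M /= !csizeE /basis.
case: ifP => // _; case: ifP => // lt.
have /andP[/cfixE[x [ec _ _]] _] := croot_min lt.
by rewrite /words_code /= ec word_codeK /cconsn.
Qed.

(** * Free bases of F, of the trivial group and of cyclic subgroups *)

Section FreeBases.
Local Open Scope group_scope.

Lemma free_basis_gens : is_free_basis ([:: ga; gb] : seq F) [set: F]%classic.
Proof.
rewrite /is_free_basis.
have e z : free_lift (fun i : 'I_2 => nth 1 [:: ga; gb] i) z = z.
  have fM := (free_lift_morphism (fun i : 'I_2 => nth 1 [:: ga; gb] i)).2.
  apply: (free_ext fM) => // i; rewrite free_lift_gen.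
  by case: (ord2P i) => ->.
split; first by move=> x y; rewrite /= !e.
by apply/seteqP; split=> // z _; exists z => //; exact: e.
Qed.

Lemma free_basis_nil : is_free_basis ([::] : seq F) [set 1]%classic.
Proof.
have e (z : freegroup 'I_0) : z = 1.
  by apply: word_inj; case: (word z) => // -[[]].
split; first by move=> x y _; rewrite (e x) (e y).
apply/seteqP; split=> [_ [x _ <-]|_ ->] /=; first by rewrite (e x) (mor1 (free_lift_morphism _).2).
by exists 1 => //; exact: (mor1 (free_lift_morphism _).2).
Qed.

(** A free group on one generator consists of the powers of it, and distinct powers of x differ
    because F has no torsion. *)
Lemma free_basis_cyclic (x : F) : x != 1 ->
  is_free_basis [:: x] [set z | exists k, z = xz x k]%classic.
Proof.
move=> x1; pose g : 'I_1 -> F := fun i => nth 1 [:: x] i.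
have fM := (free_lift_morphism g).2.
have pw (z : freegroup 'I_1) : exists k, z = xz (free_gen (ord0 : 'I_1)) k.
  by apply: powers_of_gen => l _; rewrite [LHS]ord1.
have e k : free_lift g (xz (free_gen (ord0 : 'I_1)) k) = xz x k.
  by rewrite (mor_xz _ _ fM) free_lift_gen.
split=> [y z|].
  have [j ->] := pw y; have [k ->] := pw z; rewrite /= -/g.
  by rewrite !e => /(xz_inj x1) ->.
apply/seteqP; split=> [_ [z _ <-]|_ [k ->]] /=.
  by have [k ->] := pw z; exists k; exact: e.
by exists (xz (free_gen (ord0 : 'I_1)) k) => //; exact: e.
Qed.

End FreeBases.

Section Basis.
Local Open Scope group_scope.
Variables (f : F -> F).
Hypothesis fM : {morph f : x y / x * y}.
Let M := search_bound (len (f ga) + len (f gb)).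
Let cu := word_code (f ga).
Let cv := word_code (f gb).

Let fE x : e2 (f ga) (f gb) x = f x.
Proof. by symmetry; apply: e2_ext. Qed.

Lemma csurjP : csurj M cu cv -> forall z, exists t, f t = z.
Proof.
case/andP => /hasP[c1 _ /eqP e1] /hasP[c3 _ /eqP e3] z.
move: e1 e3; rewrite !cevalE !fE => e1 e3.
have ea : f (word_decode c1) = ga by apply: word_code_inj; exact: e1.
have eb : f (word_decode c3) = gb by apply: word_code_inj; exact: e3.
by exists (e2 (word_decode c1) (word_decode c3) z); rewrite (e2_comp _ _ _ fM) ea eb e2_id.
Qed.

Lemma csurj_preim p q : len p <= preim_bound (len (f ga) + len (f gb)) ->
  len q <= preim_bound (len (f ga) + len (f gb)) -> f p = ga -> f q = gb -> csurj M cu cv.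
Proof.
have h x y : len x <= preim_bound (len (f ga) + len (f gb)) -> f x = y ->
    has (fun c => ceval cu cv c == word_code y) (iota 0 M).
  move=> lx ex; apply/hasP; exists (word_code x).
    by rewrite mem_iota /= add0n; apply: word_code_lt; apply: leq_trans lx (leq_addr _ _).
  by rewrite cevalE word_codeK fE ex.
by move=> lp lq ep eq; apply/andP; split; [exact: (h p ga) | exact: (h q gb)].
Qed.

(** The witness f^n(x) works because f^(2n)(x) = x. *)
Lemma stab_fixed x : f (f x) = x -> stab f x.
Proof.
move=> e n; exists (iter n f x); elim: n => // n IH.
by rewrite iterSr -iterS !iterSr e.
Qed.

(** Descend on the length: a candidate that is not shortest below M is replaced by a shorter one. *)
Lemma has_croot c : c < M -> cfix cu cv c -> croot M cu cv < M.
Proof.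
have [n] := ubnP (csize c); elim: n c => // n IH c lt cM fc.
have [/hasP[d]|no] := boolP (has (fun d => cfix cu cv d && (csize d < csize c)) (iota 0 M)).
  by rewrite mem_iota /= add0n => dM /andP[fd ld]; apply: (IH d) => //; lia.
rewrite /croot -[X in _ < X](size_iota 0 M) -has_find; apply/hasP; exists c.
  by rewrite mem_iota.
by rewrite /cmin fc no.
Qed.

(** Preimages found by the search prove f onto. Otherwise [stable_dichotomy] gives a generator x0
    within the range of the search, and the shortest fixed word found must be x0^(+-1). *)
Lemma basis_spec :
  is_free_basis (basis (f ga) (f gb) : seq F) [set z | stab f z]%classic.
Proof.
rewrite /basis -/M -/cu -/cv; case: ifP => [/csurjP fs|nosurj].
  suff -> : [set z | stab f z]%classic = [set: F]%classic by exact: free_basis_gens.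
  apply/seteqP; split=> // z _ n; elim: n z => [|n IH] z; first by exists z.
  by have [y <-] := fs z; have [t <-] := IH y; exists t.
case: (@stable_dichotomy f _ fM (leqnn _)) => [[p [q [lp lq ep eq]]]|[x0 [l0 f0 K0]]].
  by rewrite (csurj_preim lp lq ep eq) in nosurj.
have -> : [set z | stab f z]%classic = [set z | exists k, z = xz x0 k]%classic.
  by apply/seteqP; split=> z /K0.
have x0M : word_code x0 < M.
  by apply: word_code_lt; apply: leq_trans l0 _; rewrite leq_addl.
case: ifP => [lt|nofix]; last first.
  have [->|x1] := eqVneq x0 1; last first.
    by rewrite (has_croot x0M) ?cfix_word ?fE // in nofix.
  suff -> : [set z | exists k, z = xz 1 k]%classic = [set 1 : F]%classic by exact: free_basis_nil.
  apply/seteqP; split=> z /=; last by move=> ->; exists 0%R.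
  by case=> -[] n -> /=; rewrite expg1n ?invg1.
have /andP[/cfixE[x [ex x1 fx]] /hasPn mn] := croot_min lt.
rewrite !fE in fx; rewrite ex word_codeK.
(* x is fixed by f^2, hence stable, hence a power of x0. *)
have [k ek] := (K0 x).1 (stab_fixed fx).
have x01 : x0 != 1.
  by apply: contra x1 => /eqP x01; rewrite ek x01; case: (k) => n /=; rewrite expg1n ?invg1.
have lex : len x <= len x0.
  have := mn (word_code x0); rewrite mem_iota add0n x0M cfix_word ?fE // ex !csizeE.
  by rewrite -leqNgt; apply.
(* x is no longer than x0, and proper powers of x0 are strictly longer than x0. *)
have k1 : (k = 1 \/ k = -1)%R.
  have := len_xz_le x01 (_ : len (xz x0 k) <= len x0); rewrite -ek => /(_ lex).
  have : k != 0%R by apply: contraNneq x1 => k0; rewrite ek k0.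
  lia.
suff -> : [set z | exists k, z = xz x0 k]%classic = [set z | exists k, z = xz x k]%classic.
  exact: free_basis_cyclic.
apply/seteqP; split=> z [j ->] /=; rewrite ek.
  by exists (k * j)%R; rewrite -xzM GRing.mulrA; case: k1 => ->; congr (xz _ _); lia.
by exists (k * j)%R; rewrite xzM.
Qed.
End Basis.

Theorem corollary2 :
  exists basis : F2 -> F2 -> seq F2,
    computable_words basis /\
    forall psi : {multiplicative F2 -> F2},
      is_free_basis (basis (psi gen_a) (psi gen_b)) (stable_image psi).
Proof.
exists basis; split; first exact: computable_basis.
move=> psi; have psiM : {morph (psi : F -> F) : x y / (x * y)%g} by exact: gmulfM.
suff -> : stable_image psi = [set z | stab (psi : F -> F) z]%classic by exact: basis_spec.
apply/seteqP; split=> z /= h.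
  (* [stab] counts iterates from 0 and [stable_image] from 1; at 0 the element is its own
     witness. *)
  case=> [|n]; first by exists z.
  by have [t _ et] := h n.+1 isT; exists t.
by move=> n _; have [t et] := h n; exists t.
Qed.
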